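(* Let $\alpha\in(0,1)$, $q\in\mathbb{N}$, and let $f$ be a $q$-periodic arithmetic function. Then $L(s,f)$ has the Taylor expansion at $s=\alpha$ $$L(s,f)=\sum_{k=0}^{\infty}\frac{(-1)^k}{k!}\left(\sum_{r=1}^{q} f(r)\zeta_k(\alpha,r,q)\right)(s-\alpha)^k,$$ valid for $s\in D_\alpha:=\{s\in\mathbb{C}:|s-\alpha|<|\alpha-1|\}$. In particular, for every $k\in\mathbb{N}_0$, $$L^{(k)}(\alpha,f)=(-1)^k\sum_{r=1}^{q}f(r)\zeta_k(\alpha,r,q).$$
   Context: $L(s,f)=\sum_{n\ge1}f(n)n^{-s}$ for $\Re(s)>1$, meromorphically continued (equivalently $L(s,f)=\sum_{r=1}^q f(r)\zeta(s;r,q)$ with $\zeta(s;r,q)=\sum_{n\ge1,\,n\equiv r\bmod q}n^{-s}$ continued). For $\alpha\in(0,1)$, $k\in\mathbb{N}_0$: $\zeta_k(\alpha,r,q):=\lim_{x\to\infty}\Big(\sum_{1\le n\le x,\ n\equiv r \bmod q}\frac{\log^k n}{n^{\alpha}}-\frac{I_k(x,\alpha)}{q}\Big)$, where $I_k(x,\alpha)=x^{1-\alpha}\sum_{i=0}^{k}(-1)^i\frac{k!}{(k-i)!}\frac{\log^{k-i}x}{(1-\alpha)^{i+1}}$. *)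

(* Defs.v *)
From Stdlib Require Import Reals Arith Factorial.
From Coquelicot Require Import Coquelicot.
Open Scope R_scope.

Definition Cexp (z : C) : C :=
  (exp (Re z) * cos (Im z), exp (Re z) * sin (Im z)).

(* Intended for n >= 1 only. *)
Definition ncpow (n : nat) (s : C) : C := Cexp (Cmult s (RtoC (ln (INR n)))).

(* An arithmetic function is encoded as [nat -> C]; its value at 0 is
   irrelevant. *)
Definition periodic (q : nat) (f : nat -> C) : Prop :=
  forall n : nat, (1 <= n)%nat -> f (n + q)%nat = f n.

Definition Cdifferentiable (F : C -> C) (s : C) : Prop :=
  @ex_derive C_AbsRing C_NormedModule F s.

(* L is the meromorphic continuation of sum_{n>=1} f(n) n^{-s}, holomorphic
   except for at most a pole at s = 1.  By the identity theorem this determines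
   L away from 1; the value of the total function L at 1 is unconstrained. *)
Definition is_L_function (f : nat -> C) (L : C -> C) : Prop :=
  (forall s : C, 1 < Re s ->
     @is_series C_AbsRing C_NormedModule
       (fun m : nat => Cmult (f (S m)) (ncpow (S m) (Copp s))) (L s))
  /\ (forall s : C, s <> RtoC 1 -> Cdifferentiable L s)
  /\ (exists (N : nat) (l : C),
        filterlim (fun s : C => Cmult (Cpow (Cminus s (RtoC 1)) N) (L s))
          (@locally' C_UniformSpace (RtoC 1)) (@locally C_UniformSpace l)).

Definition I_main (k : nat) (x alpha : R) : R :=
  Rpower x (1 - alpha) *
  sum_f_R0 (fun i : nat =>
    (-1) ^ i * (INR (fact k) / INR (fact (k - i))) *
    (ln x ^ (k - i) / (1 - alpha) ^ (i + 1))) k.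

Definition zeta_partial (k : nat) (alpha : R) (r q : nat) (x : R) : R :=
  sum_n_m (fun n : nat =>
      if Nat.eqb (n mod q) (r mod q)
      then ln (INR n) ^ k / Rpower (INR n) alpha else 0)
    1 (Z.to_nat (Int_part x))
  - I_main k x alpha / INR q.

(* Coquelicot's [Lim] agrees with the limit over real x whenever the latter
   exists; it carries no information otherwise. *)
Definition zeta_k (k : nat) (alpha : R) (r q : nat) : R :=
  real (Lim (zeta_partial k alpha r q) p_infty).

Definition sum_f_zeta (f : nat -> C) (k : nat) (alpha : R) (q : nat) : C :=
  @sum_n_m C_AbelianGroup
    (fun r : nat => Cmult (f r) (RtoC (zeta_k k alpha r q))) 1 q.

(* Complex analogues of [Derive_n] and [is_derive_n].  [C_derive] only takes a
   limit in the real direction, hence the relational form for statements. *)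
Fixpoint C_derive_n (F : C -> C) (n : nat) : C -> C :=
  match n with
  | O => F
  | S m => C_derive (C_derive_n F m)
  end.

Definition is_C_derive_n (F : C -> C) (n : nat) (s l : C) : Prop :=
  match n with
  | O => F s = l
  | S m => @is_derive C_AbsRing C_NormedModule (C_derive_n F m) s l
  end.

(* Main.v *)
Require Import Defs.
From Stdlib Require Import Reals Arith Factorial.
From Stdlib Require Import ZArith Lra Lia Classical ClassicalEpsilon.
From Coquelicot Require Import Coquelicot.
Open Scope R_scope.

(** For [0 < Re s], [s <> 1] the truncated sums
    [sum_(n <= x, n = r mod q) n^-s - x^(1-s) / (q (1-s))] converge locally
    uniformly as [x] tends to infinity: a step of the sum is compared with
    [(1/q) int t^-s dt] through
    [|n^-s - t^-s| <= (|s| / Re s) (n^-(Re s) - t^-(Re s))], which telescopes.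
    The [k]-th Taylor coefficient of the truncated sum at [alpha] is
    [(-1)^k / k!] times the quantity whose limit defines [zeta_k], because
    [I_k(x, s)] is, up to the sign [(-1)^k], the [k]-th [s]-derivative of
    [x^(1-s) / (1-s)]. As Taylor coefficients are circle integrals, they pass to
    the uniform limit, which gives both the existence of [zeta_k] and its value.
    The combination of the limits with weights [f r] agrees with [L] for
    [1 < Re s], hence near [alpha] by the identity theorem, and Taylor's theorem
    for [L] on the disc around [alpha] that reaches up to the pole concludes.

    The function theory starts from pointwise complex differentiability.
    Goursat's theorem, applied to [F (a + exp w)] on a rectangle of height
    [2 PI], shows that the mean of [F] over a circle around [a] does not depend on
    the radius; Cauchy's formula and the Taylor series follow. *)

(** * Complex continuity and differentiability *)

(** Differentiability is given pointwise, with no continuity of the derivative, so Cauchy's theorem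
    cannot be drawn from Green's formula or from differentiating the circle mean in the radius. This
    is what forces the bisection argument.

    Two radii have to be kept apart. The approximations converge only for [0 < Re s], so
    coefficients can be compared only on circles of radius below [Rmin alpha (1 - alpha)], while the
    claimed disc has radius [1 - alpha] and leaves that half-plane when [alpha < 1 / 2]. Out there
    only [L] itself is known to be holomorphic; the independence of Taylor coefficients from the
    radius bridges the gap.

    The correction [x^(1-s) / (q (1-s))] carries no additive constant: for [1 < Re s] it tends to 0,
    so the limit there is the Dirichlet series itself, and the same formula keeps making sense on
    the other side of the line [Re s = 1]. *)

Lemma continuous_C_pair (U : UniformSpace) (F : U -> C) (x : U) :
  continuous (U := C_UniformSpace) F x <->
  continuous (fun u => Re (F u)) x /\ continuous (fun u => Im (F u)) x.
Proof.
  split.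
  - intros H; split.
    + apply (continuous_comp F (fun z : C => fst z)); [exact H|].
      apply continuous_fst.
    + apply (continuous_comp F (fun z : C => snd z)); [exact H|].
      apply continuous_snd.
  - intros [H1 H2].
    apply (continuous_ext (fun u => (Re (F u), Im (F u)))).
    { intros u; now destruct (F u). }
    intros P [e He].
    assert (A1 := H1 (fun y => Rabs (y - Re (F x)) < e)).
    assert (A2 := H2 (fun y => Rabs (y - Im (F x)) < e)).
    unfold filtermap in *.
    assert (B1 : locally x (fun u => Rabs (Re (F u) - Re (F x)) < e)).
    { apply A1. exists e. intros y Hy. exact Hy. }
    assert (B2 : locally x (fun u => Rabs (Im (F u) - Im (F x)) < e)).
    { apply A2. exists e. intros y Hy. exact Hy. }
    generalize (filter_and _ _ B1 B2). apply filter_imp.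
    intros u [C1 C2]. apply He. split; assumption.
Qed.

Lemma continuous_Cplus (U : UniformSpace) (F G : U -> C) (x : U) :
  continuous F x -> continuous G x ->
  continuous (U := C_UniformSpace) (fun u => Cplus (F u) (G u)) x.
Proof.
  rewrite !continuous_C_pair. intros [? ?] [? ?]; simpl; split;
  now apply (continuous_plus (V := R_NormedModule)).
Qed.

Lemma continuous_Copp (U : UniformSpace) (F : U -> C) (x : U) :
  continuous F x -> continuous (U := C_UniformSpace) (fun u => Copp (F u)) x.
Proof.
  rewrite !continuous_C_pair. intros [? ?]; simpl; split;
  now apply (continuous_opp (V := R_NormedModule)).
Qed.

Lemma continuous_Cminus (U : UniformSpace) (F G : U -> C) (x : U) :
  continuous F x -> continuous G x ->
  continuous (U := C_UniformSpace) (fun u => Cminus (F u) (G u)) x.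
Proof.
  intros. apply continuous_Cplus; [assumption|now apply continuous_Copp].
Qed.

Lemma continuous_Cmult (U : UniformSpace) (F G : U -> C) (x : U) :
  continuous F x -> continuous G x ->
  continuous (U := C_UniformSpace) (fun u => Cmult (F u) (G u)) x.
Proof.
  rewrite !continuous_C_pair. intros [? ?] [? ?]; simpl; split.
  - apply (continuous_minus (V := R_NormedModule));
      now apply (continuous_mult (K := R_AbsRing)).
  - apply (continuous_plus (V := R_NormedModule));
      now apply (continuous_mult (K := R_AbsRing)).
Qed.

Lemma continuous_Cinv (U : UniformSpace) (F : U -> C) (x : U) :
  continuous F x -> F x <> RtoC 0 ->
  continuous (U := C_UniformSpace) (fun u => Cinv (F u)) x.
Proof.
  intros HF Hnz.
  assert (N : (Re (F x)) ^ 2 + (Im (F x)) ^ 2 <> 0).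
  { intros E. apply Hnz. destruct (F x) as [p r]; simpl in *.
    unfold RtoC. f_equal; nra. }
  rewrite !continuous_C_pair in *. destruct HF as [H1 H2]; simpl.
  assert (D : continuous
     (fun u => / (Re (F u) * (Re (F u) * 1) + Im (F u) * (Im (F u) * 1))) x).
  { apply (continuous_comp
      (fun u => Re (F u) * (Re (F u) * 1) + Im (F u) * (Im (F u) * 1)) Rinv).
    - assert (S : forall g : U -> R, continuous g x ->
        continuous (fun u => g u * (g u * 1)) x).
      { intros g Hg. apply (continuous_mult (K := R_AbsRing) g (fun u => g u * 1));
          [assumption|].
        apply (continuous_mult (K := R_AbsRing) g (fun _ => 1)); [assumption|].
        apply continuous_const. }
      exact (continuous_plus (V := R_NormedModule) _ _ _ (S _ H1) (S _ H2)).
    - apply continuous_Rinv. exact N. }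
  split; unfold Rdiv;
  apply (continuous_mult (K := R_AbsRing)); try assumption.
  now apply (continuous_opp (V := R_NormedModule)).
Qed.

Lemma continuous_Cdiv (U : UniformSpace) (F G : U -> C) (x : U) :
  continuous F x -> continuous G x -> G x <> RtoC 0 ->
  continuous (U := C_UniformSpace) (fun u => Cdiv (F u) (G u)) x.
Proof.
  intros. apply continuous_Cmult; [assumption|now apply continuous_Cinv].
Qed.

Lemma continuous_Cpow (U : UniformSpace) (F : U -> C) (x : U) (n : nat) :
  continuous F x -> continuous (U := C_UniformSpace) (fun u => Cpow (F u) n) x.
Proof.
  intros H; induction n as [|n IH]; simpl.
  - apply continuous_const.
  - now apply continuous_Cmult.
Qed.

Lemma continuous_RtoC (U : UniformSpace) (F : U -> R) (x : U) :
  continuous F x -> continuous (U := C_UniformSpace) (fun u => RtoC (F u)) x.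
Proof.
  intros H. apply continuous_C_pair; simpl; split; [assumption|].
  apply continuous_const.
Qed.

(** The balls of [C_UniformSpace] are squares; passing between squares and discs costs a factor
    [sqrt 2]. *)
Lemma locally_C_iff (z : C) (P : C -> Prop) :
  @locally C_UniformSpace z P <->
  exists d : R, 0 < d /\ forall s : C, Cmod (Cminus s z) < d -> P s.
Proof.
  split.
  - intros [d Hd]. exists d. split; [apply cond_pos|].
    intros s Hs. apply Hd. now apply C_NormedModule_mixin_compat1.
  - intros (d & Hd & H).
    assert (H2 : 0 < sqrt 2) by (apply sqrt_lt_R0; lra).
    assert (Hd2 : 0 < d / sqrt 2) by now apply Rdiv_lt_0_compat.
    exists (mkposreal _ Hd2). intros s Hs. apply H.
    replace d with (sqrt 2 * mkposreal _ Hd2) by (simpl; field; lra).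
    now apply C_NormedModule_mixin_compat2.
Qed.

Lemma continuous_Cmod_iff (U : UniformSpace) (F : U -> C) (x : U) :
  continuous (U := C_UniformSpace) F x <->
  forall e : R, 0 < e -> locally x (fun u => Cmod (Cminus (F u) (F x)) < e).
Proof.
  split.
  - intros H e He. apply (H (fun w => Cmod (Cminus w (F x)) < e)).
    apply locally_C_iff. now exists e.
  - intros H P HP. apply locally_C_iff in HP. destruct HP as (d & Hd & HP).
    unfold filtermap. generalize (H d Hd). apply filter_imp.
    intros u Hu. now apply HP.
Qed.

(* Caratheodory's form of complex differentiability. *)
Definition cderiv (F : C -> C) (z l : C) : Prop :=
  exists phi : C -> C, continuous (T := C_UniformSpace) (U := C_UniformSpace) phi z /\
    phi z = l /\ forall s, F s = Cplus (F z) (Cmult (phi s) (Cminus s z)).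

Definition holo (F : C -> C) (z : C) : Prop := exists l, cderiv F z l.

Lemma Cminus_eq_0 (x y : C) : Cminus x y = RtoC 0 -> x = y.
Proof.
  intros H. replace x with (Cplus y (Cminus x y)) by ring. rewrite H. ring.
Qed.

Lemma Cminus_neq_0 (x y : C) : x <> y -> Cminus x y <> RtoC 0.
Proof. intros H E; now apply H, Cminus_eq_0. Qed.

Lemma Ceq_dec (x y : C) : {x = y} + {x <> y}.
Proof. apply excluded_middle_informative. Qed.

Lemma cderiv_intro (F : C -> C) (z l : C) :
  (forall e, 0 < e -> exists d, 0 < d /\ forall s, Cmod (Cminus s z) < d ->
     Cmod (Cminus (Cminus (F s) (F z)) (Cmult l (Cminus s z)))
       <= e * Cmod (Cminus s z)) ->
  cderiv F z l.
Proof.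
  intros H.
  exists (fun s => if Ceq_dec s z then l
                   else Cdiv (Cminus (F s) (F z)) (Cminus s z)).
  split; [|split].
  - apply continuous_Cmod_iff. intros e He.
    destruct (H (e / 2) ltac:(lra)) as (d & Hd & B).
    apply locally_C_iff. exists d. split; [assumption|].
    intros s Hs.
    destruct (Ceq_dec z z) as [_|n]; [|now destruct n].
    destruct (Ceq_dec s z) as [E|E].
    + replace (Cminus l l) with (RtoC 0) by ring. rewrite Cmod_0. lra.
    + assert (E' := Cminus_neq_0 _ _ E).
      replace (Cminus (Cdiv (Cminus (F s) (F z)) (Cminus s z)) l) with
        (Cdiv (Cminus (Cminus (F s) (F z)) (Cmult l (Cminus s z))) (Cminus s z))
        by (field; assumption).
      rewrite Cmod_div by assumption.
      assert (P := proj1 (Cmod_gt_0 _) E').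
      apply Rle_lt_trans with (e / 2); [|lra].
      apply Rmult_le_reg_r with (Cmod (Cminus s z)); [assumption|].
      unfold Rdiv at 1. rewrite Rmult_assoc, Rinv_l by lra.
      rewrite Rmult_1_r. now apply B.
  - now destruct (Ceq_dec z z).
  - intros s. destruct (Ceq_dec s z) as [E|E].
    + subst s. ring.
    + field. now apply Cminus_neq_0.
Qed.

(** The form in which derivatives are verified below: the exponential and the Cauchy kernels both
    have explicit quadratic remainders, and such bounds survive integration over a circle. *)
Lemma cderiv_of_quadratic (F : C -> C) (z l : C) (K d : R) :
  0 < d -> 0 <= K ->
  (forall w, Cmod w < d ->
     Cmod (Cminus (Cminus (F (Cplus z w)) (F z)) (Cmult l w)) <= K * Cmod w ^ 2) ->
  cderiv F z l.
Proof.
  intros Hd HK H. apply cderiv_intro. intros e He.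
  exists (Rmin d (e / (K + 1))).
  assert (Q : 0 < e / (K + 1)) by (apply Rdiv_lt_0_compat; lra).
  split; [now apply Rmin_pos|]. intros s Hs.
  assert (H1 := Rmin_l d (e / (K + 1))). assert (H2 := Rmin_r d (e / (K + 1))).
  assert (B := H (Cminus s z) ltac:(lra)).
  replace (Cplus z (Cminus s z)) with s in B by ring.
  eapply Rle_trans; [exact B|].
  assert (M := Cmod_ge_0 (Cminus s z)).
  simpl. rewrite Rmult_1_r, <- Rmult_assoc.
  apply Rmult_le_compat_r; [assumption|].
  apply Rle_trans with (K * (e / (K + 1))).
  - apply Rmult_le_compat_l; lra.
  - replace (K * (e / (K + 1))) with (e - e / (K + 1)) by (field; lra). lra.
Qed.

Lemma cderiv_is_derive (F : C -> C) (z l : C) :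
  cderiv F z l <-> @is_derive C_AbsRing C_NormedModule F z l.
Proof.
  split.
  - intros (phi & Hc & Hl & HF). split.
    + apply is_linear_scal_l.
    + intros x Hx. apply (@is_filter_lim_locally_unique C_AbsRing (AbsRing_NormedModule C_AbsRing)) in Hx. subst x.
      intros e.
      assert (A := proj1 (continuous_Cmod_iff _ _ _) Hc e (cond_pos e)).
      apply locally_C_iff in A. destruct A as (d & Hd & HA).
      exists (mkposreal d Hd). intros s Hs. 
      change (Cmod (Cminus (Cminus (F s) (F z)) (Cmult (Cminus s z) l))
              <= e * Cmod (Cminus s z)).
      rewrite (HF s), <- Hl.
      replace (Cminus (Cminus (Cplus (F z) (Cmult (phi s) (Cminus s z))) (F z))
         (Cmult (Cminus s z) (phi z)))
        with (Cmult (Cminus (phi s) (phi z)) (Cminus s z)) by ring.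
      rewrite Cmod_mult. apply Rmult_le_compat_r; [apply Cmod_ge_0|].
      apply Rlt_le, HA. exact Hs.
  - intros [_ H]. apply cderiv_intro. intros e He.
    destruct (H z (fun P HP => HP) (mkposreal e He)) as [d Hd].
    exists d. split; [apply cond_pos|]. intros s Hs. rewrite (Cmult_comm l).
    exact (Hd s Hs).
Qed.

Lemma holo_Cdifferentiable (F : C -> C) (z : C) :
  holo F z <-> Cdifferentiable F z.
Proof.
  split; intros [l Hl]; exists l; now apply cderiv_is_derive.
Qed.

Lemma cderiv_continuous (F : C -> C) (z l : C) :
  cderiv F z l -> continuous (T := C_UniformSpace) (U := C_UniformSpace) F z.
Proof.
  intros (phi & Hc & _ & HF).
  apply continuous_ext with
    (fun s => Cplus (F z) (Cmult (phi s) (Cminus s z))).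
  { intros; now rewrite <- HF. }
  apply continuous_Cplus; [apply continuous_const|].
  apply continuous_Cmult; [assumption|].
  apply continuous_Cminus; [apply continuous_id|apply continuous_const].
Qed.

Lemma holo_continuous (F : C -> C) (z : C) :
  holo F z -> continuous (T := C_UniformSpace) (U := C_UniformSpace) F z.
Proof. intros [l H]; now apply cderiv_continuous with l. Qed.

Lemma cderiv_const (c z : C) : cderiv (fun _ => c) z (RtoC 0).
Proof.
  exists (fun _ => RtoC 0). split; [apply continuous_const|].
  split; [reflexivity|intros; ring].
Qed.

Lemma cderiv_id (z : C) : cderiv (fun s => s) z (RtoC 1).
Proof.
  exists (fun _ => RtoC 1). split; [apply continuous_const|].
  split; [reflexivity|intros; ring].
Qed.

Lemma cderiv_plus (F G : C -> C) (z l m : C) :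
  cderiv F z l -> cderiv G z m ->
  cderiv (fun s => Cplus (F s) (G s)) z (Cplus l m).
Proof.
  intros (p & Hp & Hl & HF) (r & Hr & Hm & HG).
  exists (fun s => Cplus (p s) (r s)).
  split; [now apply continuous_Cplus|].
  split; [now subst|intros s; rewrite (HF s), (HG s); ring].
Qed.

Lemma cderiv_mult (F G : C -> C) (z l m : C) :
  cderiv F z l -> cderiv G z m ->
  cderiv (fun s => Cmult (F s) (G s)) z (Cplus (Cmult l (G z)) (Cmult (F z) m)).
Proof.
  intros HFd HGd. assert (cG := cderiv_continuous _ _ _ HGd).
  destruct HFd as (p & Hp & Hl & HF). destruct HGd as (r & Hr & Hm & HG).
  exists (fun s => Cplus (Cmult (p s) (G s)) (Cmult (F z) (r s))).
  split.
  - apply continuous_Cplus; apply continuous_Cmult; try assumption.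
    apply continuous_const.
  - split; [now subst|].
    intros s.
    rewrite (HF s) at 1.
    replace (Cmult (Cplus (F z) (Cmult (p s) (Cminus s z))) (G s)) with
      (Cplus (Cmult (F z) (G s)) (Cmult (Cmult (p s) (G s)) (Cminus s z))) by ring.
    rewrite (HG s) at 1. ring.
Qed.

Lemma cderiv_comp (F G : C -> C) (z l m : C) :
  cderiv G z m -> cderiv F (G z) l ->
  cderiv (fun s => F (G s)) z (Cmult l m).
Proof.
  intros HGd HFd. assert (cG := cderiv_continuous _ _ _ HGd).
  destruct HFd as (p & Hp & Hl & HF). destruct HGd as (r & Hr & Hm & HG).
  exists (fun s => Cmult (p (G s)) (r s)).
  split.
  - apply continuous_Cmult; [|assumption].
    now apply (continuous_comp G p).
  - split; [now subst|].
    intros s. rewrite (HF (G s)).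
    replace (Cminus (G s) (G z)) with (Cmult (r s) (Cminus s z))
      by (rewrite (HG s); ring).
    ring.
Qed.

Lemma continuous_ext_loc_C (U : UniformSpace) (F G : U -> C) (x : U) :
  locally x (fun u => G u = F u) ->
  continuous (U := C_UniformSpace) G x -> continuous (U := C_UniformSpace) F x.
Proof. apply continuous_ext_loc. Qed.

Lemma cderiv_inv (z : C) :
  z <> RtoC 0 -> cderiv Cinv z (Copp (Cinv (Cmult z z))).
Proof.
  intros Hz.
  (* The slope identity is demanded at every [s], also at 0, where [Cinv] has a default value; there
     the slope is whatever quotient makes the identity true. *)
  exists (fun s => if Ceq_dec s (RtoC 0) then Cdiv (Cinv z - Cinv s)%C z
                   else Copp (Cinv (Cmult z s))).
  split.
  - apply continuous_ext_loc_C with (fun s => Copp (Cinv (Cmult z s))).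
    + apply locally_C_iff. exists (Cmod z). split; [now apply Cmod_gt_0|].
      intros s Hs. destruct (Ceq_dec s (RtoC 0)) as [E|E]; [|reflexivity].
      subst s. replace (Cminus (RtoC 0) z) with (Copp z) in Hs by ring.
      rewrite Cmod_opp in Hs. lra.
    + apply continuous_Copp, continuous_Cinv.
      * apply continuous_Cmult; [apply continuous_const|apply continuous_id].
      * now apply Cmult_neq_0.
  - split.
    + destruct (Ceq_dec z (RtoC 0)); [contradiction|reflexivity].
    + intros s. destruct (Ceq_dec s (RtoC 0)) as [E|E].
      * subst s. generalize (Cinv (RtoC 0)); intros c. field. assumption.
      * field. split; assumption.
Qed.

Lemma holo_const (c z : C) : holo (fun _ => c) z.
Proof. eexists; apply cderiv_const. Qed.
Lemma holo_id (z : C) : holo (fun s => s) z.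
Proof. eexists; apply cderiv_id. Qed.
Lemma holo_plus (F G : C -> C) (z : C) :
  holo F z -> holo G z -> holo (fun s => Cplus (F s) (G s)) z.
Proof. intros [? ?] [? ?]; eexists; apply cderiv_plus; eassumption. Qed.
Lemma holo_mult (F G : C -> C) (z : C) :
  holo F z -> holo G z -> holo (fun s => Cmult (F s) (G s)) z.
Proof. intros [? ?] [? ?]; eexists; apply cderiv_mult; eassumption. Qed.
Lemma holo_ext (F G : C -> C) (z : C) :
  (forall s, F s = G s) -> holo F z -> holo G z.
Proof.
  intros E [l (p & H1 & H2 & H3)]. exists l, p. 
  split; [assumption|split; [assumption|]].
  intros s; rewrite <- !E; apply H3.
Qed.
Lemma holo_opp (F : C -> C) (z : C) :
  holo F z -> holo (fun s => Copp (F s)) z.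
Proof.
  intros H. apply holo_ext with (fun s => Cmult (RtoC (-1)) (F s)).
  - intros s. apply injective_projections; simpl; ring.
  - apply holo_mult; [apply holo_const|assumption].
Qed.
Lemma holo_minus (F G : C -> C) (z : C) :
  holo F z -> holo G z -> holo (fun s => Cminus (F s) (G s)) z.
Proof. intros. apply (holo_plus F (fun s => Copp (G s))); [|apply holo_opp]; assumption. Qed.
Lemma holo_comp (F G : C -> C) (z : C) :
  holo G z -> holo F (G z) -> holo (fun s => F (G s)) z.
Proof. intros [? ?] [? ?]; eexists; eapply cderiv_comp; eassumption. Qed.
Lemma holo_inv (F : C -> C) (z : C) :
  holo F z -> F z <> RtoC 0 -> holo (fun s => Cinv (F s)) z.
Proof.
  intros. apply (holo_comp Cinv F); [assumption|].
  eexists; now apply cderiv_inv.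
Qed.
Lemma holo_div (F G : C -> C) (z : C) :
  holo F z -> holo G z -> G z <> RtoC 0 -> holo (fun s => Cdiv (F s) (G s)) z.
Proof. intros. apply (holo_mult F (fun s => Cinv (G s))); [|apply holo_inv]; assumption. Qed.

(** Differentiability is local although the slope identity is global: the slope of [F] serves near
    [z] only, and elsewhere it is replaced by the difference quotient of [G]. *)
Lemma holo_ext_loc (F G : C -> C) (z : C) (d : R) :
  0 < d -> (forall s, Cmod (Cminus s z) < d -> F s = G s) ->
  holo F z -> holo G z.
Proof.
  intros Hd E [l (p & H1 & H2 & H3)]. exists l.
  assert (Ez : F z = G z).
  { apply E. replace (Cminus z z) with (RtoC 0) by ring. now rewrite Cmod_0. }
  exists (fun s => if Ceq_dec s z then l
                   else Cdiv (Cminus (G s) (G z)) (Cminus s z)).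
  split; [|split].
  - apply continuous_ext_loc_C with p; [|assumption].
    apply locally_C_iff. exists d. split; [assumption|].
    intros s Hs. destruct (Ceq_dec s z) as [e|e].
    + now rewrite e.
    + rewrite <- (E s Hs), <- Ez, (H3 s). field. now apply Cminus_neq_0.
  - now destruct (Ceq_dec z z).
  - intros s. destruct (Ceq_dec s z) as [e|e].
    + rewrite e; ring.
    + field. now apply Cminus_neq_0.
Qed.

(** * The complex exponential and its quadratic remainder at 0 *)

Lemma exp_sub_1_bound (u : R) :
  Rabs u <= 1 / 2 -> Rabs (exp u - 1 - u) <= 2 * u ^ 2.
Proof.
  intros H. apply Rabs_le_between in H.
  (* The lower bound is [1 + u <= exp u]; the upper one is the same inequality at [- u], which gives
     [exp u <= 1 / (1 - u)]. *)
  assert (H1 := exp_ineq1_le u). assert (H2 := exp_ineq1_le (- u)).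
  rewrite Rabs_pos_eq by lra.
  assert (H3 : exp u * exp (- u) = 1).
  { rewrite <- exp_plus, Rplus_opp_r. apply exp_0. }
  assert (P := exp_pos u).
  assert (exp u * (1 - u) <= 1) by nra.
  nra.
Qed.

Lemma Rabs_sin_le (x : R) : Rabs (sin x) <= Rabs x.
Proof.
  destruct (MVT_cor4 sin cos 0 (Rabs x)) with (b := x) as (d & Hd & _).
  - intros; apply is_derive_sin.
  - rewrite Rminus_0_r; lra.
  - rewrite sin_0, !Rminus_0_r in Hd. rewrite Hd, Rabs_mult.
    assert (Rabs (cos d) <= 1) by (apply Rabs_le, COS_bound).
    assert (0 <= Rabs x) by apply Rabs_pos. nra.
Qed.

Lemma cos_sub_1_bound (c : R) : Rabs (cos c - 1) <= c ^ 2.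
Proof.
  replace (cos c - 1) with (- (2 * (sin (c / 2) * sin (c / 2)))).
  2:{ replace c with (2 * (c / 2)) at 3 by field. rewrite cos_2a_sin. ring. }
  rewrite Rabs_Ropp, !Rabs_mult, (Rabs_pos_eq 2) by lra.
  assert (T := Rabs_sin_le (c / 2)). unfold Rdiv in *.
  rewrite Rabs_mult, (Rabs_pos_eq (/ 2)) in T by lra.
  assert (0 <= Rabs (sin (c * / 2))) by apply Rabs_pos.
  assert (0 <= Rabs c) by apply Rabs_pos.
  rewrite <- (pow2_abs c). nra.
Qed.

Lemma sin_sub_id_bound (v : R) : Rabs v <= 1 -> Rabs (sin v - v) <= v ^ 2.
Proof.
  intros H.
  destruct (MVT_cor4 (fun t => sin t - t) (fun t => cos t - 1) 0 (Rabs v))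
    with (b := v) as (c & Hc & Hc2).
  - intros c _. auto_derive; [trivial|ring].
  - rewrite Rminus_0_r; lra.
  - rewrite sin_0 in Hc. rewrite !Rminus_0_r in Hc2.
    replace (sin v - v) with ((cos c - 1) * v) by lra.
    rewrite Rabs_mult.
    assert (K := cos_sub_1_bound c). rewrite <- pow2_abs in K.
    rewrite <- (pow2_abs v).
    assert (0 <= Rabs v) by apply Rabs_pos.
    assert (0 <= Rabs c) by apply Rabs_pos.
    assert (Rabs (cos c - 1) <= Rabs v) by nra. nra.
Qed.

Lemma Cexp_plus (z w : C) : Cexp (Cplus z w) = Cmult (Cexp z) (Cexp w).
Proof.
  unfold Cexp. rewrite re_plus, im_plus, exp_plus, cos_plus, sin_plus.
  apply injective_projections; simpl; ring.
Qed.

Lemma Cmod_le_Re_Im (z : C) : Cmod z <= Rabs (Re z) + Rabs (Im z).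
Proof.
  assert (H : Cmod z ^ 2 = Re z ^ 2 + Im z ^ 2) by apply Cmod2_alt.
  rewrite <- (pow2_abs (Re z)), <- (pow2_abs (Im z)) in H.
  assert (0 <= Rabs (Re z)) by apply Rabs_pos.
  assert (0 <= Rabs (Im z)) by apply Rabs_pos.
  assert (0 <= Cmod z) by apply Cmod_ge_0. nra.
Qed.

Lemma im_le_Cmod (z : C) : Rabs (Im z) <= Cmod z.
Proof.
  eapply Rle_trans; [|apply Rmax_Cmod]. apply Rmax_r.
Qed.

Lemma Cmod2_sum (z : C) : Cmod z ^ 2 = Re z ^ 2 + Im z ^ 2.
Proof.
  unfold Cmod. rewrite pow2_sqrt; [reflexivity|].
  destruct z as [x y]; simpl. nra.
Qed.

Lemma Cexp_sub_1_bound (w : C) : Cmod w < 1 / 2 ->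
  Cmod (Cminus (Cminus (Cexp w) (RtoC 1)) w) <= 20 * Cmod w ^ 2.
Proof.
  intros H.
  assert (Hu := re_le_Cmod w). assert (Hv := im_le_Cmod w).
  rewrite Cmod2_sum.
  eapply Rle_trans; [apply Cmod_le_Re_Im|].
  destruct w as [u v].
  change (Re (u, v)) with u in *. change (Im (u, v)) with v in *.
  change (Rabs (exp u * cos v + - (1) + - u) + Rabs (exp u * sin v + - 0 + - v)
          <= 20 * (u ^ 2 + v ^ 2)).
  assert (A := exp_sub_1_bound u ltac:(lra)).
  assert (B := cos_sub_1_bound v).
  assert (D := sin_sub_id_bound v ltac:(lra)).
  assert (E : exp u <= 3).
  { apply Rabs_le_between in A. apply Rabs_le_between in Hu. nra. }
  assert (P := exp_pos u).
  (* Every summand now contains a factor of second order or two factors of first order. *)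
  replace (exp u * cos v + - (1) + - u) with ((exp u - 1 - u) + exp u * (cos v - 1)) by ring.
  replace (exp u * sin v + - 0 + - v) with
    (exp u * (sin v - v) + v * (u + (exp u - 1 - u))) by ring.
  assert (T1 := Rabs_triang (exp u - 1 - u) (exp u * (cos v - 1))).
  assert (T2 := Rabs_triang (exp u * (sin v - v)) (v * (u + (exp u - 1 - u)))).
  assert (T3 := Rabs_triang u (exp u - 1 - u)).
  rewrite !Rabs_mult in *. rewrite (Rabs_pos_eq (exp u)) in * by lra.
  rewrite <- (pow2_abs u), <- (pow2_abs v) in *.
  assert (U0 := Rabs_pos u). assert (V0 := Rabs_pos v).
  assert (exp u * Rabs (cos v - 1) <= 3 * Rabs v ^ 2)
    by (apply Rmult_le_compat; try apply Rabs_pos; lra).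
  assert (exp u * Rabs (sin v - v) <= 3 * Rabs v ^ 2)
    by (apply Rmult_le_compat; try apply Rabs_pos; lra).
  assert (Rabs v * Rabs (u + (exp u - 1 - u)) <= Rabs v * (2 * Rabs u)).
  { apply Rmult_le_compat_l; [assumption|].
    assert (0 <= Rabs u * (1 - 2 * Rabs u)) by (apply Rmult_le_pos; lra).
    simpl in A. lra. }
  assert (Q := pow2_ge_0 (Rabs u - Rabs v)).
  set (U := Rabs u) in *. set (V := Rabs v) in *.
  assert (Q1 := pow2_ge_0 U). assert (Q2 := pow2_ge_0 V). lra.
Qed.

Lemma Cexp_Cmod (z : C) : Cmod (Cexp z) = exp (Re z).
Proof.
  unfold Cmod, Cexp; simpl.
  replace (_ + _) with (exp (Re z) * exp (Re z) *
    ((sin (Im z))² + (cos (Im z))²)) by (unfold Rsqr; ring).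
  rewrite sin2_cos2, Rmult_1_r. apply sqrt_square, Rlt_le, exp_pos.
Qed.

Lemma cderiv_Cexp (z : C) : cderiv Cexp z (Cexp z).
Proof.
  apply cderiv_of_quadratic with (K := Cmod (Cexp z) * 20) (d := 1 / 2).
  - lra.
  - assert (M := Cmod_ge_0 (Cexp z)). lra.
  - intros w Hw. rewrite Cexp_plus.
    replace (Cminus (Cminus (Cmult (Cexp z) (Cexp w)) (Cexp z)) (Cmult (Cexp z) w))
      with (Cmult (Cexp z) (Cminus (Cminus (Cexp w) (RtoC 1)) w)) by ring.
    rewrite Cmod_mult, Rmult_assoc. apply Rmult_le_compat_l; [apply Cmod_ge_0|].
    now apply Cexp_sub_1_bound.
Qed.

Lemma holo_Cexp (F : C -> C) (z : C) : holo F z -> holo (fun s => Cexp (F s)) z.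
Proof.
  intros. apply (holo_comp Cexp F); [assumption|].
  eexists; apply cderiv_Cexp.
Qed.

(** * Integrals along paths and bisection of rectangles *)

Definition CInt (f : R -> C) (a b : R) : C :=
  RInt (V := C_R_CompleteNormedModule) f a b.

Definition is_CInt (f : R -> C) (a b : R) (l : C) : Prop :=
  is_RInt (V := C_R_NormedModule) f a b l.

Definition path_continuous (f : R -> C) (t : R) : Prop :=
  continuous (T := R_UniformSpace) (U := C_UniformSpace) f t.

Lemma CInt_correct (f : R -> C) (a b : R) : a <= b ->
  (forall t, a <= t <= b -> path_continuous f t) -> is_CInt f a b (CInt f a b).
Proof.
  intros Hab H. apply (RInt_correct (V := C_R_CompleteNormedModule)).
  apply (ex_RInt_continuous (V := C_R_CompleteNormedModule)).
  intros z Hz. rewrite Rmin_left, Rmax_right in Hz by assumption. now apply H.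
Qed.

Lemma is_CInt_unique (f : R -> C) (a b : R) (l : C) :
  is_CInt f a b l -> CInt f a b = l.
Proof. apply (is_RInt_unique (V := C_R_CompleteNormedModule)). Qed.

Lemma is_CInt_plus (f g : R -> C) (a b : R) (l m : C) :
  is_CInt f a b l -> is_CInt g a b m ->
  is_CInt (fun t => Cplus (f t) (g t)) a b (Cplus l m).
Proof. apply (is_RInt_plus (V := C_R_NormedModule)). Qed.

Lemma is_CInt_minus (f g : R -> C) (a b : R) (l m : C) :
  is_CInt f a b l -> is_CInt g a b m ->
  is_CInt (fun t => Cminus (f t) (g t)) a b (Cminus l m).
Proof. apply (is_RInt_minus (V := C_R_NormedModule)). Qed.

Lemma is_CInt_pair (f : R -> C) (a b : R) (l : C) :
  is_CInt f a b l <->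
  is_RInt (fun t => Re (f t)) a b (Re l) /\ is_RInt (fun t => Im (f t)) a b (Im l).
Proof.
  split.
  - intros H; split.
    + apply (is_RInt_fct_extend_fst (U := R_NormedModule) (V := R_NormedModule) f); exact H.
    + apply (is_RInt_fct_extend_snd (U := R_NormedModule) (V := R_NormedModule) f); exact H.
  - intros [H1 H2]. destruct l as [l1 l2].
    apply (is_RInt_fct_extend_pair (U := R_NormedModule) (V := R_NormedModule) f); assumption.
Qed.

(** For the integral, [C] is a normed module over the reals, so the library's scaling rule covers
    real factors only; a complex factor mixes the coordinates. *)
Lemma is_CInt_Cmult (f : R -> C) (a b : R) (l c : C) :
  is_CInt f a b l -> is_CInt (fun t => Cmult c (f t)) a b (Cmult c l).
Proof.
  rewrite !is_CInt_pair. intros [H1 H2]. destruct c as [p r]; simpl; split.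
  - apply (is_RInt_minus (V := R_NormedModule));
      now apply (is_RInt_scal (V := R_NormedModule)).
  - apply (is_RInt_plus (V := R_NormedModule));
      now apply (is_RInt_scal (V := R_NormedModule)).
Qed.

Lemma is_CInt_ext (f g : R -> C) (a b : R) (l : C) : a <= b ->
  (forall t, a <= t <= b -> f t = g t) -> is_CInt f a b l -> is_CInt g a b l.
Proof.
  intros Hab E. apply (is_RInt_ext (V := C_R_NormedModule)).
  intros t Ht. rewrite Rmin_left, Rmax_right in Ht by assumption. apply E; lra.
Qed.

Lemma CInt_ext (f g : R -> C) (a b : R) : a <= b ->
  (forall t, a <= t <= b -> f t = g t) -> CInt f a b = CInt g a b.
Proof.
  intros Hab E. apply (RInt_ext (V := C_R_CompleteNormedModule)).
  intros t Ht. rewrite Rmin_left, Rmax_right in Ht by assumption. apply E; lra.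
Qed.

Lemma is_CInt_const (c : C) (a b : R) :
  is_CInt (fun _ => c) a b (Cmult (RtoC (b - a)) c).
Proof.
  replace (Cmult (RtoC (b - a)) c) with (scal (V := C_R_NormedModule) (b - a) c).
  - apply (is_RInt_const (V := C_R_NormedModule)).
  - apply injective_projections; simpl; unfold scal; simpl; unfold mult; simpl; ring.
Qed.

Lemma is_CInt_Chasles (f : R -> C) (a b c : R) (l m : C) :
  is_CInt f a b l -> is_CInt f b c m -> is_CInt f a c (Cplus l m).
Proof. apply (is_RInt_Chasles (V := C_R_NormedModule)). Qed.

Lemma is_CInt_norm_le (f : R -> C) (a b M : R) (l : C) : a <= b ->
  (forall t, a <= t <= b -> Cmod (f t) <= M) -> is_CInt f a b l ->
  Cmod l <= M * (b - a).
Proof.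
  intros Hab H Hf. rewrite Cmod_norm.
  apply (norm_RInt_le (V := C_R_NormedModule) f (fun _ => M) a b l); try assumption.
  - intros t Ht. rewrite <- Cmod_norm. now apply H.
  - replace (M * (b - a)) with (scal (b - a) M) by (unfold scal; simpl; unfold mult; simpl; ring).
    apply (is_RInt_const (V := R_NormedModule)).
Qed.

Lemma is_CInt_near (f g : R -> C) (a b M : R) (l m : C) : a <= b ->
  (forall t, a <= t <= b -> Cmod (Cminus (f t) (g t)) <= M) ->
  is_CInt f a b l -> is_CInt g a b m -> Cmod (Cminus l m) <= M * (b - a).
Proof.
  intros Hab H Hf Hg.
  apply is_CInt_norm_le with (fun t => Cminus (f t) (g t)); try assumption.
  now apply is_CInt_minus.
Qed.

(** Again Caratheodory's form, so that products, and compositions with [cderiv], reduce to algebra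
    on the slopes. *)
Definition path_deriv (g : R -> C) (t : R) (v : C) : Prop :=
  exists phi : R -> C, path_continuous phi t /\ phi t = v /\
    forall u, g u = Cplus (g t) (Cmult (phi u) (RtoC (u - t))).

Lemma path_deriv_is_derive (g : R -> C) (t : R) (v : C) :
  path_deriv g t v -> is_derive (V := C_R_NormedModule) g t v.
Proof.
  intros (phi & Hc & Hl & HF). split.
  - apply (is_linear_scal_l (V := C_R_NormedModule)).
  - intros x Hx.
    apply (@is_filter_lim_locally_unique R_AbsRing R_NormedModule) in Hx. subst x.
    intros e.
    assert (A := proj1 (continuous_Cmod_iff _ _ _) Hc e (cond_pos e)).
    revert A. apply filter_imp. intros u A.
    rewrite <- !Cmod_norm.
    match goal with |- Cmod ?X <= _ =>
      replace X with (Cmult (Cminus (phi u) (phi t)) (RtoC (u - t))) end.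
    + rewrite Cmod_mult, Cmod_R.
      apply Rmult_le_compat_r; [apply Rabs_pos|]. now apply Rlt_le.
    + rewrite (HF u), <- Hl.
      apply injective_projections; simpl; unfold minus, plus, opp, scal; simpl;
      unfold mult, minus, plus, opp; simpl; ring.
Qed.

Lemma path_deriv_continuous (g : R -> C) (t : R) (v : C) :
  path_deriv g t v -> path_continuous g t.
Proof.
  intros (phi & Hc & _ & HF).
  apply continuous_ext with
    (fun u => Cplus (g t) (Cmult (phi u) (RtoC (u - t)))).
  { intros; now rewrite <- HF. }
  apply continuous_Cplus; [apply continuous_const|].
  apply continuous_Cmult; [assumption|].
  apply continuous_RtoC.
  apply (continuous_minus (V := R_NormedModule)); [apply continuous_id|apply continuous_const].
Qed.

Lemma path_deriv_RtoC (g : R -> R) (t l : R) :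
  is_derive g t l -> path_deriv (fun u => RtoC (g u)) t (RtoC l).
Proof.
  intros [_ H]. specialize (H t (fun P HP => HP)).
  exists (fun u => RtoC (if Req_EM_T u t then l else (g u - g t) / (u - t))).
  split; [|split].
  - apply continuous_RtoC. intros P [e He].
    assert (He2 : 0 < e / 2) by (destruct e; simpl; lra).
    unfold filtermap. generalize (H (mkposreal _ He2)). apply filter_imp. intros u Hu.
    change (Rabs (g u - g t - (u - t) * l) <= e / 2 * Rabs (u - t)) in Hu.
    apply He.
    destruct (Req_EM_T t t) as [_|n]; [|now destruct n].
    change (Rabs ((if Req_EM_T u t then l else (g u - g t) / (u - t)) - l) < e).
    destruct (Req_EM_T u t) as [E|E].
    + rewrite Rminus_diag, Rabs_R0. apply cond_pos.
    + assert (P' : 0 < Rabs (u - t)) by (apply Rabs_pos_lt; lra).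
      replace ((g u - g t) / (u - t) - l) with ((g u - g t - (u - t) * l) / (u - t))
        by (field; lra).
      unfold Rdiv at 1. rewrite Rabs_mult, Rabs_inv.
      apply Rle_lt_trans with (e / 2); [|lra].
      apply Rmult_le_reg_r with (Rabs (u - t)); [assumption|].
      rewrite Rmult_assoc, Rinv_l by lra. lra.
  - now destruct (Req_EM_T t t).
  - intros u. destruct (Req_EM_T u t) as [E|E].
    + subst u. rewrite Rminus_diag. ring.
    + rewrite <- RtoC_mult, <- RtoC_plus. f_equal. field. lra.
Qed.

Lemma path_deriv_id (t : R) : path_deriv RtoC t (RtoC 1).
Proof. apply (path_deriv_RtoC (fun u => u)), (is_derive_id (K := R_AbsRing)). Qed.

Lemma path_deriv_const (c : C) (t : R) : path_deriv (fun _ => c) t (RtoC 0).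
Proof.
  exists (fun _ => RtoC 0). split; [apply continuous_const|].
  split; [reflexivity|intros; ring].
Qed.

Lemma path_deriv_plus (f g : R -> C) (t : R) (l m : C) :
  path_deriv f t l -> path_deriv g t m ->
  path_deriv (fun u => Cplus (f u) (g u)) t (Cplus l m).
Proof.
  intros (p & Hp & Hl & HF) (r & Hr & Hm & HG).
  exists (fun s => Cplus (p s) (r s)).
  split; [now apply continuous_Cplus|].
  split; [now subst|intros s; rewrite (HF s), (HG s); ring].
Qed.

Lemma path_deriv_mult (f g : R -> C) (t : R) (l m : C) :
  path_deriv f t l -> path_deriv g t m ->
  path_deriv (fun u => Cmult (f u) (g u)) t (Cplus (Cmult l (g t)) (Cmult (f t) m)).
Proof.
  intros HFd HGd. assert (cG := path_deriv_continuous _ _ _ HGd).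
  destruct HFd as (p & Hp & Hl & HF). destruct HGd as (r & Hr & Hm & HG).
  exists (fun s => Cplus (Cmult (p s) (g s)) (Cmult (f t) (r s))).
  split.
  - apply continuous_Cplus; apply continuous_Cmult; try assumption.
    apply continuous_const.
  - split; [now subst|].
    intros s.
    rewrite (HF s) at 1.
    replace (Cmult (Cplus (f t) (Cmult (p s) (RtoC (s - t)))) (g s)) with
      (Cplus (Cmult (f t) (g s)) (Cmult (Cmult (p s) (g s)) (RtoC (s - t)))) by ring.
    rewrite (HG s) at 1. ring.
Qed.

Lemma path_deriv_comp (F : C -> C) (g : R -> C) (t : R) (l m : C) :
  path_deriv g t m -> cderiv F (g t) l ->
  path_deriv (fun u => F (g u)) t (Cmult l m).
Proof.
  intros HGd HFd. assert (cG := path_deriv_continuous _ _ _ HGd).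
  destruct HFd as (p & Hp & Hl & HF). destruct HGd as (r & Hr & Hm & HG).
  exists (fun s => Cmult (p (g s)) (r s)).
  split.
  - apply continuous_Cmult; [|assumption].
    now apply (continuous_comp (U := R_UniformSpace) (V := C_UniformSpace) g p).
  - split; [now subst|].
    intros s. rewrite (HF (g s)).
    replace (Cminus (g s) (g t)) with (Cmult (r s) (RtoC (s - t)))
      by (rewrite (HG s); ring).
    ring.
Qed.

Lemma is_CInt_path_deriv (g dg : R -> C) (a b : R) : a <= b ->
  (forall t, a <= t <= b -> path_deriv g t (dg t)) ->
  (forall t, a <= t <= b -> path_continuous dg t) ->
  is_CInt dg a b (Cminus (g b) (g a)).
Proof.
  intros Hab H1 H2.
  apply (is_RInt_derive (V := C_R_CompleteNormedModule) g dg a b);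
    intros t Ht; rewrite Rmin_left, Rmax_right in Ht by assumption.
  - now apply path_deriv_is_derive, H1.
  - now apply H2.
Qed.

(** * Nested intervals and bisection *)

Lemma pow2_inv_small (h d : R) : 0 < d -> exists n : nat, h / 2 ^ n < d.
Proof.
  intros Hd.
  destruct (Pow_x_infinity 2 ltac:(rewrite Rabs_pos_eq; lra) (h / d + 1)) as [n Hn].
  exists n. specialize (Hn n (Nat.le_refl n)).
  rewrite Rabs_pos_eq in Hn by (apply pow_le; lra).
  assert (P : 0 < 2 ^ n) by (apply pow_lt; lra).
  apply Rmult_lt_reg_r with (2 ^ n); [assumption|].
  unfold Rdiv. rewrite Rmult_assoc, Rinv_l by lra. rewrite Rmult_1_r.
  apply Rmult_lt_reg_l with (/ d); [now apply Rinv_0_lt_compat|].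
  rewrite <- Rmult_assoc, Rinv_l by lra. unfold Rdiv in Hn. lra.
Qed.

(** The point is the supremum of the left ends, each of which lies below every right end. *)
Lemma nested_point (X : nat -> R) (h : R) : 0 <= h ->
  (forall n, X n <= X (S n) /\ X (S n) + h / 2 ^ S n <= X n + h / 2 ^ n) ->
  exists p, forall n, X n <= p <= X n + h / 2 ^ n.
Proof.
  intros Hh H.
  assert (P : forall n, 0 <= h / 2 ^ n).
  { intros n. apply Rdiv_le_0_compat; [assumption|]. apply pow_lt; lra. }
  assert (I : forall n m, X n <= X (n + m)%nat).
  { intros n m; induction m as [|m IH].
    - rewrite Nat.add_0_r; lra.
    - rewrite Nat.add_succ_r. destruct (H (n + m)%nat). lra. }
  assert (D : forall n m, X (n + m)%nat + h / 2 ^ (n + m) <= X n + h / 2 ^ n).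
  { intros n m; induction m as [|m IH].
    - rewrite Nat.add_0_r; lra.
    - rewrite Nat.add_succ_r. destruct (H (n + m)%nat). lra. }
  assert (U : forall n m, X m <= X n + h / 2 ^ n).
  { intros n m. destruct (Nat.le_ge_cases n m) as [L|L].
    - replace m with (n + (m - n))%nat by lia.
      assert (A := D n (m - n)%nat). assert (B := P (n + (m - n))%nat). lra.
    - replace n with (m + (n - m))%nat by lia.
      assert (A := I m (n - m)%nat). assert (B := P (m + (n - m))%nat). lra. }
  destruct (completeness (fun y => exists n, y = X n)) as [p [Hp1 Hp2]].
  - exists (X 0%nat + h / 2 ^ 0). intros y [n ->]. apply U.
  - exists (X 0%nat). now exists 0%nat.
  - exists p. intros n. split.
    + apply Hp1. now exists n.
    + apply Hp2. intros y [m ->]. apply U.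
Qed.

(* Two-dimensional Cousin lemma; a rectangle is given by its lower left corner
   [(x, y)] and its side lengths [h], [k]. *)
Lemma bisection_rectangle (P : R -> R -> R -> R -> Prop) (x0 h0 y0 k0 : R) :
  0 <= h0 -> 0 <= k0 ->
  (forall x h y k, 0 <= h -> 0 <= k ->
     x0 <= x -> x + h <= x0 + h0 -> y0 <= y -> y + k <= y0 + k0 ->
     P x (h / 2) y (k / 2) -> P (x + h / 2) (h / 2) y (k / 2) ->
     P x (h / 2) (y + k / 2) (k / 2) ->
     P (x + h / 2) (h / 2) (y + k / 2) (k / 2) -> P x h y k) ->
  (forall p r, x0 <= p <= x0 + h0 -> y0 <= r <= y0 + k0 ->
     exists d, 0 < d /\ forall x h y k, 0 <= h < d -> 0 <= k < d ->
       x0 <= x -> x + h <= x0 + h0 -> y0 <= y -> y + k <= y0 + k0 ->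
       x <= p <= x + h -> y <= r <= y + k -> P x h y k) ->
  P x0 h0 y0 k0.
Proof.
  intros Hh Hk Hdiv Hloc. apply NNPP. intros HnP.
  set (bad := fun n (z : R * R) =>
    x0 <= fst z /\ fst z + h0 / 2 ^ n <= x0 + h0 /\
    y0 <= snd z /\ snd z + k0 / 2 ^ n <= y0 + k0 /\
    ~ P (fst z) (h0 / 2 ^ n) (snd z) (k0 / 2 ^ n)).
  assert (Half : forall h n, h / 2 ^ n / 2 = h / 2 ^ S n).
  { intros h n. simpl. field. apply pow_nonzero; lra. }
  assert (Pos : forall h n, 0 <= h -> 0 <= h / 2 ^ n).
  { intros h n H. apply Rdiv_le_0_compat; [assumption|]. apply pow_lt; lra. }
  assert (Step : forall n z, bad n z -> exists z',
    (fst z' = fst z \/ fst z' = fst z + h0 / 2 ^ S n) /\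
    (snd z' = snd z \/ snd z' = snd z + k0 / 2 ^ S n) /\ bad (S n) z').
  { intros n [x y] (B1 & B2 & B3 & B4 & B5); simpl fst in *; simpl snd in *.
    assert (Q1 := Pos h0 (S n) Hh). assert (Q2 := Pos k0 (S n) Hk).
    assert (E1 := Half h0 n). assert (E2 := Half k0 n).
    assert (F1 : x + h0 / 2 ^ S n + h0 / 2 ^ S n <= x0 + h0) by lra.
    assert (F2 : y + k0 / 2 ^ S n + k0 / 2 ^ S n <= y0 + k0) by lra.
    apply NNPP. intros N. apply B5.
    apply Hdiv; try assumption; try (apply Pos; assumption);
      rewrite E1, E2; apply NNPP; intros NP; apply N.
    - exists (x, y). unfold bad; cbn [fst snd].
      repeat split; try (left; reflexivity); try assumption; lra.
    - exists (x + h0 / 2 ^ S n, y). unfold bad; cbn [fst snd].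
      repeat split; try (left; reflexivity); try (right; reflexivity); try assumption; lra.
    - exists (x, y + k0 / 2 ^ S n). unfold bad; cbn [fst snd].
      repeat split; try (left; reflexivity); try (right; reflexivity); try assumption; lra.
    - exists (x + h0 / 2 ^ S n, y + k0 / 2 ^ S n). unfold bad; cbn [fst snd].
      repeat split; try (left; reflexivity); try (right; reflexivity); try assumption; lra. }
  set (next := fun n z z' =>
    (fst z' = fst z \/ fst z' = fst z + h0 / 2 ^ S n) /\
    (snd z' = snd z \/ snd z' = snd z + k0 / 2 ^ S n) /\ bad (S n) z').
  (* Dependent choice: [epsilon] picks, at each level, the corner of a bad quarter of the current
     bad rectangle. *)
  set (Z := fix Z (n : nat) : R * R := match n with
     | O => (x0, y0)
     | S m => epsilon (inhabits (0, 0)) (next m (Z m)) end).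
  assert (B : forall n, bad n (Z n)).
  { induction n as [|n IH].
    - unfold bad; simpl. unfold Rdiv. rewrite Rinv_1, !Rmult_1_r.
      repeat split; try lra. assumption.
    - destruct (epsilon_spec (inhabits (0, 0)) (next n (Z n)) (Step n _ IH)) as (_ & _ & H).
      exact H. }
  assert (Nx : forall n, next n (Z n) (Z (S n))).
  { intros n. apply (epsilon_spec (inhabits (0, 0)) (next n (Z n)) (Step n _ (B n))). }
  destruct (nested_point (fun n => fst (Z n)) h0 Hh) as [p Hp].
  { intros n. destruct (Nx n) as (H1 & _ & _).
    assert (Q := Pos h0 (S n) Hh). assert (E := Half h0 n). destruct H1; lra. }
  destruct (nested_point (fun n => snd (Z n)) k0 Hk) as [r Hr].
  { intros n. destruct (Nx n) as (_ & H1 & _).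
    assert (Q := Pos k0 (S n) Hk). assert (E := Half k0 n). destruct H1; lra. }
  destruct (Hloc p r) as (d & Hd & HP).
  { assert (H := Hp 0%nat). simpl in H. unfold Rdiv in H.
    rewrite Rinv_1, Rmult_1_r in H. exact H. }
  { assert (H := Hr 0%nat). simpl in H. unfold Rdiv in H.
    rewrite Rinv_1, Rmult_1_r in H. exact H. }
  (* Deep enough, the bad rectangle around the limit point [(p, r)] is small enough for the local
     hypothesis there. *)
  destruct (pow2_inv_small (Rmax h0 k0) d Hd) as [n Hn].
  destruct (B n) as (B1 & B2 & B3 & B4 & B5). apply B5.
  assert (M : forall h, h <= Rmax h0 k0 -> h / 2 ^ n < d).
  { intros h Hm. eapply Rle_lt_trans; [|exact Hn].
    apply Rmult_le_compat_r; [|assumption].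
    apply Rlt_le, Rinv_0_lt_compat, pow_lt; lra. }
  apply HP; try assumption.
  - split; [now apply Pos|]. apply M, Rmax_l.
  - split; [now apply Pos|]. apply M, Rmax_r.
  - apply Hp.
  - apply Hr.
Qed.

(** * Goursat's theorem and circle means *)

Notation ccontinuous := (continuous (T := C_UniformSpace) (U := C_UniformSpace)).

Lemma path_deriv_horizontal (x y : R) : path_deriv (fun t => (t, y)) x (RtoC 1).
Proof.
  exists (fun _ => RtoC 1). split; [apply continuous_const|].
  split; [reflexivity|intros u; apply injective_projections; simpl; ring].
Qed.

Lemma path_deriv_vertical (x y : R) : path_deriv (fun t => (x, t)) y Ci.
Proof.
  exists (fun _ => Ci). split; [apply continuous_const|].
  split; [reflexivity|intros u; apply injective_projections; simpl; ring].
Qed.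

Lemma path_continuous_comp (F : C -> C) (g : R -> C) (t : R) :
  path_continuous g t -> ccontinuous F (g t) -> path_continuous (fun u => F (g u)) t.
Proof.
  intros. now apply (continuous_comp (U := R_UniformSpace) (V := C_UniformSpace) g F).
Qed.

(** The anticlockwise contour integral along the boundary: the bottom and right sides count
    positively, the top and left sides negatively, and [Ci] is the velocity on the vertical
    sides. *)
Definition rint (G : C -> C) (x h y k : R) : C :=
  Cminus (Cplus (CInt (fun t => G (t, y)) x (x + h))
                (Cmult Ci (CInt (fun t => G (x + h, t)) y (y + k))))
         (Cplus (CInt (fun t => G (t, y + k)) x (x + h))
                (Cmult Ci (CInt (fun t => G (x, t)) y (y + k)))).

Lemma CInt_horizontal (G : C -> C) (x h y : R) : 0 <= h ->
  (forall t, x <= t <= x + h -> ccontinuous G (t, y)) ->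
  is_CInt (fun t => G (t, y)) x (x + h) (CInt (fun t => G (t, y)) x (x + h)).
Proof.
  intros Hh H. apply CInt_correct; [lra|]. intros t Ht.
  apply (path_continuous_comp G (fun t => (t, y))); [|now apply H].
  eapply path_deriv_continuous, path_deriv_horizontal.
Qed.

Lemma CInt_vertical (G : C -> C) (x y k : R) : 0 <= k ->
  (forall t, y <= t <= y + k -> ccontinuous G (x, t)) ->
  is_CInt (fun t => G (x, t)) y (y + k) (CInt (fun t => G (x, t)) y (y + k)).
Proof.
  intros Hh H. apply CInt_correct; [lra|]. intros t Ht.
  apply (path_continuous_comp G (fun t => (x, t))); [|now apply H].
  eapply path_deriv_continuous, path_deriv_vertical.
Qed.

(** The factor [2 * (h + k)] is the perimeter. *)
Lemma rint_near (G H : C -> C) (x h y k M : R) : 0 <= h -> 0 <= k ->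
  (forall u v, x <= u <= x + h -> y <= v <= y + k ->
     ccontinuous G (u, v) /\ ccontinuous H (u, v) /\
     Cmod (Cminus (G (u, v)) (H (u, v))) <= M) ->
  Cmod (Cminus (rint G x h y k) (rint H x h y k)) <= 2 * M * (h + k).
Proof.
  intros Hh Hk A.
  assert (cG : forall u v, x <= u <= x + h -> y <= v <= y + k -> ccontinuous G (u, v)).
  { intros u v Hu Hv. exact (proj1 (A u v Hu Hv)). }
  assert (cH : forall u v, x <= u <= x + h -> y <= v <= y + k -> ccontinuous H (u, v)).
  { intros u v Hu Hv. exact (proj1 (proj2 (A u v Hu Hv))). }
  assert (Hor : forall v, y <= v <= y + k ->
    Cmod (Cminus (CInt (fun t => G (t, v)) x (x + h)) (CInt (fun t => H (t, v)) x (x + h)))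
      <= M * h).
  { intros v Hv. replace h with (x + h - x) at 3 by ring.
    apply is_CInt_near with (fun t => G (t, v)) (fun t => H (t, v)); [lra| | |].
    - intros t Ht. now apply A.
    - apply CInt_horizontal; [assumption|]. intros; apply cG; lra.
    - apply CInt_horizontal; [assumption|]. intros; apply cH; lra. }
  assert (Ver : forall u, x <= u <= x + h ->
    Cmod (Cminus (CInt (fun t => G (u, t)) y (y + k)) (CInt (fun t => H (u, t)) y (y + k)))
      <= M * k).
  { intros u Hu. replace k with (y + k - y) at 3 by ring.
    apply is_CInt_near with (fun t => G (u, t)) (fun t => H (u, t)); [lra| | |].
    - intros t Ht. now apply A.
    - apply CInt_vertical; [assumption|]. intros; apply cG; lra.
    - apply CInt_vertical; [assumption|]. intros; apply cH; lra. }
  assert (H1 := Hor y ltac:(lra)). assert (H2 := Hor (y + k) ltac:(lra)).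
  assert (V1 := Ver x ltac:(lra)). assert (V2 := Ver (x + h) ltac:(lra)).
  unfold rint. revert H1 H2 V1 V2.
  generalize (CInt (fun t => G (t, y)) x (x + h)) (CInt (fun t => H (t, y)) x (x + h))
   (CInt (fun t => G (t, y + k)) x (x + h)) (CInt (fun t => H (t, y + k)) x (x + h))
   (CInt (fun t => G (x, t)) y (y + k)) (CInt (fun t => H (x, t)) y (y + k))
   (CInt (fun t => G (x + h, t)) y (y + k)) (CInt (fun t => H (x + h, t)) y (y + k)).
  intros a a' b b' c c' d d' H1 H2 V1 V2.
  replace (Cminus _ _) with
    (Cplus (Cplus (Cminus a a') (Cmult Ci (Cminus d d')))
       (Copp (Cplus (Cminus b b') (Cmult Ci (Cminus c c'))))) by ring.
  assert (T : forall z w, Cmod (Cplus z (Cmult Ci w)) <= Cmod z + Cmod w).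
  { intros z w. eapply Rle_trans; [apply Cmod_triangle|].
    rewrite Cmod_mult, Cmod_Ci. lra. }
  eapply Rle_trans; [apply Cmod_triangle|]. rewrite Cmod_opp.
  assert (T1 := T (Cminus a a') (Cminus d d')).
  assert (T2 := T (Cminus b b') (Cminus c c')). lra.
Qed.

Lemma rint_primitive (A G : C -> C) (x h y k : R) : 0 <= h -> 0 <= k ->
  (forall s, cderiv A s (G s)) -> (forall s, ccontinuous G s) ->
  rint G x h y k = RtoC 0.
Proof.
  intros Hh Hk HA HG.
  assert (Hor : forall v, CInt (fun t => G (t, v)) x (x + h)
     = Cminus (A (x + h, v)) (A (x, v))).
  { intros v. apply is_CInt_unique.
    apply (is_CInt_path_deriv (fun t => A (t, v))); [lra| |]; intros t _.
    - replace (G (t, v)) with (Cmult (G (t, v)) (RtoC 1)) by ring.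
      apply (path_deriv_comp A (fun t => (t, v))); [apply path_deriv_horizontal|apply HA].
    - apply (path_continuous_comp G (fun t => (t, v))); [|apply HG].
      eapply path_deriv_continuous, path_deriv_horizontal. }
  assert (Ver : forall u, Cmult Ci (CInt (fun t => G (u, t)) y (y + k))
     = Cminus (A (u, y + k)) (A (u, y))).
  { intros u.
    assert (I : is_CInt (fun t => Cmult (G (u, t)) Ci) y (y + k)
                  (Cminus (A (u, y + k)) (A (u, y)))).
    { apply (is_CInt_path_deriv (fun t => A (u, t))); [lra| |]; intros t _.
      - apply (path_deriv_comp A (fun t => (u, t))); [apply path_deriv_vertical|apply HA].
      - apply continuous_Cmult; [|apply continuous_const].
        apply (path_continuous_comp G (fun t => (u, t))); [|apply HG].
        eapply path_deriv_continuous, path_deriv_vertical. }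
    rewrite <- (is_CInt_unique _ _ _ _ I). symmetry. apply is_CInt_unique.
    apply is_CInt_ext with (fun t => Cmult Ci (G (u, t))); [lra|intros; ring|].
    apply is_CInt_Cmult, CInt_vertical; [assumption|]. intros; apply HG. }
  unfold rint. rewrite !Hor, !Ver. ring.
Qed.

Lemma rint_split (G : C -> C) (x h y k : R) : 0 <= h -> 0 <= k ->
  (forall u v, x <= u <= x + h -> y <= v <= y + k -> ccontinuous G (u, v)) ->
  rint G x h y k =
  Cplus (Cplus (rint G x (h / 2) y (k / 2)) (rint G (x + h / 2) (h / 2) y (k / 2)))
        (Cplus (rint G x (h / 2) (y + k / 2) (k / 2))
               (rint G (x + h / 2) (h / 2) (y + k / 2) (k / 2))).
Proof.
  intros Hh Hk HG.
  assert (Hor : forall v, y <= v <= y + k -> CInt (fun t => G (t, v)) x (x + h) =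
     Cplus (CInt (fun t => G (t, v)) x (x + h / 2))
           (CInt (fun t => G (t, v)) (x + h / 2) (x + h))).
  { intros v Hv. apply is_CInt_unique. apply is_CInt_Chasles with (x + h / 2).
    - apply CInt_horizontal; [lra|]. intros; apply HG; lra.
    - replace (x + h) with (x + h / 2 + h / 2) by field.
      apply CInt_horizontal; [lra|]. intros; apply HG; lra. }
  assert (Ver : forall u, x <= u <= x + h -> CInt (fun t => G (u, t)) y (y + k) =
     Cplus (CInt (fun t => G (u, t)) y (y + k / 2))
           (CInt (fun t => G (u, t)) (y + k / 2) (y + k))).
  { intros u Hu. apply is_CInt_unique. apply is_CInt_Chasles with (y + k / 2).
    - apply CInt_vertical; [lra|]. intros; apply HG; lra.
    - replace (y + k) with (y + k / 2 + k / 2) by field.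
      apply CInt_vertical; [lra|]. intros; apply HG; lra. }
  unfold rint.
  replace (x + h / 2 + h / 2) with (x + h) by field.
  replace (y + k / 2 + k / 2) with (y + k) by field.
  rewrite !Hor, !Ver by lra. ring.
Qed.

Lemma le_0_of_le_all_eps (S X : R) : (forall e, 0 < e -> X <= e * S) -> 0 <= S -> X <= 0.
Proof.
  intros H HS. apply Rnot_lt_le. intros HX.
  assert (A := H (X / (2 * (S + 1))) ltac:(apply Rdiv_lt_0_compat; lra)).
  assert (B : X / (2 * (S + 1)) * S <= X / 2).
  { replace (X / 2) with (X / (2 * (S + 1)) * (S + 1)) by (field; lra).
    apply Rmult_le_compat_l; [|lra]. apply Rlt_le, Rdiv_lt_0_compat; lra. }
  lra.
Qed.

Lemma Cmod_le_0 (z : C) : Cmod z <= 0 -> z = RtoC 0.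
Proof. intros H. apply Cmod_eq_0. assert (A := Cmod_ge_0 z). lra. Qed.

Lemma exp_le_compat (x y : R) : x <= y -> exp x <= exp y.
Proof.
  intros [H|H]; [|subst; apply Rle_refl]. now apply Rlt_le, exp_increasing.
Qed.

(** What passes through the bisection is the bound [e * (h + k) ^ 2], which is stable because the
    bounds of four quarters add up to that of the whole. It holds on small rectangles since [G] is
    there an affine function, which has a primitive, up to an error of smaller order. *)
Theorem goursat_rectangle (G : C -> C) (x0 h0 y0 k0 : R) : 0 <= h0 -> 0 <= k0 ->
  (forall x y, x0 <= x <= x0 + h0 -> y0 <= y <= y0 + k0 -> holo G (x, y)) ->
  rint G x0 h0 y0 k0 = RtoC 0.
Proof.
  intros Hh Hk HG. apply Cmod_le_0.
  apply le_0_of_le_all_eps with ((h0 + k0) ^ 2); [|apply pow2_ge_0].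
  intros e He.
  apply (bisection_rectangle
    (fun x h y k => Cmod (rint G x h y k) <= e * (h + k) ^ 2)); try assumption.
  - intros x h y k H1 H2 H3 H4 H5 H6 P1 P2 P3 P4.
    rewrite rint_split; try assumption.
    2:{ intros u v Hu Hv. apply holo_continuous, HG; lra. }
    eapply Rle_trans; [apply Cmod_triangle|].
    assert (T1 := Cmod_triangle (rint G x (h / 2) y (k / 2))
                    (rint G (x + h / 2) (h / 2) y (k / 2))).
    assert (T2 := Cmod_triangle (rint G x (h / 2) (y + k / 2) (k / 2))
                    (rint G (x + h / 2) (h / 2) (y + k / 2) (k / 2))).
    replace (e * (h + k) ^ 2) with (4 * (e * (h / 2 + k / 2) ^ 2)) by field.
    lra.
  - intros p r Hp Hr.
    destruct (HG p r Hp Hr) as (l & phi & Hc & Hl & HF).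
    assert (A := proj1 (continuous_Cmod_iff _ _ _) Hc (e / 2) ltac:(lra)).
    apply locally_C_iff in A. destruct A as (d & Hd & HA).
    exists (d / 2). split; [lra|].
    intros x h y k H1 H2 H3 H4 H5 H6 H7 H8.
    set (z := (p, r)) in *.
    set (aff := fun s => Cplus (G z) (Cmult l (Cminus s z))).
    assert (caff : forall s, ccontinuous aff s).
    { intros s. apply holo_continuous. apply holo_plus; [apply holo_const|].
      apply holo_mult; [apply holo_const|].
      apply holo_minus; [apply holo_id|apply holo_const]. }
    assert (Z : rint aff x h y k = RtoC 0).
    { apply rint_primitive with (fun s => Cmult (Cminus s z)
        (Cplus (G z) (Cmult (Cmult l (RtoC (/ 2))) (Cminus s z)))); try lra.
      - intros s.
        assert (D1 : cderiv (fun s => Cminus s z) s (Cplus (RtoC 1) (RtoC 0))).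
        { apply (cderiv_plus (fun s => s) (fun _ => Copp z));
            [apply cderiv_id|apply cderiv_const]. }
        assert (D2 := cderiv_mult _ _ _ _ _ D1 (cderiv_plus _ _ _ _ _
           (cderiv_const (G z) s) (cderiv_mult _ _ _ _ _ 
           (cderiv_const (Cmult l (RtoC (/ 2))) s) D1))).
        match type of D2 with cderiv _ _ ?v => replace (aff s) with v end; [exact D2|].
        unfold aff. rewrite RtoC_inv by lra. field.
      - assumption. }
    replace (rint G x h y k) with (Cminus (rint G x h y k) (rint aff x h y k))
      by (rewrite Z; ring).
    (* Points of the rectangle are within [h + k] of [z], so [G] differs from [aff] by at most
       [e / 2 * (h + k)]; the other factor is the perimeter. *)
    replace (e * (h + k) ^ 2) with (2 * (e / 2 * (h + k)) * (h + k)) by field.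
    apply rint_near; try lra.
    intros u v Hu Hv. split; [|split].
    + apply holo_continuous, HG; lra.
    + apply caff.
    + unfold aff. rewrite (HF (u, v)), <- Hl.
      replace (Cminus _ _) with
        (Cmult (Cminus (phi (u, v)) (phi z)) (Cminus (u, v) z)) by ring.
      assert (D : Cmod (Cminus (u, v) z) <= h + k).
      { eapply Rle_trans; [apply Cmod_le_Re_Im|]. unfold z; simpl.
        apply Rplus_le_compat; apply Rabs_le; lra. }
      rewrite Cmod_mult. apply Rmult_le_compat; try apply Cmod_ge_0; [|assumption].
      apply Rlt_le, HA. lra.
Qed.

(** * Circles and integrals over the angle *)

Definition cis (t : R) : C := (cos t, sin t).

Lemma Cexp_polar (x t : R) : Cexp (x, t) = Cmult (RtoC (exp x)) (cis t).
Proof. apply injective_projections; simpl; ring. Qed.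

Lemma Cmod_cis (t : R) : Cmod (cis t) = 1.
Proof.
  replace (cis t) with (Cexp (0, t)).
  - rewrite Cexp_Cmod. apply exp_0.
  - rewrite Cexp_polar, exp_0. ring.
Qed.

Lemma path_deriv_cis (t : R) : path_deriv cis t (Cmult Ci (cis t)).
Proof.
  assert (E : forall u, Cexp (0, u) = cis u).
  { intros u. rewrite Cexp_polar, exp_0. ring. }
  assert (H := path_deriv_comp Cexp (fun u => (0, u)) t _ _ (path_deriv_vertical 0 t)
                 (cderiv_Cexp (0, t))).
  destruct H as (phi & H1 & H2 & H3).
  exists phi. split; [assumption|]. split.
  - rewrite H2, E. ring.
  - intros u. rewrite <- !E. apply H3.
Qed.

Lemma path_continuous_cis (t : R) : path_continuous cis t.
Proof. eapply path_deriv_continuous, path_deriv_cis. Qed.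

Definition circ (a : C) (r t : R) : C := Cplus a (Cmult (RtoC r) (cis t)).

Lemma Cmod_circ (a : C) (r t : R) : 0 <= r -> Cmod (Cminus (circ a r t) a) = r.
Proof.
  intros Hr. unfold circ.
  replace (Cminus _ _) with (Cmult (RtoC r) (cis t)) by ring.
  rewrite Cmod_mult, Cmod_cis, Cmod_R, Rabs_pos_eq by assumption. ring.
Qed.

Lemma path_deriv_circ (a : C) (r t : R) :
  path_deriv (circ a r) t (Cmult Ci (Cminus (circ a r t) a)).
Proof.
  replace (Cmult Ci (Cminus (circ a r t) a)) with
    (Cplus (RtoC 0) (Cplus (Cmult (RtoC 0) (cis t)) (Cmult (RtoC r) (Cmult Ci (cis t)))))
    by (unfold circ; ring).
  apply (path_deriv_plus (fun _ => a) (fun u => Cmult (RtoC r) (cis u)));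
    [apply path_deriv_const|].
  apply (path_deriv_mult (fun _ => RtoC r) cis);
    [apply path_deriv_const|apply path_deriv_cis].
Qed.

Lemma path_continuous_circ (a : C) (r t : R) : path_continuous (circ a r) t.
Proof. eapply path_deriv_continuous, path_deriv_circ. Qed.

(** Integrated in the angle, not in [ds]: divided by [2 * PI] this is the mean over the circle, and
    it still makes sense at radius 0. *)
Definition circint (F : C -> C) (a : C) (r : R) : C :=
  CInt (fun t => F (circ a r t)) 0 (2 * PI).

Lemma two_PI_pos : 0 < 2 * PI.
Proof. assert (H := PI_RGT_0). lra. Qed.

Lemma circint_correct (F : C -> C) (a : C) (r : R) : 0 <= r ->
  (forall s, Cmod (Cminus s a) = r -> ccontinuous F s) ->
  is_CInt (fun t => F (circ a r t)) 0 (2 * PI) (circint F a r).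
Proof.
  intros Hr H. assert (P := two_PI_pos). apply CInt_correct; [lra|].
  intros t _. apply (path_continuous_comp F (circ a r)).
  - apply path_continuous_circ.
  - apply H. now apply Cmod_circ.
Qed.

(* Goursat's theorem for [F (a + exp w)] on a rectangle of height [2 PI]: the
   horizontal sides cancel by periodicity. *)
Lemma circint_const (F : C -> C) (a : C) (r1 r2 : R) : 0 < r1 <= r2 ->
  (forall s, r1 <= Cmod (Cminus s a) <= r2 -> holo F s) ->
  circint F a r1 = circint F a r2.
Proof.
  intros Hr HF.
  set (G := fun w => F (Cplus a (Cexp w))).
  assert (Hl : 0 <= ln r2 - ln r1) by (assert (H := ln_le r1 r2); lra).
  assert (P := two_PI_pos).
  assert (Z : rint G (ln r1) (ln r2 - ln r1) 0 (2 * PI) = RtoC 0).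
  { apply goursat_rectangle; try lra.
    intros x y Hx _. apply (holo_comp F (fun w => Cplus a (Cexp w))).
    - apply holo_plus; [apply holo_const|]. apply holo_Cexp, holo_id.
    - apply HF.
      replace (Cminus (Cplus a (Cexp (x, y))) a) with (Cexp (x, y)) by ring.
      rewrite Cexp_Cmod. simpl.
      rewrite <- (exp_ln r1), <- (exp_ln r2) by lra.
      split; apply exp_le_compat; lra. }
  unfold rint in Z.
  replace (ln r1 + (ln r2 - ln r1)) with (ln r2) in Z by ring.
  replace (0 + 2 * PI) with (2 * PI) in Z by ring.
  assert (E1 : CInt (fun t => G (t, 2 * PI)) (ln r1) (ln r2) =
               CInt (fun t => G (t, 0)) (ln r1) (ln r2)).
  { apply CInt_ext; [lra|]. intros t _. unfold G. do 2 f_equal.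
    unfold Cexp; simpl. now rewrite cos_2PI, sin_2PI, cos_0, sin_0. }
  assert (E2 : forall r, 0 < r ->
     CInt (fun t => G (ln r, t)) 0 (2 * PI) = circint F a r).
  { intros r Hr0. apply CInt_ext; [lra|]. intros t _. unfold G, circ.
    now rewrite Cexp_polar, exp_ln. }
  rewrite E1, !E2 in Z by lra.
  set (A := CInt _ _ _) in Z.
  apply Cminus_eq_0.
  replace (Cminus (circint F a r1) (circint F a r2)) with
    (Cmult Ci (Cminus (Cplus A (Cmult Ci (circint F a r2)))
                      (Cplus A (Cmult Ci (circint F a r1))))).
  - rewrite Z. ring.
  - replace (Cmult Ci _) with
      (Cmult (Cmult Ci Ci) (Cminus (circint F a r2) (circint F a r1))) by ring.
    replace (Cmult Ci Ci) with (RtoC (-1))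
      by (apply injective_projections; simpl; ring).
    apply injective_projections; simpl; ring.
Qed.

Lemma circint_near (F G : C -> C) (a b : C) (r1 r2 e : R) : 0 <= r1 -> 0 <= r2 ->
  (forall s, Cmod (Cminus s a) = r1 -> ccontinuous F s) ->
  (forall s, Cmod (Cminus s b) = r2 -> ccontinuous G s) ->
  (forall t, 0 <= t <= 2 * PI ->
     Cmod (Cminus (F (circ a r1 t)) (G (circ b r2 t))) <= e) ->
  Cmod (Cminus (circint F a r1) (circint G b r2)) <= e * (2 * PI).
Proof.
  intros H1 H2 HF HG H. assert (P := two_PI_pos).
  replace (2 * PI) with (2 * PI - 0) at 1 by ring.
  apply is_CInt_near with (fun t => F (circ a r1 t)) (fun t => G (circ b r2 t)).
  - lra.
  - exact H.
  - now apply circint_correct.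
  - now apply circint_correct.
Qed.

(** Continuity of [F] is enough, being uniform in the angle by compactness. This lets the circle
    mean shrink to the centre and cross a point where [F] is not yet known to be differentiable. *)
Lemma circint_continuous (F : C -> C) (a : C) (r0 rad : R) : 0 <= r0 < rad ->
  (forall s, Cmod (Cminus s a) < rad -> ccontinuous F s) ->
  forall e, 0 < e -> exists d, 0 < d /\ forall r, 0 <= r < rad -> Rabs (r - r0) < d ->
    Cmod (Cminus (circint F a r) (circint F a r0)) <= e.
Proof.
  intros Hr0 HF e He. assert (P := two_PI_pos).
  (* One such share for the real part and one for the imaginary part, over an angle range of length
     [2 * PI]. *)
  assert (He' : 0 < e / (4 * PI)) by (apply Rdiv_lt_0_compat; lra).
  assert (K : forall th, continuous (T := prod_UniformSpace R_UniformSpace R_UniformSpace)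
     (U := C_UniformSpace) (fun z => F (circ a (fst z) (snd z))) (r0, th)).
  { intros th.
    apply (continuous_comp (U := prod_UniformSpace R_UniformSpace R_UniformSpace)
      (V := C_UniformSpace) (fun z => circ a (fst z) (snd z)) F).
    - apply continuous_Cplus; [apply continuous_const|]. apply continuous_Cmult.
      + apply continuous_RtoC, continuous_fst.
      + apply (continuous_comp (V := R_UniformSpace) snd cis);
          [apply continuous_snd|apply path_continuous_cis].
    - apply HF. simpl fst; simpl snd. rewrite Cmod_circ; lra. }
  assert (K1 : forall x, 0 <= x <= 2 * PI ->
    continuity_2d_pt (fun u v => Re (F (circ a u v))) r0 x).
  { intros x _. apply continuity_2d_pt_filterlim.
    apply (proj1 (proj1 (continuous_C_pair _ _ _) (K x))). }
  assert (K2 : forall x, 0 <= x <= 2 * PI ->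
    continuity_2d_pt (fun u v => Im (F (circ a u v))) r0 x).
  { intros x _. apply continuity_2d_pt_filterlim.
    apply (proj2 (proj1 (continuous_C_pair _ _ _) (K x))). }
  destruct (uniform_continuity_2d_1d' _ 0 (2 * PI) r0 K1 (mkposreal _ He')) as [d1 H1].
  destruct (uniform_continuity_2d_1d' _ 0 (2 * PI) r0 K2 (mkposreal _ He')) as [d2 H2].
  exists (Rmin d1 d2). split; [apply Rmin_pos; apply cond_pos|].
  intros r Hr Hd.
  assert (M1 := Rmin_l d1 d2). assert (M2 := Rmin_r d1 d2).
  assert (N1 := cond_pos d1). assert (N2 := cond_pos d2).
  apply Rabs_def2 in Hd.
  replace e with (e / (2 * PI) * (2 * PI)) by (field; lra).
  apply circint_near; try lra.
  - intros s Hs; apply HF; lra.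
  - intros s Hs; apply HF; lra.
  - intros t Ht. eapply Rle_trans; [apply Cmod_le_Re_Im|].
    assert (A1 := H1 t r0 t r Ht ltac:(lra) Ht ltac:(lra)
       ltac:(rewrite Rminus_diag, Rabs_R0; assumption)).
    assert (A2 := H2 t r0 t r Ht ltac:(lra) Ht ltac:(lra)
       ltac:(rewrite Rminus_diag, Rabs_R0; assumption)).
    simpl in A1, A2. unfold Rminus in A1, A2.
    replace (e / (2 * PI)) with (e / (4 * PI) + e / (4 * PI)) by (field; lra).
    apply Rplus_le_compat; apply Rlt_le; assumption.
Qed.

Lemma circint_0 (F : C -> C) (a : C) :
  circint F a 0 = Cmult (RtoC (2 * PI)) (F a).
Proof.
  assert (P := two_PI_pos).
  apply is_CInt_unique. apply is_CInt_ext with (fun _ => F a); [lra| |].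
  - intros t _. f_equal. unfold circ. ring.
  - replace (2 * PI) with (2 * PI - 0) at 2 by ring. apply is_CInt_const.
Qed.

Lemma Ceq_eps (z w : C) : (forall e, 0 < e -> Cmod (Cminus z w) <= e) -> z = w.
Proof.
  intros H. apply Cminus_eq_0, Cmod_le_0. apply Rnot_lt_le. intros L.
  assert (A := H (Cmod (Cminus z w) / 2) ltac:(lra)). lra.
Qed.

(* The exceptional point [z] is crossed by continuity in the radius. *)
Lemma circint_mean_value (F : C -> C) (a z : C) (rad : R) :
  (forall s, Cmod (Cminus s a) < rad -> ccontinuous F s) ->
  (forall s, Cmod (Cminus s a) < rad -> s <> a -> s <> z -> holo F s) ->
  forall r, 0 <= r < rad -> circint F a r = Cmult (RtoC (2 * PI)) (F a).
Proof.
  intros HC HH. set (rz := Cmod (Cminus z a)).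
  assert (Hol : forall s, 0 < Cmod (Cminus s a) < rad -> Cmod (Cminus s a) <> rz -> holo F s).
  { intros s Hs Hn. apply HH; [lra| |].
    - intros ->. replace (Cminus a a) with (RtoC 0) in Hs by ring.
      rewrite Cmod_0 in Hs. lra.
    - intros ->. now apply Hn. }
  (* Circles that do not reach [z], or all circles if [z] is the centre: their integrals agree and
     tend to the one at radius 0. *)
  assert (Z0 : forall r, 0 <= r < rad -> r < rz \/ rz = 0 ->
     circint F a r = circint F a 0).
  { intros r Hr Hz. apply Ceq_eps. intros e He.
    destruct (circint_continuous F a 0 rad ltac:(lra) HC e He) as (d & Hd & H).
    destruct (Rle_lt_dec r (d / 2)) as [L|L].
    - apply H; [lra|]. rewrite Rminus_0_r, Rabs_pos_eq; lra.
    - rewrite <- (circint_const F a (d / 2) r).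
      + apply H; [lra|]. rewrite Rminus_0_r, Rabs_pos_eq; lra.
      + lra.
      + intros s Hs. apply Hol; lra. }
  (* The circle through [z] is approached from inside. *)
  assert (Z1 : rz < rad -> circint F a rz = circint F a 0).
  { intros Hz. assert (Hz0 : 0 <= rz) by apply Cmod_ge_0.
    destruct (Req_dec rz 0) as [E|E]; [now apply Z0; [lra|right]|].
    apply Ceq_eps. intros e He.
    destruct (circint_continuous F a rz rad ltac:(lra) HC e He) as (d & Hd & H).
    set (r := Rmax (rz / 2) (rz - d / 2)).
    assert (Hr : rz / 2 <= r < rz /\ rz - d / 2 <= r).
    { split; [split|]; [apply Rmax_l| |apply Rmax_r]. apply Rmax_lub_lt; lra. }
    rewrite <- (Z0 r) by lra.
    replace (Cminus _ _) with (Copp (Cminus (circint F a r) (circint F a rz))) by ring.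
    rewrite Cmod_opp. apply H; [lra|]. apply Rabs_def1; lra. }
  intros r Hr. rewrite <- circint_0.
  destruct (Rtotal_order r rz) as [L|[E|L]].
  - apply Z0; [assumption|now left].
  - rewrite E in *. apply Z1. lra.
  (* Larger circles have equal integrals, which tend to the one through [z] from outside. *)
  - rewrite <- Z1 by lra. apply Ceq_eps. intros e He.
    assert (Hz0 : 0 <= rz) by apply Cmod_ge_0.
    destruct (circint_continuous F a rz rad ltac:(lra) HC e He) as (d & Hd & H).
    set (r' := Rmin r (rz + d / 2)).
    assert (Hr' : rz < r' <= r /\ r' <= rz + d / 2).
    { split; [split|]; [|apply Rmin_l|apply Rmin_r]. apply Rmin_glb_lt; lra. }
    rewrite <- (circint_const F a r' r).
    + apply H; [lra|]. apply Rabs_def1; lra.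
    + lra.
    + intros s Hs. apply Hol; lra.
Qed.

(** * Cauchy's formula and Taylor series *)

Lemma Cmod_circle_neq (a z s : C) (r : R) :
  Cmod (Cminus z a) < r -> Cmod (Cminus s a) = r -> Cminus s z <> RtoC 0.
Proof.
  intros H E. apply Cminus_neq_0. intros ->. lra.
Qed.

Lemma Cmod_circle_neq0 (a s : C) (r : R) :
  0 < r -> Cmod (Cminus s a) = r -> Cminus s a <> RtoC 0.
Proof.
  intros H E Z. rewrite Z, Cmod_0 in E. lra.
Qed.

Definition circle_continuous (F : C -> C) (a : C) (r : R) : Prop :=
  forall s, Cmod (Cminus s a) = r -> ccontinuous F s.

Lemma circint_ext (F G : C -> C) (a : C) (r : R) : 0 <= r ->
  (forall s, Cmod (Cminus s a) = r -> F s = G s) -> circint F a r = circint G a r.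
Proof.
  intros Hr H. assert (P := two_PI_pos). apply CInt_ext; [lra|].
  intros t _. apply H. now apply Cmod_circ.
Qed.

Lemma circint_plus (F G : C -> C) (a : C) (r : R) : 0 <= r ->
  circle_continuous F a r -> circle_continuous G a r ->
  circint (fun s => Cplus (F s) (G s)) a r = Cplus (circint F a r) (circint G a r).
Proof.
  intros Hr HF HG. apply is_CInt_unique.
  apply (is_CInt_plus (fun t => F (circ a r t)) (fun t => G (circ a r t)));
    now apply circint_correct.
Qed.

Lemma circint_scal (c : C) (F : C -> C) (a : C) (r : R) : 0 <= r ->
  circle_continuous F a r ->
  circint (fun s => Cmult c (F s)) a r = Cmult c (circint F a r).
Proof.
  intros Hr HF. apply is_CInt_unique.
  apply (is_CInt_Cmult (fun t => F (circ a r t))). now apply circint_correct.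
Qed.

Lemma circint_bound (F : C -> C) (a : C) (r M : R) : 0 <= r ->
  circle_continuous F a r ->
  (forall s, Cmod (Cminus s a) = r -> Cmod (F s) <= M) ->
  Cmod (circint F a r) <= M * (2 * PI).
Proof.
  intros Hr HF HM. assert (P := two_PI_pos).
  replace (2 * PI) with (2 * PI - 0) by ring.
  apply is_CInt_norm_le with (fun t => F (circ a r t)).
  - lra.
  - intros t _. apply HM. now apply Cmod_circ.
  - now apply circint_correct.
Qed.

Lemma circle_bounded (F : C -> C) (a : C) (r : R) : 0 <= r ->
  circle_continuous F a r ->
  exists M, 0 <= M /\ forall t, 0 <= t <= 2 * PI -> Cmod (F (circ a r t)) <= M.
Proof.
  intros Hr HF. assert (P := two_PI_pos).
  set (f := fun t => Re (F (circ a r t)) * Re (F (circ a r t))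
                     + Im (F (circ a r t)) * Im (F (circ a r t))).
  assert (Cf : forall t, continuity_pt f t).
  { intros t. apply continuity_pt_filterlim.
    assert (H : path_continuous (fun t => F (circ a r t)) t).
    { apply (path_continuous_comp F (circ a r)); [apply path_continuous_circ|].
      apply HF. now apply Cmod_circ. }
    apply continuous_C_pair in H. destruct H as [H1 H2].
    exact (continuous_plus (V := R_NormedModule) _ _ _
      (continuous_mult (K := R_AbsRing) _ _ _ H1 H1)
      (continuous_mult (K := R_AbsRing) _ _ _ H2 H2)). }
  destruct (continuity_ab_maj f 0 (2 * PI)) as (x & Hx & _); [lra|intros; apply Cf|].
  (* [f] is the squared modulus, and [y <= y ^ 2 + 1] turns its maximum into a bound for the
     modulus. *)
  exists (f x + 1). split.
  - unfold f. assert (A := Rle_0_sqr (Re (F (circ a r x)))).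
    assert (B := Rle_0_sqr (Im (F (circ a r x)))). unfold Rsqr in *. lra.
  - intros t Ht. specialize (Hx t Ht).
    assert (E : f t = Cmod (F (circ a r t)) ^ 2) by (rewrite Cmod2_sum; unfold f; ring).
    assert (B := pow2_ge_0 (Cmod (F (circ a r t)) - 1)).
    assert (N := Cmod_ge_0 (F (circ a r t))). nra.
Qed.

(** Cauchy's integral for the [k]-th Taylor coefficient, with [F s / (s - a)^(k+1)] integrated in
    [ds]; rewriting it over the angle absorbs one power of [s - a]. *)
Definition coef (F : C -> C) (a : C) (r : R) (k : nat) : C :=
  Cmult (RtoC (/ (2 * PI)))
    (circint (fun s => Cmult (F s) (Cpow (Cinv (Cminus s a)) k)) a r).

Lemma continuous_Csub (c s : C) : ccontinuous (fun u => Cminus u c) s.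
Proof. apply continuous_Cminus; [apply continuous_id|apply continuous_const]. Qed.

Lemma circle_continuous_pow_inv (a : C) (r : R) (k : nat) : 0 < r ->
  circle_continuous (fun s => Cpow (Cinv (Cminus s a)) k) a r.
Proof.
  intros Hr s Hs. apply continuous_Cpow, continuous_Cinv; [apply continuous_Csub|].
  now apply Cmod_circle_neq0 with r.
Qed.

Lemma circle_continuous_mult (F G : C -> C) (a : C) (r : R) :
  circle_continuous F a r -> circle_continuous G a r ->
  circle_continuous (fun s => Cmult (F s) (G s)) a r.
Proof. intros HF HG s Hs. apply continuous_Cmult; [now apply HF|now apply HG]. Qed.

Lemma circle_continuous_coef (F : C -> C) (a : C) (r : R) (k : nat) : 0 < r ->
  circle_continuous F a r ->
  circle_continuous (fun s => Cmult (F s) (Cpow (Cinv (Cminus s a)) k)) a r.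
Proof.
  intros. apply circle_continuous_mult; [assumption|].
  now apply circle_continuous_pow_inv.
Qed.

(* With [s = a + r exp (i t)], [ds / (s - z)] is [i (s - a) / (s - z) dt]. *)
Definition cauchy_kernel (a z s : C) : C := Cdiv (Cminus s a) (Cminus s z).

Lemma circle_continuous_cauchy_kernel (a z : C) (r : R) : Cmod (Cminus z a) < r ->
  circle_continuous (cauchy_kernel a z) a r.
Proof.
  intros Hz s Hs. apply continuous_Cdiv; try apply continuous_Csub.
  now apply Cmod_circle_neq with a r.
Qed.

Definition cauchy_transform (F : C -> C) (a : C) (r : R) (z : C) : C :=
  Cmult (RtoC (/ (2 * PI))) (circint (fun s => Cmult (F s) (cauchy_kernel a z s)) a r).

Fixpoint psum (c : nat -> C) (w : C) (n : nat) : C :=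
  match n with
  | O => RtoC 0
  | S m => Cplus (psum c w m) (Cmult (c m) (Cpow w m))
  end.

(** The finite geometric sum for the kernel: with [v = w / (s - a)], the kernel equals
    [1 + v + ... + v^(n-1)] plus [v^n] times the kernel. Being exact for each [n], it avoids any
    exchange of an infinite sum with the integral. *)
Lemma cauchy_transform_expand (F : C -> C) (a : C) (r : R) (w : C) (n : nat) :
  circle_continuous F a r -> Cmod w < r ->
  cauchy_transform F a r (Cplus a w) =
  Cplus (psum (coef F a r) w n)
    (Cmult (RtoC (/ (2 * PI)))
       (circint (fun s => Cmult (Cmult (F s) (Cpow (Cmult w (Cinv (Cminus s a))) n))
                                (cauchy_kernel a (Cplus a w) s)) a r)).
Proof.
  intros HF Hw. assert (W := Cmod_ge_0 w).
  assert (Hz : Cmod (Cminus (Cplus a w) a) < r)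
    by (replace (Cminus (Cplus a w) a) with w by ring; assumption).
  assert (HK := circle_continuous_cauchy_kernel a (Cplus a w) r Hz).
  assert (HP : forall n, circle_continuous
     (fun s => Cpow (Cmult w (Cinv (Cminus s a))) n) a r).
  { intros m s Hs. apply continuous_Cpow, continuous_Cmult; [apply continuous_const|].
    apply continuous_Cinv; [apply continuous_Csub|].
    apply Cmod_circle_neq0 with r; [lra|assumption]. }
  induction n as [|n IH].
  - simpl psum. rewrite Cplus_0_l. unfold cauchy_transform. f_equal.
    apply circint_ext; [lra|]. intros s _. simpl. ring.
  - rewrite IH. simpl psum. rewrite <- Cplus_assoc. f_equal.
    unfold coef. rewrite <- Cmult_assoc, <- Cmult_plus_distr_l. f_equal.
    rewrite (Cmult_comm _ (Cpow w n)).
    rewrite <- circint_scal; [|lra|apply circle_continuous_coef; [lra|assumption]].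
    rewrite <- circint_plus; [|lra| |].
    + apply circint_ext; [lra|]. intros s Hs.
      rewrite !Cpow_mult_l. unfold cauchy_kernel. simpl.
      assert (N1 : Cminus s a <> RtoC 0) by (apply Cmod_circle_neq0 with r; [lra|assumption]).
      assert (N2 : Cminus s (Cplus a w) <> RtoC 0)
        by (now apply Cmod_circle_neq with a r).
      generalize (Cpow w n) (Cpow (Cinv (Cminus s a)) n). intros p1 p2.
      field. split; assumption.
    + intros s Hs. apply continuous_Cmult; [apply continuous_const|].
      exact (circle_continuous_coef F a r n ltac:(lra) HF s Hs).
    + apply circle_continuous_mult; [|assumption].
      now apply circle_continuous_mult.
Qed.

(** On the circle the power [v^n] in the remainder has modulus [(Cmod w / r) ^ n], and [M] bounds
    the other factors independently of [n]. Only continuity on the circle enters: the transform is a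
    power series inside whatever its boundary values are. *)
Lemma cauchy_transform_remainder (F : C -> C) (a : C) (r : R) (w : C) :
  circle_continuous F a r -> Cmod w < r ->
  exists M, 0 <= M /\ forall n,
    Cmod (Cminus (cauchy_transform F a r (Cplus a w)) (psum (coef F a r) w n))
      <= M * (Cmod w / r) ^ n.
Proof.
  intros HF Hw. assert (W := Cmod_ge_0 w). assert (P := two_PI_pos).
  assert (Hz : Cmod (Cminus (Cplus a w) a) < r)
    by (replace (Cminus (Cplus a w) a) with w by ring; assumption).
  assert (HK := circle_continuous_cauchy_kernel a (Cplus a w) r Hz).
  destruct (circle_bounded (fun s => Cmult (F s) (cauchy_kernel a (Cplus a w) s)) a r)
    as (M & HM0 & HM).
  { lra. }
  { now apply circle_continuous_mult. }
  exists M. split; [assumption|]. intros n.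
  rewrite (cauchy_transform_expand F a r w n HF Hw).
  match goal with |- Cmod (Cminus (Cplus ?A ?B) ?A) <= _ =>
    replace (Cminus (Cplus A B) A) with B by ring end.
  rewrite Cmod_mult, Cmod_R, Rabs_pos_eq by (apply Rlt_le, Rinv_0_lt_compat; lra).
  apply Rmult_le_reg_l with (2 * PI); [assumption|].
  rewrite <- Rmult_assoc, Rinv_r, Rmult_1_l by lra.
  rewrite (Rmult_comm (2 * PI)).
  replace (M * (Cmod w / r) ^ n * (2 * PI)) with (M * (Cmod w / r) ^ n * (2 * PI - 0)) by ring.
  eapply is_CInt_norm_le with
    (f := fun t => Cmult (Cmult (F (circ a r t))
                (Cpow (Cmult w (Cinv (Cminus (circ a r t) a))) n))
                                (cauchy_kernel a (Cplus a w) (circ a r t))).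
  - lra.
  - intros t Ht.
    replace (Cmult (Cmult _ _) _) with
      (Cmult (Cmult (F (circ a r t)) (cauchy_kernel a (Cplus a w) (circ a r t)))
         (Cpow (Cmult w (Cinv (Cminus (circ a r t) a))) n)) by ring.
    rewrite Cmod_mult. apply Rmult_le_compat; try apply Cmod_ge_0; [now apply HM|].
    assert (C1 := Cmod_circ a r t ltac:(lra)).
    rewrite Cmod_pow, Cmod_mult, Cmod_inv, C1.
    + apply Rle_refl.
    + apply Cmod_circle_neq0 with r; [lra|assumption].
  - apply (circint_correct (fun s => Cmult (Cmult (F s)
      (Cpow (Cmult w (Cinv (Cminus s a))) n)) (cauchy_kernel a (Cplus a w) s))).
    + lra.
    + apply circle_continuous_mult; [|assumption].
      apply circle_continuous_mult; [assumption|].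
      intros s Hs. apply continuous_Cpow, continuous_Cmult; [apply continuous_const|].
      apply continuous_Cinv; [apply continuous_Csub|].
      apply Cmod_circle_neq0 with r; [lra|assumption].
Qed.

Lemma geometric_remainder_small (M q e : R) : 0 <= q < 1 -> 0 <= M -> 0 < e ->
  exists N, forall n, (N <= n)%nat -> M * q ^ n < e.
Proof.
  intros Hq HM He.
  assert (Q : 0 < e / (M + 1)) by (apply Rdiv_lt_0_compat; lra).
  destruct (pow_lt_1_zero q ltac:(rewrite Rabs_pos_eq; lra) _ Q) as [N HN].
  exists N. intros n Hn. specialize (HN n Hn).
  rewrite Rabs_pos_eq in HN by (apply pow_le; lra).
  assert (0 <= q ^ n) by (apply pow_le; lra).
  apply Rle_lt_trans with ((M + 1) * q ^ n); [nra|].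
  apply Rlt_le_trans with ((M + 1) * (e / (M + 1))).
  - apply Rmult_lt_compat_l; lra.
  - right; field; lra.
Qed.

(** The shift arises because [sum_n] includes its upper index and [psum] excludes it. *)
Lemma sum_n_psum (c : nat -> C) (w : C) (n : nat) :
  sum_n (G := C_AbelianGroup)
    (fun k => scal (V := C_NormedModule) (pow_n (K := C_Ring) w k) (c k)) n
  = psum c w (S n).
Proof.
  assert (E : forall k, pow_n (K := C_Ring) w k = Cpow w k).
  { induction k as [|k IH]; simpl; [reflexivity|now rewrite IH]. }
  induction n as [|n IH].
  - rewrite sum_O. simpl. change (Cmult (RtoC 1) (c 0%nat) =
      Cplus (RtoC 0) (Cmult (c 0%nat) (RtoC 1))). ring.
  - rewrite sum_Sn, IH, E. simpl psum.
    change (Cplus (Cplus (psum c w n) (Cmult (c n) (Cpow w n)))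
              (Cmult (Cpow w (S n)) (c (S n))) =
            Cplus (Cplus (psum c w n) (Cmult (c n) (Cpow w n)))
              (Cmult (c (S n)) (Cpow w (S n)))). ring.
Qed.

Lemma is_pseries_intro (c : nat -> C) (w l : C) (M q : R) : 0 <= q < 1 -> 0 <= M ->
  (forall n, Cmod (Cminus l (psum c w n)) <= M * q ^ n) ->
  @is_pseries C_AbsRing C_NormedModule c w l.
Proof.
  intros Hq HM H P HP.
  apply (locally_C_iff l P) in HP. destruct HP as (d & Hd & HP).
  destruct (geometric_remainder_small M q d Hq HM Hd) as [N HN].
  exists N. intros n Hn. apply HP.
  change (Cmod (Cminus (sum_n (G := C_AbelianGroup)
    (fun k => scal (V := C_NormedModule) (pow_n (K := C_Ring) w k) (c k)) n) l) < d).
  rewrite (sum_n_psum c w n).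
  replace (Cminus _ _) with (Copp (Cminus l (psum c w (S n)))) by ring.
  rewrite Cmod_opp. eapply Rle_lt_trans; [apply H|]. apply HN. lia.
Qed.

Lemma circint_one (a : C) (r : R) : 0 <= r ->
  circint (fun _ => RtoC 1) a r = RtoC (2 * PI).
Proof.
  intros Hr.
  assert (H := circint_mean_value (fun _ => RtoC 1) a a (r + 1)
    ltac:(intros; apply continuous_const) ltac:(intros; apply holo_const) r ltac:(lra)).
  rewrite H. ring.
Qed.

Lemma cderiv_inv_pow (a s : C) (n : nat) : Cminus s a <> RtoC 0 ->
  cderiv (fun u => Cpow (Cinv (Cminus u a)) n) s
    (Copp (Cmult (RtoC (INR n)) (Cpow (Cinv (Cminus s a)) (S n)))).
Proof.
  intros Hs. induction n as [|n IH].
  - simpl Cpow at 1. replace (Copp _) with (RtoC 0) by (simpl; ring).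
    apply cderiv_const.
  - assert (D : cderiv (fun u => Cinv (Cminus u a)) s
        (Cmult (Copp (Cinv (Cmult (Cminus s a) (Cminus s a)))) (Cplus (RtoC 1) (RtoC 0)))).
    { apply (cderiv_comp Cinv (fun u => Cminus u a)).
      - apply (cderiv_plus (fun u => u) (fun _ => Copp a));
          [apply cderiv_id|apply cderiv_const].
      - now apply cderiv_inv. }
    assert (E := cderiv_mult _ _ _ _ _ D IH).
    match type of E with cderiv _ _ ?v => replace (Copp _) with v; [exact E|] end.
    rewrite S_INR, RtoC_plus. simpl Cpow. field. assumption.
Qed.

(** Up to the factor [Ci], the integrand is the angular derivative of [F] along a closed curve. All
    integrations by parts on circles go through this. *)
Lemma circint_path_deriv_0 (F F' : C -> C) (a : C) (r : R) : 0 <= r ->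
  (forall s, Cmod (Cminus s a) = r -> cderiv F s (F' s)) -> circle_continuous F' a r ->
  circint (fun s => Cmult (F' s) (Cminus s a)) a r = RtoC 0.
Proof.
  intros Hr HF HF'. assert (P := two_PI_pos).
  assert (I : is_CInt (fun t => Cmult (F' (circ a r t)) (Cmult Ci (Cminus (circ a r t) a)))
     0 (2 * PI) (Cminus (F (circ a r (2 * PI))) (F (circ a r 0)))).
  { apply (is_CInt_path_deriv (fun t => F (circ a r t))); [lra| |]; intros t _.
    - apply (path_deriv_comp F (circ a r)); [apply path_deriv_circ|].
      apply HF. now apply Cmod_circ.
    - apply continuous_Cmult.
      + apply (path_continuous_comp F' (circ a r)); [apply path_continuous_circ|].
        apply HF'. now apply Cmod_circ.
      + apply continuous_Cmult; [apply continuous_const|].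
        apply continuous_Cminus; [apply path_continuous_circ|apply continuous_const]. }
  assert (E : circ a r (2 * PI) = circ a r 0).
  { unfold circ, cis. now rewrite cos_2PI, sin_2PI, cos_0, sin_0. }
  rewrite E in I. replace (Cminus (F (circ a r 0)) (F (circ a r 0))) with (RtoC 0) in I by ring.
  assert (J := is_CInt_Cmult _ _ _ _ (Copp Ci) I).
  replace (Cmult (Copp Ci) (RtoC 0)) with (RtoC 0) in J by ring.
  apply is_CInt_unique.
  apply is_CInt_ext with (3 := J); [lra|]. intros t _.
  replace (Cmult (Copp Ci) _) with (Cmult (Copp (Cmult Ci Ci))
     (Cmult (F' (circ a r t)) (Cminus (circ a r t) a))) by ring.
  replace (Copp (Cmult Ci Ci)) with (RtoC 1)
    by (apply injective_projections; simpl; ring). ring.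
Qed.

(** For [k > 0], the function [(s - a)^-k] is [- 1 / k] times its own derivative multiplied by
    [s - a], so its mean vanishes. *)
Lemma coef_one (a : C) (r : R) (k : nat) : 0 < r ->
  coef (fun _ => RtoC 1) a r k = if Nat.eqb k 0 then RtoC 1 else RtoC 0.
Proof.
  intros Hr. unfold coef. destruct k as [|k]; simpl Nat.eqb; cbn iota.
  - rewrite circint_ext with (G := fun _ => RtoC 1); [|lra|intros; simpl; ring].
    rewrite circint_one by lra. rewrite <- RtoC_mult. f_equal.
    field. apply PI_neq0.
  - assert (H := circint_path_deriv_0
      (fun u => Cpow (Cinv (Cminus u a)) (S k))
      (fun s => Copp (Cmult (RtoC (INR (S k))) (Cpow (Cinv (Cminus s a)) (S (S k)))))
      a r ltac:(lra)).
    assert (NZ : RtoC (INR (S k)) <> RtoC 0).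
    { intros E. apply RtoC_inj in E. now apply (not_0_INR (S k)). }
    rewrite circint_ext with (G := fun s => Cmult (Copp (Cinv (RtoC (INR (S k)))))
      (Cmult (Copp (Cmult (RtoC (INR (S k))) (Cpow (Cinv (Cminus s a)) (S (S k)))))
         (Cminus s a))); [|lra|].
    + rewrite circint_scal; [|lra|].
      * rewrite H; [ring| |].
        -- intros s Hs. apply cderiv_inv_pow. now apply Cmod_circle_neq0 with r.
        -- intros s Hs. apply continuous_Copp, continuous_Cmult;
             [apply continuous_const|]. now apply circle_continuous_pow_inv with r.
      * intros s Hs. apply continuous_Cmult; [|apply continuous_Csub].
        apply continuous_Copp, continuous_Cmult;
             [apply continuous_const|]. now apply circle_continuous_pow_inv with r.
    + intros s Hs. assert (N := Cmod_circle_neq0 a s r Hr Hs).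
      change (Cpow (Cinv (Cminus s a)) (S (S k))) with
        (Cmult (Cinv (Cminus s a)) (Cpow (Cinv (Cminus s a)) (S k))).
      generalize (Cpow (Cinv (Cminus s a)) (S k)). intros p. field. split; assumption.
Qed.

(** The circle winds once around every inner point, not just its centre: all partial sums of the
    expansion are 1, since only the zeroth coefficient of a constant survives. *)
Lemma cauchy_transform_one (a : C) (r : R) (z : C) : Cmod (Cminus z a) < r ->
  cauchy_transform (fun _ => RtoC 1) a r z = RtoC 1.
Proof.
  intros Hz. set (w := Cminus z a) in *. assert (W := Cmod_ge_0 w).
  replace z with (Cplus a w) by (unfold w; ring).
  destruct (cauchy_transform_remainder (fun _ => RtoC 1) a r w) as (M & HM & H).
  - intros s _. apply continuous_const.
  - assumption.
  - apply Ceq_eps. intros e He.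
    destruct (geometric_remainder_small M (Cmod w / r) e) as [N HN]; try assumption.
    { split; [apply Rdiv_le_0_compat; lra|].
      apply Rmult_lt_reg_r with r; [lra|]. unfold Rdiv.
      rewrite Rmult_assoc, Rinv_l by lra. lra. }
    assert (E : forall n, psum (coef (fun _ => RtoC 1) a r) w (S n) = RtoC 1).
    { induction n as [|n IH].
      - simpl. rewrite coef_one by lra. simpl. ring.
      - change (psum ?c w (S (S n))) with
          (Cplus (psum c w (S n)) (Cmult (c (S n)) (Cpow w (S n)))).
        rewrite IH, coef_one by lra. simpl Nat.eqb. cbn iota. ring. }
    rewrite <- (E N) at 1. apply Rlt_le. eapply Rle_lt_trans; [apply H|].
    apply HN. lia.
Qed.

(** The slope [phi] of [F] at [z] is continuous in the disc and holomorphic off [z]. Hence the mean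
    of [phi s * (s - a)] is its value at the centre, which is 0. That mean is the transform of [F]
    minus [F z] times the transform of 1. *)
Theorem cauchy_formula (F : C -> C) (a : C) (rad r : R) (z : C) :
  (forall s, Cmod (Cminus s a) < rad -> holo F s) ->
  Cmod (Cminus z a) < r < rad -> cauchy_transform F a r z = F z.
Proof.
  intros HF Hz. assert (W := Cmod_ge_0 (Cminus z a)).
  destruct (HF z ltac:(lra)) as (l & phi & Hc & Hl & Hphi).
  assert (HK := circle_continuous_cauchy_kernel a z r ltac:(lra)).
  assert (Q : forall s, s <> z -> Cdiv (Cminus (F s) (F z)) (Cminus s z) = phi s).
  { intros s Hs. rewrite (Hphi s). field. now apply Cminus_neq_0. }
  assert (Hhol : forall s, Cmod (Cminus s a) < rad -> s <> z -> holo phi s).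
  { intros s Hs Hn.
    apply holo_ext_loc with (fun s => Cdiv (Cminus (F s) (F z)) (Cminus s z))
      (Cmod (Cminus s z)).
    - apply Cmod_gt_0. now apply Cminus_neq_0.
    - intros u Hu. apply Q. intros ->.
      replace (Cminus z s) with (Copp (Cminus s z)) in Hu by ring.
      rewrite Cmod_opp in Hu. lra.
    - apply holo_div.
      + apply holo_minus; [now apply HF|apply holo_const].
      + apply holo_minus; [apply holo_id|apply holo_const].
      + now apply Cminus_neq_0. }
  assert (M := circint_mean_value (fun s => Cmult (phi s) (Cminus s a)) a z rad).
  specialize (M ltac:(intros s Hs; apply continuous_Cmult; [|apply continuous_Csub];
    destruct (Ceq_dec s z) as [->|n]; [assumption|now apply holo_continuous, Hhol])).
  specialize (M ltac:(intros s Hs _ Hn; apply holo_mult; [now apply Hhol|];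
    apply holo_minus; [apply holo_id|apply holo_const]) r ltac:(lra)).
  simpl in M.
  assert (cphi : circle_continuous (fun s => Cmult (phi s) (Cminus s a)) a r).
  { intros s Hs. apply continuous_Cmult; [|apply continuous_Csub].
    apply holo_continuous, Hhol; [lra|]. intros ->. lra. }
  rewrite <- (Cmult_1_r (F z)), <- (cauchy_transform_one a r z) by lra.
  unfold cauchy_transform.
  rewrite circint_ext with (G := fun s => Cplus (Cmult (phi s) (Cminus s a))
    (Cmult (F z) (Cmult (RtoC 1) (cauchy_kernel a z s)))); [|lra|].
  - rewrite circint_plus; [|lra|assumption|].
    + rewrite M, circint_scal; [ring|lra|].
      intros s Hs. apply continuous_Cmult; [apply continuous_const|now apply HK].
    + intros s Hs. apply continuous_Cmult; [apply continuous_const|].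
      apply continuous_Cmult; [apply continuous_const|now apply HK].
  - intros s Hs. rewrite (Hphi s). unfold cauchy_kernel. field.
    apply Cmod_circle_neq with a r; [lra|assumption].
Qed.

Definition disc_holo (F : C -> C) (a : C) (rad : R) : Prop :=
  forall s, Cmod (Cminus s a) < rad -> holo F s.

Lemma disc_holo_circle (F : C -> C) (a : C) (rad r : R) :
  disc_holo F a rad -> r < rad -> circle_continuous F a r.
Proof. intros H Hr s Hs. apply holo_continuous, H. lra. Qed.

Lemma Rdiv_unit (x r : R) : 0 <= x < r -> 0 <= x / r < 1.
Proof.
  intros H. split; [apply Rdiv_le_0_compat; lra|].
  apply Rmult_lt_reg_r with r; [lra|]. unfold Rdiv.
  rewrite Rmult_assoc, Rinv_l by lra. lra.
Qed.

Lemma taylor_remainder (F : C -> C) (a : C) (rad r : R) (w : C) :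
  disc_holo F a rad -> Cmod w < r < rad ->
  exists M, 0 <= M /\ forall n,
    Cmod (Cminus (F (Cplus a w)) (psum (coef F a r) w n)) <= M * (Cmod w / r) ^ n.
Proof.
  intros HF Hw.
  rewrite <- (cauchy_formula F a rad r (Cplus a w) HF).
  - apply cauchy_transform_remainder; [|lra]. apply disc_holo_circle with rad; [assumption|lra].
  - replace (Cminus (Cplus a w) a) with w by ring. lra.
Qed.

Theorem taylor_series (F : C -> C) (a : C) (rad r : R) (w : C) :
  disc_holo F a rad -> Cmod w < r < rad ->
  @is_pseries C_AbsRing C_NormedModule (coef F a r) w (F (Cplus a w)).
Proof.
  intros HF Hw. assert (W := Cmod_ge_0 w).
  destruct (taylor_remainder F a rad r w HF Hw) as (M & HM & H).
  apply is_pseries_intro with M (Cmod w / r); try assumption.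
  apply Rdiv_unit. lra.
Qed.

Lemma coef_0 (F : C -> C) (a : C) (rad r : R) :
  disc_holo F a rad -> 0 < r < rad -> coef F a r 0 = F a.
Proof.
  intros HF Hr. unfold coef.
  rewrite circint_ext with (G := F); [|lra|intros; simpl; ring].
  rewrite (circint_mean_value F a a rad); [|intros; now apply holo_continuous, HF|
    intros; now apply HF|lra].
  rewrite Cmult_assoc, <- RtoC_mult.
  replace (/ (2 * PI) * (2 * PI)) with 1 by (field; apply PI_neq0). ring.
Qed.

(** * Derivatives, identity theorem, uniform limits *)

(** Differentiation under the integral sign; the quadratic remainder of the kernel is uniform in [s]
    on the circle and is simply integrated. *)
Lemma circint_kernel_deriv (F : C -> C) (k dk : C -> C -> C) (a z : C) (r d K : R) :
  0 <= r -> circle_continuous F a r -> 0 < d -> 0 <= K ->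
  (forall w, Cmod w < d -> circle_continuous (k (Cplus z w)) a r) ->
  circle_continuous (dk z) a r ->
  (forall w s, Cmod w < d -> Cmod (Cminus s a) = r ->
     Cmod (Cminus (Cminus (k (Cplus z w) s) (k z s)) (Cmult w (dk z s)))
       <= K * Cmod w ^ 2) ->
  cderiv (fun u => circint (fun s => Cmult (F s) (k u s)) a r) z
    (circint (fun s => Cmult (F s) (dk z s)) a r).
Proof.
  intros Hr HF Hd HK Hk Hdk H. assert (P := two_PI_pos).
  destruct (circle_bounded F a r Hr HF) as (M & HM0 & HM).
  assert (Hk0 : circle_continuous (k z) a r).
  { replace z with (Cplus z (RtoC 0)) by ring. apply Hk. now rewrite Cmod_0. }
  apply cderiv_of_quadratic with (K := M * K * (2 * PI)) (d := d).
  - assumption.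
  - apply Rmult_le_pos; [now apply Rmult_le_pos|lra].
  - intros w Hw.
    assert (C1 := circle_continuous_mult _ _ _ _ HF (Hk w Hw)).
    assert (C2 := circle_continuous_mult _ _ _ _ HF Hk0).
    assert (C3 := circle_continuous_mult _ _ _ _ HF Hdk).
    assert (I := is_CInt_minus _ _ _ _ _ _ (is_CInt_minus _ _ _ _ _ _
       (circint_correct _ a r Hr C1) (circint_correct _ a r Hr C2))
       (is_CInt_Cmult _ _ _ _ w (circint_correct _ a r Hr C3))).
    rewrite (Cmult_comm _ w).
    replace (M * K * (2 * PI) * Cmod w ^ 2) with (M * (K * Cmod w ^ 2) * (2 * PI - 0)) by ring.
    apply is_CInt_norm_le with (3 := I); [lra|]. intros t Ht. cbv beta.
    replace (Cminus _ _) with (Cmult (F (circ a r t))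
      (Cminus (Cminus (k (Cplus z w) (circ a r t)) (k z (circ a r t)))
         (Cmult w (dk z (circ a r t))))) by ring.
    rewrite Cmod_mult. apply Rmult_le_compat; try apply Cmod_ge_0; [now apply HM|].
    apply H; [assumption|]. now apply Cmod_circ.
Qed.

Lemma circle_continuous_inv (a z : C) (r : R) : Cmod (Cminus z a) < r ->
  circle_continuous (fun s => Cinv (Cminus s z)) a r.
Proof.
  intros Hz s Hs. apply continuous_Cinv; [apply continuous_Csub|].
  now apply Cmod_circle_neq with a r.
Qed.

Lemma Cmod_shift_lt (a z w : C) (r : R) :
  Cmod w < (r - Cmod (Cminus z a)) / 2 -> Cmod (Cminus (Cplus z w) a) < r.
Proof.
  intros H. replace (Cminus (Cplus z w) a) with (Cplus (Cminus z a) w) by ring.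
  assert (T := Cmod_triangle (Cminus z a) w). assert (N := Cmod_ge_0 w). lra.
Qed.

Lemma Cmod_circle_dist (a z s : C) (r : R) : Cmod (Cminus s a) = r ->
  r - Cmod (Cminus z a) <= Cmod (Cminus s z).
Proof.
  intros H. replace (Cminus s a) with (Cplus (Cminus s z) (Cminus z a)) in H by ring.
  assert (T := Cmod_triangle (Cminus s z) (Cminus z a)). lra.
Qed.

Lemma Cmod_inv_le (z : C) (d : R) : 0 < d <= Cmod z -> Cmod (Cinv z) <= / d.
Proof.
  intros H. rewrite Cmod_inv.
  - apply Rinv_le_contravar; lra.
  - apply Cmod_gt_0. lra.
Qed.

Lemma cderiv_cauchy_1 (F : C -> C) (a z : C) (r : R) :
  circle_continuous F a r -> Cmod (Cminus z a) < r ->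
  cderiv (fun u => circint (fun s => Cmult (F s) (Cinv (Cminus s u))) a r) z
    (circint (fun s => Cmult (F s) (Cpow (Cinv (Cminus s z)) 2)) a r).
Proof.
  intros HF Hz. assert (N := Cmod_ge_0 (Cminus z a)).
  (* At most half the distance from [z] to the circle, so that [z + w] stays at distance at least
     [d] from the circle when [Cmod w < d]. *)
  set (d := (r - Cmod (Cminus z a)) / 2).
  assert (Hd : 0 < d) by (unfold d; lra).
  apply (circint_kernel_deriv F (fun u s => Cinv (Cminus s u))
     (fun z s => Cpow (Cinv (Cminus s z)) 2) a z r d (/ d * / d * / d)); try assumption.
  - lra.
  - apply Rlt_le, Rmult_lt_0_compat; [apply Rmult_lt_0_compat|]; now apply Rinv_0_lt_compat.
  - intros w Hw. apply circle_continuous_inv. now apply Cmod_shift_lt.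
  - intros s Hs. apply continuous_Cpow. now apply circle_continuous_inv with a r.
  - intros w s Hw Hs. assert (D := Cmod_circle_dist a z s r Hs).
    assert (N1 : Cminus s z <> RtoC 0) by now apply Cmod_circle_neq with a r.
    assert (Hz' := Cmod_shift_lt a z w r Hw).
    assert (N2 : Cminus s (Cplus z w) <> RtoC 0) by now apply Cmod_circle_neq with a r.
    (* With [u = s - z]: 1/(u-w) - 1/u - w/u^2 = w^2 / (u^2 (u-w)). *)
    replace (Cminus _ _) with (Cmult (Cmult (Cmult (Cinv (Cminus s z)) (Cinv (Cminus s z)))
       (Cinv (Cminus s (Cplus z w)))) (Cpow w 2)) by (simpl; field; split; assumption).
    rewrite !Cmod_mult, Cmod_pow.
    apply Rmult_le_compat_r; [apply pow2_ge_0|].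
    assert (E : d <= Cmod (Cminus s (Cplus z w))).
    { assert (T := Cmod_triangle (Cminus s (Cplus z w)) w).
      replace (Cplus (Cminus s (Cplus z w)) w) with (Cminus s z) in T by ring.
      unfold d in *. lra. }
    repeat apply Rmult_le_compat; try apply Cmod_ge_0;
      try (apply Rmult_le_pos; apply Cmod_ge_0); apply Cmod_inv_le; unfold d in *; lra.
Qed.

Lemma holo_cauchy_2 (F : C -> C) (a z : C) (r : R) :
  circle_continuous F a r -> Cmod (Cminus z a) < r ->
  holo (fun u => circint (fun s => Cmult (F s) (Cpow (Cinv (Cminus s u)) 2)) a r) z.
Proof.
  intros HF Hz. assert (N := Cmod_ge_0 (Cminus z a)).
  set (d := (r - Cmod (Cminus z a)) / 2).
  assert (Hd : 0 < d) by (unfold d; lra).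
  assert (Hi := Rinv_0_lt_compat d Hd).
  eexists. apply (circint_kernel_deriv F (fun u s => Cpow (Cinv (Cminus s u)) 2)
     (fun z s => Cmult (RtoC 2) (Cpow (Cinv (Cminus s z)) 3)) a z r d
     (2 * / d ^ 4 + / d ^ 4)); try assumption.
  - lra.
  - assert (Q := pow_lt _ 4 Hd). assert (Q' := Rinv_0_lt_compat _ Q). lra.
  - intros w Hw s Hs. apply continuous_Cpow.
    apply circle_continuous_inv with a r; [now apply Cmod_shift_lt|assumption].
  - intros s Hs. apply continuous_Cmult; [apply continuous_const|].
    apply continuous_Cpow. now apply circle_continuous_inv with a r.
  - intros w s Hw Hs. assert (D := Cmod_circle_dist a z s r Hs).
    assert (N1 : Cminus s z <> RtoC 0) by now apply Cmod_circle_neq with a r.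
    assert (Hz' := Cmod_shift_lt a z w r Hw).
    assert (N2 : Cminus s (Cplus z w) <> RtoC 0) by now apply Cmod_circle_neq with a r.
    assert (E : d <= Cmod (Cminus s (Cplus z w))).
    { assert (T := Cmod_triangle (Cminus s (Cplus z w)) w).
      replace (Cplus (Cminus s (Cplus z w)) w) with (Cminus s z) in T by ring.
      unfold d in *. lra. }
    (* With [u = s - z]:
       (u-w)^-2 - u^-2 - 2 w u^-3 = w^2 (2 u^-3 (u-w)^-1 + u^-2 (u-w)^-2). *)
    replace (Cminus _ _) with (Cmult (Cplus
        (Cmult (RtoC 2) (Cmult (Cpow (Cinv (Cminus s z)) 3) (Cinv (Cminus s (Cplus z w)))))
        (Cmult (Cpow (Cinv (Cminus s z)) 2) (Cpow (Cinv (Cminus s (Cplus z w))) 2)))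
        (Cpow w 2)) by (simpl; field; split; assumption).
    rewrite Cmod_mult, Cmod_pow. apply Rmult_le_compat_r; [apply pow2_ge_0|].
    eapply Rle_trans; [apply Cmod_triangle|].
    rewrite !Cmod_mult, !Cmod_pow, Cmod_R, Rabs_pos_eq by lra.
    assert (B1 : Cmod (Cinv (Cminus s z)) <= / d) by (apply Cmod_inv_le; unfold d in *; lra).
    assert (B2 : Cmod (Cinv (Cminus s (Cplus z w))) <= / d) by (apply Cmod_inv_le; lra).
    assert (P1 := Cmod_ge_0 (Cinv (Cminus s z))).
    assert (P2 := Cmod_ge_0 (Cinv (Cminus s (Cplus z w)))).
    apply Rplus_le_compat.
    + apply Rmult_le_compat_l; [lra|].
      replace (/ d ^ 4) with ((/ d) ^ 3 * / d) by (field; lra).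
      apply Rmult_le_compat; try assumption; [now apply pow_le|].
      apply pow_incr; lra.
    + replace (/ d ^ 4) with ((/ d) ^ 2 * (/ d) ^ 2) by (field; lra).
      apply Rmult_le_compat; try (now apply pow_le); apply pow_incr; lra.
Qed.

Lemma cderiv_C_derive (F : C -> C) (z l : C) : cderiv F z l -> C_derive F z = l.
Proof. intros H. now apply is_C_derive_unique, cderiv_is_derive. Qed.

Lemma holo_C_derive (F : C -> C) (z : C) : holo F z -> cderiv F z (C_derive F z).
Proof. intros [l H]. now rewrite (cderiv_C_derive F z l H). Qed.

Lemma cauchy_transform_alt (F : C -> C) (a : C) (r : R) (z : C) : 0 <= r ->
  cauchy_transform F a r z = Cmult (RtoC (/ (2 * PI)))
   (circint (fun s => Cmult (Cmult (F s) (Cminus s a)) (Cinv (Cminus s z))) a r).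
Proof.
  intros Hr. unfold cauchy_transform, cauchy_kernel. f_equal.
  apply circint_ext; [assumption|]. intros s _. unfold Cdiv. ring.
Qed.

Lemma circle_continuous_mult_id (F : C -> C) (a : C) (r : R) :
  circle_continuous F a r -> circle_continuous (fun s => Cmult (F s) (Cminus s a)) a r.
Proof.
  intros HF s Hs. apply continuous_Cmult; [now apply HF|apply continuous_Csub].
Qed.

Lemma holo_cauchy_transform (F : C -> C) (a z : C) (r : R) :
  circle_continuous F a r -> Cmod (Cminus z a) < r ->
  holo (cauchy_transform F a r) z.
Proof.
  intros HF Hz. assert (N := Cmod_ge_0 (Cminus z a)).
  apply holo_ext with (fun z => Cmult (RtoC (/ (2 * PI)))
   (circint (fun s => Cmult (Cmult (F s) (Cminus s a)) (Cinv (Cminus s z))) a r)).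
  - intros s. symmetry. apply cauchy_transform_alt. lra.
  - apply holo_mult; [apply holo_const|]. eexists.
    apply (cderiv_cauchy_1 (fun s => Cmult (F s) (Cminus s a))); [|assumption].
    now apply circle_continuous_mult_id.
Qed.

Lemma cderiv_ext_loc (F G : C -> C) (z l : C) (d : R) :
  0 < d -> (forall s, Cmod (Cminus s z) < d -> F s = G s) ->
  cderiv F z l -> cderiv G z l.
Proof.
  intros Hd E H. 
  destruct (holo_ext_loc F G z d Hd E (ex_intro _ l H)) as [m Hm].
  enough (l = m) by now subst.
  apply cderiv_is_derive in H. apply cderiv_is_derive in Hm.
  rewrite <- (is_C_derive_unique _ _ _ Hm). symmetry.
  apply is_C_derive_unique.
  apply (is_derive_ext_loc (V := C_NormedModule) F G); [|exact H].
  exists (mkposreal d Hd). intros s Hs. apply E. exact Hs.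
Qed.

(** Near [z], Cauchy's formula writes the derivative as an integral of boundary values against the
    squared kernel, and that integral can be differentiated once more. *)
Theorem disc_holo_C_derive (F : C -> C) (a : C) (rad : R) :
  disc_holo F a rad -> disc_holo (C_derive F) a rad.
Proof.
  intros HF z Hz. set (r := (Cmod (Cminus z a) + rad) / 2).
  assert (N := Cmod_ge_0 (Cminus z a)).
  assert (Hr : Cmod (Cminus z a) < r < rad) by (unfold r; lra).
  assert (CF := disc_holo_circle F a rad r HF ltac:(lra)).
  assert (CF' := circle_continuous_mult_id F a r CF).
  set (K := fun u => Cmult (RtoC (/ (2 * PI)))
    (circint (fun s => Cmult (Cmult (F s) (Cminus s a)) (Cpow (Cinv (Cminus s u)) 2)) a r)).
  assert (D : forall u, Cmod (Cminus u a) < r -> C_derive F u = K u).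
  { intros u Hu. apply cderiv_C_derive.
    apply cderiv_ext_loc with (fun z => Cmult (RtoC (/ (2 * PI)))
     (circint (fun s => Cmult (Cmult (F s) (Cminus s a)) (Cinv (Cminus s z))) a r))
     ((r - Cmod (Cminus u a)) / 2).
    - lra.
    - intros s Hs. rewrite <- cauchy_transform_alt by lra.
      apply cauchy_formula with rad; [assumption|]. split; [|lra].
      replace s with (Cplus u (Cminus s u)) by ring. now apply Cmod_shift_lt.
    - assert (E := cderiv_mult _ _ _ _ _ (cderiv_const (RtoC (/ (2 * PI))) u)
         (cderiv_cauchy_1 (fun s => Cmult (F s) (Cminus s a)) a u r CF' Hu)).
      match type of E with cderiv _ _ ?v => replace (K u) with v; [exact E|] end.
      unfold K. ring. }
  apply holo_ext_loc with K ((r - Cmod (Cminus z a)) / 2).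
  - lra.
  - intros s Hs. symmetry. apply D.
    replace s with (Cplus z (Cminus s z)) by ring. now apply Cmod_shift_lt.
  - apply holo_mult; [apply holo_const|]. apply holo_cauchy_2; [assumption|lra].
Qed.

Lemma disc_holo_C_derive_n (F : C -> C) (a : C) (rad : R) (n : nat) :
  disc_holo F a rad -> disc_holo (C_derive_n F n) a rad.
Proof.
  intros HF. induction n as [|n IH]; simpl; [assumption|]. now apply disc_holo_C_derive.
Qed.

(** Integration by parts on the circle: [H'] is the derivative of [F s] times [(s - a)^-(k+1)], so
    the mean of [H' s * (s - a)] vanishes. *)
Lemma coef_C_derive (F : C -> C) (a : C) (rad r : R) (k : nat) :
  disc_holo F a rad -> 0 < r < rad ->
  coef (C_derive F) a r k = Cmult (RtoC (INR (S k))) (coef F a r (S k)).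
Proof.
  intros HF Hr.
  assert (HF' := disc_holo_C_derive F a rad HF).
  assert (CF := disc_holo_circle F a rad r HF ltac:(lra)).
  assert (CF' := disc_holo_circle _ a rad r HF' ltac:(lra)).
  set (H' := fun s => Cminus
     (Cmult (C_derive F s) (Cpow (Cinv (Cminus s a)) (S k)))
     (Cmult (RtoC (INR (S k))) (Cmult (F s) (Cpow (Cinv (Cminus s a)) (S (S k)))))).
  assert (Z : circint (fun s => Cmult (H' s) (Cminus s a)) a r = RtoC 0).
  { apply (circint_path_deriv_0
      (fun u => Cmult (F u) (Cpow (Cinv (Cminus u a)) (S k))) H'); [lra| |].
    - intros s Hs. assert (N := Cmod_circle_neq0 a s r ltac:(lra) Hs).
      assert (E := cderiv_mult _ _ _ _ _ (holo_C_derive F s (HF s ltac:(lra)))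
         (cderiv_inv_pow a s (S k) N)).
      match type of E with cderiv _ _ ?v => replace (H' s) with v; [exact E|] end.
      unfold H'. ring.
    - intros s Hs. apply continuous_Cminus.
      + exact (circle_continuous_coef _ a r (S k) ltac:(lra) CF' s Hs).
      + apply continuous_Cmult; [apply continuous_const|].
        exact (circle_continuous_coef _ a r (S (S k)) ltac:(lra) CF s Hs). }
  apply Cminus_eq_0. unfold coef.
  rewrite (circint_ext (fun s => Cmult (H' s) (Cminus s a)) (fun s => Cplus
     (Cmult (C_derive F s) (Cpow (Cinv (Cminus s a)) k))
     (Cmult (Copp (RtoC (INR (S k)))) (Cmult (F s) (Cpow (Cinv (Cminus s a)) (S k))))))
    in Z; [|lra|].
  - rewrite circint_plus, circint_scal in Z; [|lra| |lra| |].
    + replace (Cminus _ _) with (Cmult (RtoC (/ (2 * PI)))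
        (Cplus (circint (fun s => Cmult (C_derive F s) (Cpow (Cinv (Cminus s a)) k)) a r)
           (Cmult (Copp (RtoC (INR (S k))))
             (circint (fun s => Cmult (F s) (Cpow (Cinv (Cminus s a)) (S k))) a r)))) by ring.
      rewrite Z. ring.
    + apply circle_continuous_coef; [lra|assumption].
    + apply circle_continuous_coef; [lra|assumption].
    + intros s Hs. apply continuous_Cmult; [apply continuous_const|].
      exact (circle_continuous_coef _ a r (S k) ltac:(lra) CF s Hs).
  - intros s Hs. assert (N := Cmod_circle_neq0 a s r ltac:(lra) Hs).
    unfold H'. 
    change (Cpow (Cinv (Cminus s a)) (S (S k))) with
      (Cmult (Cinv (Cminus s a)) (Cpow (Cinv (Cminus s a)) (S k))).
    change (Cpow (Cinv (Cminus s a)) (S k)) with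
      (Cmult (Cinv (Cminus s a)) (Cpow (Cinv (Cminus s a)) k)).
    generalize (Cpow (Cinv (Cminus s a)) k). intros p. field. assumption.
Qed.

(** Stated for every [j] because the induction on [n] trades one derivative for a shift of the
    index; [j = 0] is the case of interest. *)
Lemma coef_C_derive_n (F : C -> C) (a : C) (rad r : R) (n j : nat) :
  disc_holo F a rad -> 0 < r < rad ->
  Cmult (RtoC (INR (fact j))) (coef (C_derive_n F n) a r j) =
  Cmult (RtoC (INR (fact (j + n)))) (coef F a r (j + n)).
Proof.
  intros HF Hr. revert j. induction n as [|n IH]; intros j.
  - now rewrite Nat.add_0_r.
  - simpl C_derive_n. rewrite (coef_C_derive _ a rad r j);
      [|now apply disc_holo_C_derive_n|assumption].
    rewrite Nat.add_succ_r, <- Nat.add_succ_l, <- IH.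
    rewrite fact_simpl, mult_INR, RtoC_mult. ring.
Qed.

Lemma C_derive_n_coef (F : C -> C) (a : C) (rad r : R) (n : nat) :
  disc_holo F a rad -> 0 < r < rad ->
  C_derive_n F n a = Cmult (RtoC (INR (fact n))) (coef F a r n).
Proof.
  intros HF Hr. rewrite <- (coef_0 _ a rad r (disc_holo_C_derive_n F a rad n HF) Hr).
  rewrite <- (Cmult_1_l (coef _ _ _ 0)). exact (coef_C_derive_n F a rad r n 0 HF Hr).
Qed.

Lemma RtoC_fact_neq (n : nat) : RtoC (INR (fact n)) <> RtoC 0.
Proof. intros E. apply RtoC_inj in E. now apply (INR_fact_neq_0 n). Qed.

(** Both sides are the [n]-th derivative at [a] divided by the factorial, in which no radius
    occurs. *)
Lemma coef_radius (F : C -> C) (a : C) (rad r1 r2 : R) (n : nat) :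
  disc_holo F a rad -> 0 < r1 < rad -> 0 < r2 < rad ->
  coef F a r1 n = coef F a r2 n.
Proof.
  intros HF H1 H2.
  assert (E1 := C_derive_n_coef F a rad r1 n HF H1).
  assert (E2 := C_derive_n_coef F a rad r2 n HF H2).
  assert (N := RtoC_fact_neq n).
  replace (coef F a r1 n) with (Cmult (Cinv (RtoC (INR (fact n))))
    (Cmult (RtoC (INR (fact n))) (coef F a r1 n))) by (field; assumption).
  rewrite <- E1, E2. field. assumption.
Qed.

Lemma coef_ext (F G : C -> C) (a : C) (r : R) (k : nat) : 0 <= r ->
  (forall s, Cmod (Cminus s a) = r -> F s = G s) -> coef F a r k = coef G a r k.
Proof.
  intros Hr H. unfold coef. f_equal. apply circint_ext; [assumption|].
  intros s Hs. now rewrite H.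
Qed.

Lemma coef_plus (F G : C -> C) (a : C) (r : R) (k : nat) : 0 < r ->
  circle_continuous F a r -> circle_continuous G a r ->
  coef (fun s => Cplus (F s) (G s)) a r k = Cplus (coef F a r k) (coef G a r k).
Proof.
  intros Hr HF HG. unfold coef. rewrite <- Cmult_plus_distr_l. f_equal.
  rewrite <- circint_plus; [|lra| |]; try now apply circle_continuous_coef.
  apply circint_ext; [lra|]. intros; ring.
Qed.

Lemma coef_scal (c : C) (F : C -> C) (a : C) (r : R) (k : nat) : 0 < r ->
  circle_continuous F a r ->
  coef (fun s => Cmult c (F s)) a r k = Cmult c (coef F a r k).
Proof.
  intros Hr HF. unfold coef.
  rewrite circint_ext with (G := fun s => Cmult c (Cmult (F s) (Cpow (Cinv (Cminus s a)) k)));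
    [|lra|intros; ring].
  rewrite circint_scal; [ring|lra|now apply circle_continuous_coef].
Qed.

Lemma coef_minus (F G : C -> C) (a : C) (r : R) (k : nat) : 0 < r ->
  circle_continuous F a r -> circle_continuous G a r ->
  coef (fun s => Cminus (F s) (G s)) a r k = Cminus (coef F a r k) (coef G a r k).
Proof.
  intros Hr HF HG.
  rewrite coef_ext with (G := fun s => Cplus (F s) (Cmult (Copp (RtoC 1)) (G s)));
    [|lra|intros; ring].
  rewrite coef_plus, coef_scal; try assumption; [ring|].
  intros s Hs. apply continuous_Cmult; [apply continuous_const|now apply HG].
Qed.

(** Cauchy's estimate. Applied to a difference, it carries closeness on a circle over to each
    coefficient. *)
Lemma coef_bound (F : C -> C) (a : C) (r M : R) (k : nat) : 0 < r ->
  circle_continuous F a r ->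
  (forall s, Cmod (Cminus s a) = r -> Cmod (F s) <= M) ->
  Cmod (coef F a r k) <= M * (/ r) ^ k.
Proof.
  intros Hr HF HM. assert (P := two_PI_pos). unfold coef.
  rewrite Cmod_mult, Cmod_R, Rabs_pos_eq by (apply Rlt_le, Rinv_0_lt_compat; lra).
  apply Rmult_le_reg_l with (2 * PI); [assumption|].
  rewrite <- Rmult_assoc, Rinv_r, Rmult_1_l by lra.
  rewrite (Rmult_comm (2 * PI)). apply circint_bound; [lra| |].
  - now apply circle_continuous_coef.
  - intros s Hs. assert (N := Cmod_circle_neq0 a s r Hr Hs).
    rewrite Cmod_mult, Cmod_pow, Cmod_inv, Hs by assumption.
    apply Rmult_le_compat_r; [|now apply HM].
    apply pow_le, Rlt_le, Rinv_0_lt_compat; assumption.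
Qed.

(** The coefficients can be computed on a circle so small that [F] vanishes on it; they are then 0
    for every radius, and the Taylor remainder tends to 0. *)
Theorem identity_disc (F : C -> C) (a : C) (rad d : R) :
  disc_holo F a rad -> 0 < d -> (forall s, Cmod (Cminus s a) < d -> F s = RtoC 0) ->
  forall s, Cmod (Cminus s a) < rad -> F s = RtoC 0.
Proof.
  intros HF Hd HZ s Hs. assert (N := Cmod_ge_0 (Cminus s a)).
  set (r := (Cmod (Cminus s a) + rad) / 2).
  assert (Hr : Cmod (Cminus s a) < r < rad) by (unfold r; lra).
  set (r0 := Rmin (d / 2) r).
  assert (Hr0 : 0 < r0 <= r /\ r0 <= d / 2).
  { split; [split|]; [apply Rmin_pos; lra|apply Rmin_r|apply Rmin_l]. }
  assert (Cz : forall k, coef F a r k = RtoC 0).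
  { intros k. rewrite (coef_radius F a rad r r0) by (try assumption; lra).
    apply Cmod_le_0. eapply Rle_trans.
    - apply coef_bound with (M := 0); [lra| |].
      + apply disc_holo_circle with rad; [assumption|lra].
      + intros u Hu. rewrite HZ by lra. rewrite Cmod_0. lra.
    - lra. }
  assert (Pz : forall w n, psum (coef F a r) w n = RtoC 0).
  { intros w n. induction n as [|n IH]; simpl; [reflexivity|].
    rewrite IH, Cz. ring. }
  destruct (taylor_remainder F a rad r (Cminus s a) HF Hr) as (M & HM & H).
  replace (Cplus a (Cminus s a)) with s in H by ring.
  apply Ceq_eps. intros e He.
  destruct (geometric_remainder_small M (Cmod (Cminus s a) / r) e) as [n Hn]; try assumption.
  { apply Rdiv_unit; lra. }
  rewrite <- (Pz (Cminus s a) n) at 1. apply Rlt_le.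
  eapply Rle_lt_trans; [apply H|]. now apply Hn.
Qed.

(** * Uniform limits of holomorphic functions *)

Lemma cauchy_transform_near (F G : C -> C) (a : C) (r e : R) (z : C) :
  circle_continuous F a r -> circle_continuous G a r -> Cmod (Cminus z a) < r ->
  (forall s, Cmod (Cminus s a) = r -> Cmod (Cminus (F s) (G s)) <= e) ->
  Cmod (Cminus (cauchy_transform F a r z) (cauchy_transform G a r z))
    <= e * (r / (r - Cmod (Cminus z a))).
Proof.
  intros HF HG Hz H. assert (P := two_PI_pos). assert (N := Cmod_ge_0 (Cminus z a)).
  assert (HK := circle_continuous_cauchy_kernel a z r Hz).
  unfold cauchy_transform.
  match goal with |- Cmod (Cminus (Cmult ?A ?X) (Cmult ?A ?Y)) <= _ =>
    replace (Cminus (Cmult A X) (Cmult A Y)) with (Cmult A (Cminus X Y)) by ring end.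
  rewrite Cmod_mult, Cmod_R, Rabs_pos_eq by (apply Rlt_le, Rinv_0_lt_compat; lra).
  apply Rmult_le_reg_l with (2 * PI); [assumption|].
  rewrite <- Rmult_assoc, Rinv_r, Rmult_1_l by lra.
  rewrite (Rmult_comm (2 * PI)). apply circint_near; try lra.
  - now apply circle_continuous_mult.
  - now apply circle_continuous_mult.
  - intros t _.
    assert (C1 := Cmod_circ a r t ltac:(lra)).
    replace (Cminus _ _) with (Cmult (Cminus (F (circ a r t)) (G (circ a r t)))
      (cauchy_kernel a z (circ a r t))) by ring.
    rewrite Cmod_mult. apply Rmult_le_compat; try apply Cmod_ge_0; [now apply H|].
    unfold cauchy_kernel, Cdiv. rewrite Cmod_mult, C1.
    apply Rmult_le_compat_l; [lra|]. apply Cmod_inv_le.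
    assert (D := Cmod_circle_dist a z _ r C1). lra.
Qed.

Lemma continuous_uniform_limit (F : C -> C) (G : nat -> C -> C) (z : C) (d : R) :
  0 < d -> (forall n, ccontinuous (G n) z) ->
  (forall e, 0 < e -> exists n, forall s, Cmod (Cminus s z) < d ->
     Cmod (Cminus (F s) (G n s)) <= e) ->
  ccontinuous F z.
Proof.
  intros Hd HG H. apply continuous_Cmod_iff. intros e He.
  destruct (H (e / 4) ltac:(lra)) as [n Hn].
  assert (A := proj1 (continuous_Cmod_iff _ _ _) (HG n) (e / 4) ltac:(lra)).
  apply locally_C_iff in A. destruct A as (d' & Hd' & HA).
  apply locally_C_iff. exists (Rmin d d'). split; [now apply Rmin_pos|].
  intros s Hs. assert (M1 := Rmin_l d d'). assert (M2 := Rmin_r d d').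
  assert (B1 := Hn s ltac:(lra)). assert (B2 := HA s ltac:(lra)).
  assert (B3 := Hn z ltac:(replace (Cminus z z) with (RtoC 0) by ring; now rewrite Cmod_0)).
  replace (Cminus (F s) (F z)) with
    (Cplus (Cplus (Cminus (F s) (G n s)) (Cminus (G n s) (G n z)))
       (Copp (Cminus (F z) (G n z)))) by ring.
  eapply Rle_lt_trans; [apply Cmod_triangle|]. rewrite Cmod_opp.
  assert (T := Cmod_triangle (Cminus (F s) (G n s)) (Cminus (G n s) (G n z))). lra.
Qed.

(* Weierstrass: Cauchy's formula survives the uniform limit. *)
Theorem disc_holo_limit (F : C -> C) (G : nat -> C -> C) (a : C) (rad : R) :
  (forall n, disc_holo (G n) a rad) ->
  (forall e, 0 < e -> exists n, forall s, Cmod (Cminus s a) < rad ->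
     Cmod (Cminus (F s) (G n s)) <= e) ->
  disc_holo F a rad.
Proof.
  intros HG H z Hz0. assert (N0 := Cmod_ge_0 (Cminus z a)).
  set (r := (Cmod (Cminus z a) + rad) / 2).
  assert (Hr : Cmod (Cminus z a) < r < rad) by (unfold r; lra).
  assert (Hz : Cmod (Cminus z a) < r) by lra.
  assert (HF : circle_continuous F a r).
  { intros s Hs. apply continuous_uniform_limit with G ((rad - Cmod (Cminus s a)) / 2).
    - lra.
    - intros n. apply holo_continuous, HG. lra.
    - intros e He. destruct (H e He) as [n Hn]. exists n. intros u Hu. apply Hn.
      replace u with (Cplus s (Cminus u s)) by ring. now apply Cmod_shift_lt. }
  apply holo_ext_loc with (cauchy_transform F a r) ((r - Cmod (Cminus z a)) / 2).
  - lra.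
  - intros s Hs'.
    assert (Hs : Cmod (Cminus s a) < r).
    { replace s with (Cplus z (Cminus s z)) by ring. now apply Cmod_shift_lt. }
    assert (N := Cmod_ge_0 (Cminus s a)).
    (* With accuracy [e / S] on the disc, the error of the transforms, magnified by
       [r / (r - Cmod (s - a))], and the error of the values at [s] add up to [e]. *)
    set (S := r / (r - Cmod (Cminus s a)) + 1).
    assert (HS : 0 <= r / (r - Cmod (Cminus s a))) by (apply Rdiv_le_0_compat; lra).
    apply Ceq_eps. intros e He.
    destruct (H (e / S)) as [n Hn].
    { apply Rdiv_lt_0_compat; [assumption|unfold S; lra]. }
    assert (T := cauchy_transform_near F (G n) a r (e / S) s HF
      (disc_holo_circle _ a rad r (HG n) ltac:(lra)) Hs ltac:(intros; apply Hn; lra)).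
    rewrite (cauchy_formula (G n) a rad r s (HG n)) in T by lra.
    assert (T2 := Hn s ltac:(lra)).
    replace (Cminus (cauchy_transform F a r s) (F s)) with
      (Cplus (Cminus (cauchy_transform F a r s) (G n s)) (Copp (Cminus (F s) (G n s)))) by ring.
    eapply Rle_trans; [apply Cmod_triangle|]. rewrite Cmod_opp.
    replace e with (e / S * (r / (r - Cmod (Cminus s a))) + e / S) at 1.
    + lra.
    + unfold S. field. unfold S in *. lra.
  - apply holo_cauchy_transform; assumption.
Qed.

(** * Taylor coefficients of the approximations at [alpha] *)

Definition cpw (x : R) (s : C) : C := Cexp (Cmult s (RtoC (ln x))).

Fixpoint csum (u : nat -> C) (N : nat) : C :=
  match N with
  | O => RtoC 0
  | S M => Cplus (csum u M) (u (S M))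
  end.

Lemma csum_sum_n_m (u : nat -> C) (N : nat) :
  @sum_n_m C_AbelianGroup u 1 N = csum u N.
Proof.
  induction N as [|N IH].
  - rewrite sum_n_m_zero by lia. reflexivity.
  - rewrite sum_n_Sm by lia. rewrite IH. reflexivity.
Qed.

Lemma RtoC_sum_n_m (u : nat -> R) (N : nat) :
  RtoC (sum_n_m u 1 N) = csum (fun n => RtoC (u n)) N.
Proof.
  induction N as [|N IH].
  - rewrite sum_n_m_zero by lia. reflexivity.
  - rewrite sum_n_Sm by lia. simpl. rewrite <- IH. apply RtoC_plus.
Qed.

Lemma csum_ext (u v : nat -> C) (N : nat) :
  (forall n, (1 <= n <= N)%nat -> u n = v n) -> csum u N = csum v N.
Proof.
  intros H. induction N as [|N IH]; simpl; [reflexivity|].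
  rewrite IH, (H (S N)); [reflexivity|lia|intros; apply H; lia].
Qed.

Lemma csum_plus (u v : nat -> C) (N : nat) :
  csum (fun n => Cplus (u n) (v n)) N = Cplus (csum u N) (csum v N).
Proof. induction N as [|N IH]; simpl; [ring|rewrite IH; ring]. Qed.

Lemma csum_scal (c : C) (u : nat -> C) (N : nat) :
  csum (fun n => Cmult c (u n)) N = Cmult c (csum u N).
Proof. induction N as [|N IH]; simpl; [ring|rewrite IH; ring]. Qed.

Lemma holo_csum (u : nat -> C -> C) (N : nat) (z : C) :
  (forall n, (1 <= n <= N)%nat -> holo (u n) z) -> holo (fun s => csum (fun n => u n s) N) z.
Proof.
  intros H. induction N as [|N IH]; simpl; [apply holo_const|].
  apply holo_plus; [|apply H; lia]. apply IH. intros; apply H; lia.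
Qed.

Lemma coef_csum (u : nat -> C -> C) (N : nat) (a : C) (rad r : R) (k : nat) :
  0 < r < rad -> (forall n, (1 <= n <= N)%nat -> disc_holo (u n) a rad) ->
  coef (fun s => csum (fun n => u n s) N) a r k = csum (fun n => coef (u n) a r k) N.
Proof.
  intros Hr H. induction N as [|N IH]; simpl.
  - apply Cmod_le_0. eapply Rle_trans.
    + apply coef_bound with (M := 0); [lra| |].
      * intros s _. apply continuous_const.
      * intros s _. rewrite Cmod_0. lra.
    + lra.
  - rewrite coef_plus; [|lra| |].
    + rewrite IH; [reflexivity|]. intros; apply H; lia.
    + apply disc_holo_circle with rad; [|lra]. intros s Hs. apply holo_csum.
      intros n Hn. apply H; [lia|assumption].
    + apply disc_holo_circle with rad; [|lra]. apply H. lia.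
Qed.

Lemma Cmod_cpw (x : R) (s : C) : Cmod (cpw x s) = exp (Re s * ln x).
Proof. unfold cpw. now rewrite Cexp_Cmod, re_scal_r. Qed.

Lemma cpw_plus (x : R) (s t : C) : cpw x (Cplus s t) = Cmult (cpw x s) (cpw x t).
Proof. unfold cpw. rewrite <- Cexp_plus. f_equal. ring. Qed.

Lemma cpw_RtoC (x y : R) : cpw x (RtoC y) = RtoC (exp (y * ln x)).
Proof.
  unfold cpw. rewrite <- RtoC_mult. unfold Cexp, RtoC; simpl.
  rewrite cos_0, sin_0. apply injective_projections; simpl; ring.
Qed.

Lemma cpw_1 (x : R) : 0 < x -> cpw x (RtoC 1) = RtoC x.
Proof. intros H. rewrite cpw_RtoC, Rmult_1_l, exp_ln by assumption. reflexivity. Qed.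

Lemma cderiv_cpw (x : R) (b s : C) :
  cderiv (fun s => cpw x (Cminus b s)) s
    (Cmult (RtoC (- ln x)) (cpw x (Cminus b s))).
Proof.
  assert (D : cderiv (fun s => Cmult (Cminus b s) (RtoC (ln x))) s
    (Cplus (Cmult (Cplus (RtoC 0) (Copp (RtoC 1))) (RtoC (ln x)))
           (Cmult (Cminus b s) (RtoC 0)))).
  { apply (cderiv_mult (fun s => Cminus b s) (fun _ => RtoC (ln x)));
      [|apply cderiv_const].
    apply (cderiv_plus (fun _ => b) (fun s => Copp s)); [apply cderiv_const|].
    exists (fun _ => Copp (RtoC 1)). split; [apply continuous_const|].
    split; [reflexivity|intros; ring]. }
  assert (E := cderiv_comp Cexp _ _ _ _ D (cderiv_Cexp _)).
  match type of E with cderiv _ _ ?v => replace (Cmult (RtoC (- ln x)) _) with v; [exact E|] end.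
  unfold cpw. rewrite RtoC_opp. ring.
Qed.

Lemma holo_cpw (x : R) (b s : C) : holo (fun s => cpw x (Cminus b s)) s.
Proof. eexists. apply cderiv_cpw. Qed.

(** As a function of [s], [x^(b-s)] is an eigenfunction of differentiation with eigenvalue [- ln x],
    so [coef_C_derive] becomes a recursion for its coefficients alone. *)
Lemma coef_cpw (x : R) (b a : C) (r : R) (k : nat) : 0 < r ->
  coef (fun s => cpw x (Cminus b s)) a r k =
  Cmult (RtoC ((-1) ^ k / INR (fact k) * ln x ^ k)) (cpw x (Cminus b a)).
Proof.
  intros Hr.
  assert (HF : disc_holo (fun s => cpw x (Cminus b s)) a (r + 1)).
  { intros s _. apply holo_cpw. }
  induction k as [|k IH].
  - rewrite (coef_0 _ a (r + 1) r HF) by lra. simpl.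
    replace (1 / 1 * 1) with 1 by field. ring.
  - assert (E := coef_C_derive _ a (r + 1) r k HF ltac:(lra)).
    rewrite (coef_ext _ (fun s => Cmult (RtoC (- ln x)) (cpw x (Cminus b s)))) in E;
      [|lra|intros s _; apply cderiv_C_derive, cderiv_cpw].
    rewrite coef_scal, IH in E; [|lra|].
    2:{ intros s _. apply holo_continuous, holo_cpw. }
    assert (N : RtoC (INR (S k)) <> RtoC 0).
    { intros Z. apply RtoC_inj in Z. apply (not_0_INR (S k)); [discriminate|assumption]. }
    replace (coef (fun s => cpw x (Cminus b s)) a r (S k)) with
      (Cmult (Cinv (RtoC (INR (S k)))) (Cmult (RtoC (INR (S k)))
         (coef (fun s => cpw x (Cminus b s)) a r (S k)))) by (field; assumption).
    rewrite <- E, <- RtoC_inv by (apply not_0_INR; discriminate).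
    rewrite !Cmult_assoc, <- !RtoC_mult. f_equal. f_equal.
    rewrite fact_simpl, mult_INR. simpl pow. field.
    assert (INR (S k) <> 0) by (apply not_0_INR; discriminate).
    assert (Q := INR_fact_neq_0 k). split; assumption.
Qed.

Lemma coef_mult_sub_S (F : C -> C) (a : C) (r : R) (k : nat) : 0 < r ->
  coef (fun s => Cmult (Cminus s a) (F s)) a r (S k) = coef F a r k.
Proof.
  intros Hr. unfold coef. f_equal. apply circint_ext; [lra|].
  intros s Hs. assert (N := Cmod_circle_neq0 a s r Hr Hs).
  simpl. generalize (Cpow (Cinv (Cminus s a)) k). intros p. field. assumption.
Qed.

(** For fixed [s] an antiderivative of [x^-s] in [x]; for fixed [x] its expansion in [s] generates
    the terms [I_main]. *)
Definition power_antideriv (x : R) (s : C) : C :=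
  Cdiv (cpw x (Cminus (RtoC 1) s)) (Cminus (RtoC 1) s).

Lemma holo_power_antideriv (x : R) (s : C) : s <> RtoC 1 -> holo (power_antideriv x) s.
Proof.
  intros Hs. apply holo_div; [apply holo_cpw| |].
  - apply holo_minus; [apply holo_const|apply holo_id].
  - apply Cminus_neq_0. intros E; now apply Hs.
Qed.

Lemma I_main_0 (x alpha : R) : alpha <> 1 ->
  (1 - alpha) * I_main 0 x alpha = Rpower x (1 - alpha).
Proof. intros H. unfold I_main. simpl. field. lra. Qed.

(** The recursion that integration by parts gives for the antiderivative of [ln t ^ k / t^alpha]; in
    the closed form it amounts to splitting off the summand [i = 0] and shifting the others. *)
Lemma I_main_S (k : nat) (x alpha : R) : alpha <> 1 ->
  (1 - alpha) * I_main (S k) x alpha =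
  Rpower x (1 - alpha) * ln x ^ S k - INR (S k) * I_main k x alpha.
Proof.
  intros H. unfold I_main.
  rewrite decomp_sum by lia. simpl Init.Nat.pred.
  rewrite (sum_eq _ (fun i => (-1) ^ i * (INR (fact k) / INR (fact (k - i))) *
    (ln x ^ (k - i) / (1 - alpha) ^ (i + 1)) * (- INR (S k) / (1 - alpha)))).
  - rewrite <- scal_sum. simpl (S k - 0)%nat. simpl (0 + 1)%nat. rewrite pow_O, pow_1.
    field. split; [lra|apply INR_fact_neq_0].
  - intros i Hi. simpl (S k - S i)%nat. rewrite fact_simpl, mult_INR.
    replace (S i + 1)%nat with (S (i + 1)) by lia. simpl pow. field.
    repeat split; try apply INR_fact_neq_0; try lra; apply pow_nonzero; lra.
Qed.

(** Comparing coefficients in [(1 - s) E(s) = x^(1-s)], with [1 - s] split as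
    [(1 - alpha) - (s - alpha)], gives a recursion which is that of [I_main] up to the factor
    [(-1) ^ k / k!]. *)
Lemma coef_power_antideriv (x alpha r : R) (k : nat) : 0 < x -> alpha < 1 ->
  0 < r < 1 - alpha ->
  coef (power_antideriv x) (RtoC alpha) r k =
  RtoC ((-1) ^ k / INR (fact k) * I_main k x alpha).
Proof.
  intros Hx Ha Hr.
  assert (N1 : RtoC (1 - alpha) <> RtoC 0).
  { intros E. apply RtoC_inj in E. lra. }
  assert (HE : disc_holo (power_antideriv x) (RtoC alpha) (1 - alpha)).
  { intros s Hs. apply holo_power_antideriv. intros ->.
    rewrite <- RtoC_minus, Cmod_R, Rabs_pos_eq in Hs by lra. lra. }
  assert (CE := disc_holo_circle _ _ _ r HE ltac:(lra)).
  assert (R0 : forall k, coef (fun s => cpw x (Cminus (RtoC 1) s)) (RtoC alpha) r k =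
     Cminus (Cmult (RtoC (1 - alpha)) (coef (power_antideriv x) (RtoC alpha) r k))
       (coef (fun s => Cmult (Cminus s (RtoC alpha)) (power_antideriv x s)) (RtoC alpha) r k)).
  { intros j. rewrite <- coef_scal by (try assumption; lra).
    rewrite <- coef_minus; [|lra| |].
    - apply coef_ext; [lra|]. intros s Hs. unfold power_antideriv.
      rewrite RtoC_minus. field.
      intros E. assert (s = RtoC 1) by (symmetry; now apply Cminus_eq_0). subst s.
      rewrite <- RtoC_minus, Cmod_R, Rabs_pos_eq in Hs by lra. lra.
    - intros s Hs. apply continuous_Cmult; [apply continuous_const|now apply CE].
    - intros s Hs. apply continuous_Cmult; [apply continuous_Csub|now apply CE]. }
  assert (P : cpw x (Cminus (RtoC 1) (RtoC alpha)) = RtoC (Rpower x (1 - alpha))).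
  { rewrite <- RtoC_minus, cpw_RtoC. reflexivity. }
  assert (Inv : forall z w, Cmult (RtoC (1 - alpha)) z = w ->
     z = Cmult (RtoC (/ (1 - alpha))) w).
  { intros z w <-. rewrite RtoC_inv by lra. field. assumption. }
  induction k as [|k IH].
  - assert (E := R0 0%nat). rewrite coef_cpw, P in E by lra.
    rewrite (coef_0 (fun s => Cmult (Cminus s (RtoC alpha)) (power_antideriv x s))
       (RtoC alpha) (1 - alpha) r) in E; [|intros s Hs; apply holo_mult;
       [apply holo_minus; [apply holo_id|apply holo_const]|now apply HE]|lra].
    rewrite (Inv _ (RtoC (Rpower x (1 - alpha)))).
    + rewrite <- I_main_0, <- RtoC_mult by lra. f_equal. simpl. field. lra.
    + replace (Cmult (RtoC (1 - alpha)) _) with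
        (Cminus (Cmult (RtoC (1 - alpha)) (coef (power_antideriv x) (RtoC alpha) r 0))
           (Cmult (Cminus (RtoC alpha) (RtoC alpha)) (power_antideriv x (RtoC alpha)))) by ring.
      rewrite <- E. simpl. replace (1 / 1 * 1) with 1 by field. ring.
  - assert (E := R0 (S k)). rewrite coef_cpw, P, coef_mult_sub_S, IH in E by lra.
    rewrite (Inv _ (RtoC ((-1) ^ S k / INR (fact (S k)) *
      ((1 - alpha) * I_main (S k) x alpha)))).
    + rewrite <- RtoC_mult. f_equal. field. split; [apply INR_fact_neq_0|lra].
    + replace (Cmult (RtoC (1 - alpha)) _) with
        (Cplus (Cmult (RtoC ((-1) ^ S k / INR (fact (S k)) * ln x ^ S k))
                  (RtoC (Rpower x (1 - alpha))))
            (RtoC ((-1) ^ k / INR (fact k) * I_main k x alpha))) by (rewrite E; ring).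
      rewrite <- RtoC_mult, <- RtoC_plus. f_equal.
      rewrite I_main_S by lra. rewrite fact_simpl, mult_INR. simpl pow. field.
      assert (INR (S k) <> 0) by (apply not_0_INR; discriminate).
      assert (Q := INR_fact_neq_0 k). split; assumption.
Qed.

(** The residue of [r] is taken as well because the class of 0 is represented by [r = q]. Writing
    [0 - s] makes the term an instance of [cpw x (b - s)], as is the numerator of [power_antideriv]
    with [b = 1]. *)
Definition class_term (r q : nat) (s : C) (n : nat) : C :=
  if Nat.eqb (n mod q) (r mod q) then cpw (INR n) (Cminus (RtoC 0) s) else RtoC 0.

Definition zeta_approx (r q : nat) (x : R) (s : C) : C :=
  Cminus (csum (class_term r q s) (Z.to_nat (Int_part x)))
         (Cmult (RtoC (/ INR q)) (power_antideriv x s)).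

Lemma holo_class_term (r q n : nat) (s : C) : holo (fun s => class_term r q s n) s.
Proof.
  unfold class_term. destruct (Nat.eqb _ _); [apply holo_cpw|apply holo_const].
Qed.

Lemma holo_zeta_approx (r q : nat) (x : R) (s : C) :
  s <> RtoC 1 -> holo (zeta_approx r q x) s.
Proof.
  intros Hs. apply holo_minus.
  - apply (holo_csum (fun n s => class_term r q s n)). intros n _. apply holo_class_term.
  - apply holo_mult; [apply holo_const|now apply holo_power_antideriv].
Qed.

Lemma coef_class_term (r q n : nat) (alpha rho : R) (k : nat) : 0 < rho ->
  coef (fun s => class_term r q s n) (RtoC alpha) rho k =
  Cmult (RtoC ((-1) ^ k / INR (fact k)))
    (RtoC (if Nat.eqb (n mod q) (r mod q)
           then ln (INR n) ^ k / Rpower (INR n) alpha else 0)).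
Proof.
  intros Hr. unfold class_term. destruct (Nat.eqb _ _).
  - rewrite coef_cpw by assumption.
    rewrite <- RtoC_minus, cpw_RtoC, <- !RtoC_mult. f_equal.
    unfold Rpower. replace ((0 - alpha) * ln (INR n)) with (- (alpha * ln (INR n))) by ring.
    rewrite exp_Ropp. unfold Rdiv. ring.
  - rewrite <- RtoC_mult, Rmult_0_r. apply Cmod_le_0. eapply Rle_trans.
    + apply coef_bound with (M := 0); [lra| |].
      * intros s _. apply continuous_const.
      * intros s _. rewrite Cmod_0. lra.
    + lra.
Qed.

Lemma coef_zeta_approx (r q : nat) (x alpha rho : R) (k : nat) : 0 < x -> alpha < 1 ->
  (1 <= q)%nat -> 0 < rho < 1 - alpha ->
  coef (zeta_approx r q x) (RtoC alpha) rho k =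
  RtoC ((-1) ^ k / INR (fact k) * zeta_partial k alpha r q x).
Proof.
  intros Hx Ha Hq Hr. unfold zeta_approx.
  assert (H1 : forall s, Cmod (Cminus s (RtoC alpha)) < 1 - alpha -> s <> RtoC 1).
  { intros s Hs ->. rewrite <- RtoC_minus, Cmod_R, Rabs_pos_eq in Hs; lra. }
  assert (HS : disc_holo (fun s => csum (class_term r q s) (Z.to_nat (Int_part x)))
     (RtoC alpha) (1 - alpha)).
  { intros s _. apply (holo_csum (fun n s => class_term r q s n)).
    intros n _. apply holo_class_term. }
  assert (HP : disc_holo (power_antideriv x) (RtoC alpha) (1 - alpha)).
  { intros s Hs. now apply holo_power_antideriv, H1. }
  assert (CS := disc_holo_circle _ _ _ rho HS ltac:(lra)).
  assert (CP := disc_holo_circle _ _ _ rho HP ltac:(lra)).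
  rewrite coef_minus, coef_scal, coef_power_antideriv; try assumption; try lra.
  2:{ intros s Hs. apply continuous_Cmult; [apply continuous_const|now apply CP]. }
  rewrite (coef_csum (fun n s => class_term r q s n) _ _ (1 - alpha) rho k Hr).
  2:{ intros n _ s _. apply holo_class_term. }
  rewrite (csum_ext _ (fun n => Cmult (RtoC ((-1) ^ k / INR (fact k)))
    (RtoC (if Nat.eqb (n mod q) (r mod q)
           then ln (INR n) ^ k / Rpower (INR n) alpha else 0)))).
  2:{ intros n _. apply coef_class_term. lra. }
  rewrite csum_scal, <- RtoC_sum_n_m, <- !RtoC_mult, <- RtoC_minus. f_equal.
  unfold zeta_partial. rewrite Rmult_minus_distr_l. apply f_equal2; [reflexivity|].
  unfold Rdiv. ring.
Qed.

(** * Continuation of the residue class zeta functions to [0 < Re s] *)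

(** Complex paths satisfy only a mean value inequality. The majorant [h] is left general: it is
    exponential in [cpw_diff_le] and linear in the later uses. *)
Lemma path_mean_value (g dg : R -> C) (h dh : R -> R) (a b : R) : a <= b ->
  (forall t, a <= t <= b -> path_deriv g t (dg t)) ->
  (forall t, a <= t <= b -> path_continuous dg t) ->
  (forall t, a <= t <= b -> is_derive h t (dh t)) ->
  (forall t, a <= t <= b -> continuous dh t) ->
  (forall t, a <= t <= b -> Cmod (dg t) <= dh t) ->
  Cmod (Cminus (g b) (g a)) <= h b - h a.
Proof.
  intros Hab H1 H2 H3 H4 H5. rewrite Cmod_norm.
  apply (norm_RInt_le (V := C_R_NormedModule) dg dh a b); [assumption| | |].
  - intros t Ht. rewrite <- Cmod_norm. now apply H5.
  - now apply is_CInt_path_deriv.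
  - apply (is_RInt_derive (V := R_CompleteNormedModule) h dh);
      rewrite Rmin_left, Rmax_right by assumption; assumption.
Qed.

Lemma path_deriv_cpw (t : R) (s : C) : 0 < t ->
  path_deriv (fun t => cpw t s) t (Cmult (cpw t s) (Cmult s (RtoC (/ t)))).
Proof.
  intros Ht.
  assert (L : is_derive ln t (/ t)) by (apply is_derive_Reals, derivable_pt_lim_ln; assumption).
  assert (E := path_deriv_comp Cexp _ t _ _
    (path_deriv_mult (fun _ => s) (fun t => RtoC (ln t)) t _ _
       (path_deriv_const s t) (path_deriv_RtoC ln t _ L)) (cderiv_Cexp _)).
  match type of E with path_deriv _ _ ?v =>
    replace (Cmult (cpw t s) (Cmult s (RtoC (/ t)))) with v; [exact E|] end.
  unfold cpw. ring.
Qed.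

Lemma path_continuous_cpw (t : R) (s : C) : 0 < t -> path_continuous (fun t => cpw t s) t.
Proof. intros Ht. eapply path_deriv_continuous, path_deriv_cpw, Ht. Qed.

Lemma cpw_1_minus (t : R) (s : C) : 0 < t ->
  Cmult (cpw t (Cminus (RtoC 1) s)) (RtoC (/ t)) = cpw t (Cminus (RtoC 0) s).
Proof.
  intros Ht. replace (Cminus (RtoC 1) s) with (Cplus (RtoC 1) (Cminus (RtoC 0) s)) by ring.
  rewrite cpw_plus, cpw_1, RtoC_inv by lra. field.
  intros E. apply RtoC_inj in E. lra.
Qed.

Lemma path_deriv_power_antideriv (t : R) (s : C) : 0 < t -> s <> RtoC 1 ->
  path_deriv (fun t => power_antideriv t s) t (cpw t (Cminus (RtoC 0) s)).
Proof.
  intros Ht Hs.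
  assert (E := path_deriv_mult _ (fun _ => Cinv (Cminus (RtoC 1) s)) t _ _
    (path_deriv_cpw t (Cminus (RtoC 1) s) Ht) (path_deriv_const _ t)).
  match type of E with path_deriv _ _ ?v =>
    replace (cpw t (Cminus (RtoC 0) s)) with v; [exact E|] end.
  rewrite <- (cpw_1_minus t s Ht). field.
  apply Cminus_neq_0. intros Z; now apply Hs.
Qed.

Lemma Cmod_cpw_neg (t : R) (s : C) :
  Cmod (cpw t (Cminus (RtoC 0) s)) = exp (- Re s * ln t).
Proof. rewrite Cmod_cpw. f_equal. unfold Re; simpl; ring. Qed.

(** In the variable [u = ln t] the path is [exp (- s u)], with speed [Cmod s * exp (- Re s * u)];
    integrating the speed produces the quotient [Cmod s / Re s]. *)
Lemma cpw_diff_le (A B : R) (s : C) : 0 < A <= B -> 0 < Re s ->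
  Cmod (Cminus (cpw B (Cminus (RtoC 0) s)) (cpw A (Cminus (RtoC 0) s))) <=
  Cmod s / Re s * (exp (- Re s * ln A) - exp (- Re s * ln B)).
Proof.
  intros HAB Hs.
  set (b := Cminus (RtoC 0) s).
  assert (Hln : ln A <= ln B) by (apply ln_le; lra).
  replace (Cmod s / Re s * (exp (- Re s * ln A) - exp (- Re s * ln B))) with
    (- (Cmod s / Re s) * exp (- Re s * ln B) - - (Cmod s / Re s) * exp (- Re s * ln A)) by ring.
  assert (D : forall t, path_deriv (fun t => Cexp (Cmult b (RtoC t))) t
     (Cmult (Cexp (Cmult b (RtoC t))) b)).
  { intros t. assert (E := path_deriv_comp Cexp _ t _ _
    (path_deriv_mult (fun _ => b) RtoC t _ _
       (path_deriv_const b t) (path_deriv_id t)) (cderiv_Cexp _)).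
    match type of E with path_deriv _ _ ?v =>
      replace (Cmult _ b) with v; [exact E|] end. ring. }
  apply (path_mean_value (fun t => Cexp (Cmult b (RtoC t)))
     (fun t => Cmult (Cexp (Cmult b (RtoC t))) b)
     (fun t => - (Cmod s / Re s) * exp (- Re s * t))
     (fun t => Cmod s * exp (- Re s * t))); [assumption| | | | |]; intros t _.
  - apply D.
  - apply continuous_Cmult; [|apply continuous_const].
    eapply path_deriv_continuous, D.
  - auto_derive; [trivial|]. field. lra.
  - apply (ex_derive_continuous (K := R_AbsRing) (V := R_NormedModule)). auto_derive. trivial.
  - rewrite Cmod_mult, Cexp_Cmod, re_scal_r, Rmult_comm.
    replace (Cmod b) with (Cmod s).
    + right. f_equal. f_equal. unfold b, Re; simpl; ring.
    + unfold b. replace (Cminus (RtoC 0) s) with (Copp s) by ring. now rewrite Cmod_opp.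
Qed.

Lemma decay_anti (A B x : R) : 0 < A <= B -> 0 < x -> exp (- x * ln B) <= exp (- x * ln A).
Proof.
  intros HAB Hx. apply exp_le_compat.
  assert (Hln : ln A <= ln B) by (apply ln_le; lra). nra.
Qed.

Lemma power_antideriv_diff_le (n x : R) (s : C) : 0 < n <= x -> 0 < Re s -> s <> RtoC 1 ->
  Cmod (Cminus (power_antideriv x s) (power_antideriv n s)) <=
  (x - n) * exp (- Re s * ln n).
Proof.
  intros Hn Hs Hs1.
  replace ((x - n) * exp (- Re s * ln n)) with
    (x * exp (- Re s * ln n) - n * exp (- Re s * ln n)) by ring.
  apply (path_mean_value (fun t => power_antideriv t s)
     (fun t => cpw t (Cminus (RtoC 0) s))
     (fun t => t * exp (- Re s * ln n)) (fun _ => exp (- Re s * ln n)));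
     [lra| | | | |]; intros t Ht.
  - apply path_deriv_power_antideriv; [lra|assumption].
  - apply path_continuous_cpw. lra.
  - auto_derive; [trivial|ring].
  - apply continuous_const.
  - rewrite Cmod_cpw_neg. apply decay_anti; lra.
Qed.

(** The term sits at the right end of the step. The path [t * c - power_antideriv t s] has
    derivative [c - t^-s], bounded on the whole step by the bound at [t = n]. That bound is a
    difference of values at the two ends, which is why consecutive steps telescope. *)
Lemma euler_step (n p : R) (s : C) : 0 < n -> 0 < p -> 0 < Re s -> s <> RtoC 1 ->
  Cmod (Cminus (cpw (n + p) (Cminus (RtoC 0) s))
     (Cmult (RtoC (/ p)) (Cminus (power_antideriv (n + p) s) (power_antideriv n s)))) <=
  Cmod s / Re s * (exp (- Re s * ln n) - exp (- Re s * ln (n + p))).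
Proof.
  intros Hn Hp Hs Hs1.
  set (B := Cmod s / Re s * (exp (- Re s * ln n) - exp (- Re s * ln (n + p)))).
  set (c := cpw (n + p) (Cminus (RtoC 0) s)).
  assert (Pp : RtoC p <> RtoC 0) by (intros E; apply RtoC_inj in E; lra).
  assert (K : Cmod (Cminus (Cminus (Cmult (RtoC (n + p)) c) (power_antideriv (n + p) s))
     (Cminus (Cmult (RtoC n) c) (power_antideriv n s))) <= B * (n + p) - B * n).
  { assert (D : forall t, 0 < t -> path_deriv
      (fun t => Cminus (Cmult (RtoC t) c) (power_antideriv t s)) t
      (Cminus c (cpw t (Cminus (RtoC 0) s)))).
    { intros t Ht. assert (E := path_deriv_plus _ _ t _ _
        (path_deriv_mult RtoC (fun _ => c) t _ _ (path_deriv_id t) (path_deriv_const c t))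
        (path_deriv_mult (fun _ => Copp (RtoC 1)) _ t _ _ (path_deriv_const _ t)
           (path_deriv_power_antideriv t s Ht Hs1))).
      destruct E as (phi & E1 & E2 & E3). exists phi. split; [assumption|]. split.
      - rewrite E2. ring.
      - intros u. assert (E4 := E3 u). simpl in E4.
        replace (Cminus (Cmult (RtoC u) c) (power_antideriv u s)) with
          (Cplus (Cmult (RtoC u) c) (Cmult (Copp (RtoC 1)) (power_antideriv u s))) by ring.
        rewrite E4. ring. }
    apply (path_mean_value (fun t => Cminus (Cmult (RtoC t) c) (power_antideriv t s))
       (fun t => Cminus c (cpw t (Cminus (RtoC 0) s))) (fun t => B * t) (fun _ => B));
       [lra| | | | |]; intros t Ht.
    - apply D. lra.
    - apply continuous_Cminus; [apply continuous_const|apply path_continuous_cpw; lra].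
    - auto_derive; [trivial|ring].
    - apply continuous_const.
    - eapply Rle_trans; [apply cpw_diff_le; lra|].
      apply Rmult_le_compat_l.
      + apply Rdiv_le_0_compat; [apply Cmod_ge_0|assumption].
      + assert (H := decay_anti n t (Re s) ltac:(lra) Hs). lra. }
  replace (Cminus c _) with (Cmult (RtoC (/ p))
    (Cminus (Cminus (Cmult (RtoC (n + p)) c) (power_antideriv (n + p) s))
     (Cminus (Cmult (RtoC n) c) (power_antideriv n s)))).
  - rewrite Cmod_mult, Cmod_R, Rabs_pos_eq by (apply Rlt_le, Rinv_0_lt_compat; lra).
    apply Rmult_le_reg_l with p; [assumption|].
    rewrite <- Rmult_assoc, Rinv_r, Rmult_1_l by lra. lra.
  - rewrite RtoC_plus, RtoC_inv by lra. field. assumption.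
Qed.

Lemma csum_class_gap (r q M j : nat) (s : C) : (1 <= q)%nat -> (j < q)%nat ->
  csum (class_term r q s) (r + M * q + j) = csum (class_term r q s) (r + M * q).
Proof.
  intros Hq. induction j as [|j IH]; intros Hj.
  - now rewrite Nat.add_0_r.
  - rewrite Nat.add_succ_r. simpl csum. rewrite IH by lia.
    unfold class_term at 2. destruct (Nat.eqb_spec (S (r + M * q + j) mod q) (r mod q)) as [E|E].
    + exfalso.
      assert (D1 := Nat.div_mod_eq (S (r + M * q + j)) q).
      assert (D2 := Nat.div_mod_eq r q).
      rewrite E in D1.
      set (A := (S (r + M * q + j) / q)%nat) in *. set (B := (r / q)%nat) in *.
      set (c := (r mod q)%nat) in *.
      (* [S j] would be a multiple of [q] strictly between 0 and [q]. *)
      assert (F : (S j = q * A - (q * B + M * q))%nat) by lia.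
      assert (G : (S j = q * (A - (B + M)))%nat).
      { rewrite F, Nat.mul_sub_distr_l. lia. }
      destruct (A - (B + M))%nat as [|k]; [lia|]. nia.
    + ring.
Qed.

Lemma csum_class_next (r q M : nat) (s : C) : (1 <= q)%nat ->
  csum (class_term r q s) (r + S M * q) =
  Cplus (csum (class_term r q s) (r + M * q))
        (cpw (INR (r + S M * q)) (Cminus (RtoC 0) s)).
Proof.
  intros Hq.
  assert (E : (r + S M * q = S (r + M * q + (q - 1)))%nat) by lia.
  rewrite E. simpl csum. rewrite csum_class_gap by lia. f_equal.
  rewrite <- E. unfold class_term. rewrite Nat.Div0.mod_add, Nat.eqb_refl. reflexivity.
Qed.

Lemma Int_part_nat (n : nat) (x : R) : INR n <= x < INR n + 1 ->
  Z.to_nat (Int_part x) = n.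
Proof.
  intros H. rewrite <- (Int_part_spec x (Z.of_nat n)).
  - apply Nat2Z.id.
  - rewrite <- INR_IZR_INZ. lra.
Qed.

Lemma zeta_approx_step (r q M : nat) (s : C) : (1 <= r)%nat -> (1 <= q)%nat ->
  0 < Re s -> s <> RtoC 1 ->
  Cmod (Cminus (zeta_approx r q (INR (r + S M * q)) s) (zeta_approx r q (INR (r + M * q)) s))
  <= Cmod s / Re s * (exp (- Re s * ln (INR (r + M * q)))
                      - exp (- Re s * ln (INR (r + S M * q)))).
Proof.
  intros Hr Hq Hs Hs1. unfold zeta_approx.
  assert (IP : forall n, Z.to_nat (Int_part (INR n)) = n)
    by (intros n; apply Int_part_nat; lra).
  rewrite !IP.
  rewrite csum_class_next by assumption.
  assert (E : INR (r + S M * q) = INR (r + M * q) + INR q).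
  { rewrite <- plus_INR. f_equal. lia. }
  assert (P1 : 0 < INR (r + M * q)) by (apply lt_0_INR; lia).
  assert (P2 : 0 < INR q) by (apply lt_0_INR; lia).
  rewrite E.
  replace (Cminus _ _) with (Cminus (cpw (INR (r + M * q) + INR q) (Cminus (RtoC 0) s))
     (Cmult (RtoC (/ INR q)) (Cminus (power_antideriv (INR (r + M * q) + INR q) s)
         (power_antideriv (INR (r + M * q)) s)))) by ring.
  now apply euler_step.
Qed.

Lemma zeta_approx_cauchy (r q M j : nat) (s : C) : (1 <= r)%nat -> (1 <= q)%nat ->
  0 < Re s -> s <> RtoC 1 ->
  Cmod (Cminus (zeta_approx r q (INR (r + (M + j) * q)) s)
               (zeta_approx r q (INR (r + M * q)) s))
  <= Cmod s / Re s * (exp (- Re s * ln (INR (r + M * q)))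
                      - exp (- Re s * ln (INR (r + (M + j) * q)))).
Proof.
  intros Hr Hq Hs Hs1. induction j as [|j IH].
  - rewrite Nat.add_0_r. replace (Cminus _ _) with (RtoC 0) by ring. rewrite Cmod_0.
    rewrite Rminus_diag. lra.
  - rewrite Nat.add_succ_r.
    assert (A := zeta_approx_step r q (M + j) s Hr Hq Hs Hs1).
    set (z1 := zeta_approx r q (INR (r + S (M + j) * q)) s) in *.
    set (z2 := zeta_approx r q (INR (r + (M + j) * q)) s) in *.
    set (z3 := zeta_approx r q (INR (r + M * q)) s) in *.
    replace (Cminus z1 z3) with (Cplus (Cminus z1 z2) (Cminus z2 z3)) by ring.
    eapply Rle_trans; [apply Cmod_triangle|]. lra.
Qed.

(** The bound is inherited by the limit: locally uniform convergence will be read off from the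
    explicit rate, so mere existence of a limit would not do. *)
Lemma Ccauchy_limit (u : nat -> C) (b : nat -> R) :
  (forall M j, Cmod (Cminus (u (M + j)%nat) (u M)) <= b M) ->
  (forall e, 0 < e -> exists M, b M < e) ->
  exists l, forall M, Cmod (Cminus l (u M)) <= b M.
Proof.
  intros H Hb.
  assert (Q : forall p : C -> R, (forall z w, p z - p w = p (Cminus z w)) ->
     (forall z, Rabs (p z) <= Cmod z) -> ex_finite_lim_seq (fun n => p (u n))).
  { intros p Hp1 Hp2. apply ex_lim_seq_cauchy_corr. intros e.
    destruct (Hb (e / 2)) as [N HN]; [destruct e; simpl; lra|].
    exists N. intros n m Hn Hm. rewrite Hp1.
    eapply Rle_lt_trans; [apply Hp2|].
    assert (A1 := H N (n - N)%nat). assert (A2 := H N (m - N)%nat).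
    replace (N + (n - N))%nat with n in A1 by lia.
    replace (N + (m - N))%nat with m in A2 by lia.
    replace (Cminus (u n) (u m)) with
      (Cplus (Cminus (u n) (u N)) (Copp (Cminus (u m) (u N)))) by ring.
    eapply Rle_lt_trans; [apply Cmod_triangle|]. rewrite Cmod_opp. lra. }
  destruct (Q Re) as [l1 H1].
  { intros z w. unfold Re, Im; simpl; ring. }
  { apply re_le_Cmod. }
  destruct (Q Im) as [l2 H2].
  { intros z w. unfold Re, Im; simpl; ring. }
  { apply im_le_Cmod. }
  exists (l1, l2). intros M. apply Rnot_lt_le. intros L.
  (* A third of the supposed excess; the two coordinates will use up [2 * e]. *)
  set (e := (Cmod (Cminus (l1, l2) (u M)) - b M) / 3).
  assert (He : 0 < e) by (unfold e; lra).
  apply is_lim_seq_spec in H1. apply is_lim_seq_spec in H2.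
  destruct (H1 (mkposreal e He)) as [N1 HN1]. destruct (H2 (mkposreal e He)) as [N2 HN2].
  set (n := (M + (N1 + N2))%nat).
  specialize (HN1 n ltac:(unfold n; lia)). specialize (HN2 n ltac:(unfold n; lia)).
  simpl in HN1, HN2.
  assert (A := H M (N1 + N2)%nat). fold n in A.
  assert (B : Cmod (Cminus (l1, l2) (u n)) < 2 * e).
  { eapply Rle_lt_trans; [apply Cmod_le_Re_Im|].
    replace (Re (Cminus (l1, l2) (u n))) with (- (Re (u n) - l1)) by (unfold Re, Im; simpl; ring).
    replace (Im (Cminus (l1, l2) (u n))) with (- (Im (u n) - l2)) by (unfold Re, Im; simpl; ring).
    rewrite !Rabs_Ropp. lra. }
  assert (T := Cmod_triangle (Cminus (l1, l2) (u n)) (Cminus (u n) (u M))).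
  replace (Cplus (Cminus (l1, l2) (u n)) (Cminus (u n) (u M))) with (Cminus (l1, l2) (u M))
    in T by ring.
  unfold e in *. lra.
Qed.

Lemma decay_small (K x e : R) : 0 < x -> 0 < e ->
  exists X, 1 <= X /\ forall y, X <= y -> K * exp (- x * ln y) <= e.
Proof.
  intros Hx He.
  set (K' := Rabs K + 1).
  assert (HK' : 0 < K') by (unfold K'; assert (A := Rabs_pos K); lra).
  set (L := ln (K' / e) / x).
  exists (1 + exp L). assert (P := exp_pos L). split; [lra|].
  intros y Hy.
  assert (HL : L <= ln y).
  { rewrite <- (ln_exp L). apply ln_le; lra. }
  apply Rle_trans with (K' * exp (- x * ln y)).
  { apply Rmult_le_compat_r; [apply Rlt_le, exp_pos|].
    unfold K'. assert (A := Rle_abs K). lra. }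
  apply Rle_trans with (K' * exp (- x * L)).
  { apply Rmult_le_compat_l; [lra|]. apply exp_le_compat. nra. }
  replace (- x * L) with (- ln (K' / e)) by (unfold L; field; lra).
  rewrite exp_Ropp, exp_ln by now apply Rdiv_lt_0_compat.
  right. field. lra.
Qed.

(** From the progression [r + M * q] to all real [x]: with [n] its last member up to [x], the sum is
    constant from [n] to [x], and the correction moves by at most [(x - n) / q <= 1] times
    [n^-(Re s)]. This is the summand 1 in the constant; since [n > x - q], the rate is stated at
    [x - q]. *)
Lemma zeta_class_limit (r q : nat) (s : C) : (1 <= r <= q)%nat -> 0 < Re s -> s <> RtoC 1 ->
  exists l, forall x, INR q + 1 <= x ->
    Cmod (Cminus l (zeta_approx r q x s)) <=
    (Cmod s / Re s + 1) * exp (- Re s * ln (x - INR q)).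
Proof.
  intros Hr Hs Hs1.
  set (c := Cmod s / Re s).
  assert (Hc : 0 <= c) by (apply Rdiv_le_0_compat; [apply Cmod_ge_0|assumption]).
  set (e := fun M : nat => exp (- Re s * ln (INR (r + M * q)))).
  assert (Pq : 0 < INR q) by (apply lt_0_INR; lia).
  destruct (Ccauchy_limit (fun M => zeta_approx r q (INR (r + M * q)) s)
    (fun M => c * e M)) as [l Hl].
  - intros M j. eapply Rle_trans; [apply zeta_approx_cauchy; try assumption; lia|].
    apply Rmult_le_compat_l; [assumption|]. unfold e.
    assert (A := exp_pos (- Re s * ln (INR (r + (M + j) * q)))). lra.
  - intros ep Hep. destruct (decay_small c (Re s) (ep / 2)) as (X & HX1 & HX); [assumption|lra|].
    destruct (archimed X) as [A1 _].
    assert (A2 : (0 <= up X)%Z) by (apply le_IZR; lra).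
    exists (Z.to_nat (up X)). apply Rle_lt_trans with (ep / 2); [|lra].
    apply HX.
    assert (A3 : INR (Z.to_nat (up X)) = IZR (up X)).
    { rewrite INR_IZR_INZ, Z2Nat.id by assumption. reflexivity. }
    apply Rle_trans with (INR (Z.to_nat (up X))); [lra|].
    apply le_INR. nia.
  - exists l. intros x Hx.
    set (N := Z.to_nat (Int_part x)).
    assert (HN : INR N <= x < INR N + 1).
    { destruct (base_Int_part x) as [B1 B2].
      assert (B3 : (0 <= Int_part x)%Z).
      { apply Z.lt_succ_r. apply lt_IZR. rewrite succ_IZR. lra. }
      unfold N. rewrite INR_IZR_INZ, Z2Nat.id by assumption. lra. }
    assert (HqN : (q <= N)%nat).
    { apply Nat.lt_succ_r. apply INR_lt. rewrite S_INR. lra. }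
    set (M := ((N - r) / q)%nat). set (j := ((N - r) mod q)%nat).
    assert (Hj : (j < q)%nat) by (apply Nat.mod_upper_bound; lia).
    assert (EN : N = (r + M * q + j)%nat).
    { assert (D := Nat.div_mod_eq (N - r) q). fold M j in D. lia. }
    set (n := INR (r + M * q)).
    assert (Hn : INR N = n + INR j).
    { rewrite EN, plus_INR. reflexivity. }
    assert (Hj' : INR j + 1 <= INR q).
    { rewrite <- S_INR. apply le_INR. lia. }
    assert (Hj0 : 0 <= INR j) by apply pos_INR.
    assert (Hn0 : 0 < n) by (apply lt_0_INR; lia).
    assert (Dx : Cmod (Cminus (zeta_approx r q n s) (zeta_approx r q x s)) <= e M).
    { unfold zeta_approx. fold N. unfold n at 1.
      rewrite (Int_part_nat (r + M * q)) by (split; lra).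
      rewrite EN, csum_class_gap by lia.
      replace (Cminus _ _) with (Cmult (RtoC (/ INR q))
         (Cminus (power_antideriv x s) (power_antideriv n s))) by ring.
      rewrite Cmod_mult, Cmod_R, Rabs_pos_eq by (apply Rlt_le, Rinv_0_lt_compat; lra).
      apply Rmult_le_reg_l with (INR q); [assumption|].
      rewrite <- Rmult_assoc, Rinv_r, Rmult_1_l by lra.
      eapply Rle_trans; [apply power_antideriv_diff_le; try assumption; lra|].
      apply Rmult_le_compat_r; [apply Rlt_le, exp_pos|]. lra. }
    assert (T := Hl M). cbv beta in T. fold n in T.
    replace (Cminus l (zeta_approx r q x s)) with
      (Cplus (Cminus l (zeta_approx r q n s))
             (Cminus (zeta_approx r q n s) (zeta_approx r q x s))) by ring.
    eapply Rle_trans; [apply Cmod_triangle|].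
    apply Rle_trans with ((c + 1) * e M); [lra|].
    apply Rmult_le_compat_l; [lra|]. unfold e. fold n. apply decay_anti; [|assumption]. lra.
Qed.

(* The limit of [zeta_approx r q x s] as [x] tends to infinity; it is only
   meaningful for [1 <= r <= q], [0 < Re s], [s <> 1]. *)
Definition zeta_class (r q : nat) (s : C) : C :=
  epsilon (inhabits (RtoC 0)) (fun l => forall x, INR q + 1 <= x ->
    Cmod (Cminus l (zeta_approx r q x s)) <=
    (Cmod s / Re s + 1) * exp (- Re s * ln (x - INR q))).

Lemma zeta_class_uniform (r q : nat) (sigma B e : R) : (1 <= r <= q)%nat ->
  0 < sigma -> 0 < e ->
  exists X, 1 <= X /\ forall x s, X <= x -> sigma <= Re s -> Cmod s <= B -> s <> RtoC 1 ->
    Cmod (Cminus (zeta_class r q s) (zeta_approx r q x s)) <= e.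
Proof.
  intros Hr Hsig He.
  destruct (decay_small (B / sigma + 1) sigma e Hsig He) as (X & HX1 & HX).
  assert (Pq : 0 <= INR q) by apply pos_INR.
  exists (X + INR q). split; [lra|]. intros x s Hx Hs HB Hs1.
  assert (H := epsilon_spec (inhabits (RtoC 0)) _
    (zeta_class_limit r q s Hr ltac:(lra) Hs1) x ltac:(lra)).
  fold (zeta_class r q s) in H.
  eapply Rle_trans; [exact H|]. eapply Rle_trans; [|apply (HX (x - INR q)); lra].
  assert (M := Cmod_ge_0 s).
  assert (Hl : 0 <= ln (x - INR q)).
  { rewrite <- ln_1. apply ln_le; lra. }
  apply Rmult_le_compat.
  - assert (0 <= Cmod s / Re s) by (apply Rdiv_le_0_compat; lra). lra.
  - apply Rlt_le, exp_pos.
  - apply Rplus_le_compat_r. apply Rmult_le_compat; try assumption.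
    + apply Rlt_le, Rinv_0_lt_compat. lra.
    + apply Rinv_le_contravar; lra.
  - apply exp_le_compat. nra.
Qed.

Lemma Re_near (s z : C) (d : R) : Cmod (Cminus s z) < d -> Re z - d < Re s.
Proof.
  intros H. assert (A := re_le_Cmod (Cminus s z)).
  replace (Re (Cminus s z)) with (Re s - Re z) in A by (unfold Re, Im; simpl; ring).
  assert (B := Rle_abs (- (Re s - Re z))). rewrite Rabs_Ropp in B. lra.
Qed.

Lemma holo_zeta_class (r q : nat) (z : C) : (1 <= r <= q)%nat ->
  0 < Re z -> z <> RtoC 1 -> holo (zeta_class r q) z.
Proof.
  intros Hr Hz Hz1.
  assert (D1 : 0 < Cmod (Cminus z (RtoC 1))) by (apply Cmod_gt_0; now apply Cminus_neq_0).
  (* On this disc [Re s] stays above [Re z / 2] and the point 1 is avoided, so one rate serves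
     throughout. *)
  set (d := Rmin (Re z / 2) (Cmod (Cminus z (RtoC 1)))).
  assert (Hd : 0 < d) by (apply Rmin_pos; lra).
  assert (Hd1 : d <= Re z / 2) by apply Rmin_l.
  assert (Hd2 : d <= Cmod (Cminus z (RtoC 1))) by apply Rmin_r.
  assert (N1 : forall s, Cmod (Cminus s z) < d -> s <> RtoC 1).
  { intros s Hs ->. replace (Cminus (RtoC 1) z) with (Copp (Cminus z (RtoC 1))) in Hs by ring.
    rewrite Cmod_opp in Hs. lra. }
  apply (disc_holo_limit (zeta_class r q) (fun n => zeta_approx r q (INR n)) z d).
  - intros n s Hs. apply holo_zeta_approx. now apply N1.
  - intros e He.
    destruct (zeta_class_uniform r q (Re z / 2) (Cmod z + d) e Hr ltac:(lra) He)
      as (X & HX1 & HX).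
    destruct (archimed X) as [A1 _].
    assert (A2 : (0 <= up X)%Z) by (apply le_IZR; lra).
    exists (Z.to_nat (up X)). intros s Hs. apply HX.
    + rewrite INR_IZR_INZ, Z2Nat.id by assumption. lra.
    + assert (T := Re_near s z d Hs). lra.
    + replace s with (Cplus z (Cminus s z)) by ring.
      eapply Rle_trans; [apply Cmod_triangle|]. lra.
    + now apply N1.
  - replace (Cminus z z) with (RtoC 0) by ring. now rewrite Cmod_0.
Qed.

(** * The Taylor expansion of [L] *)

Lemma csum_single (u : nat -> C) (N r0 : nat) : (1 <= r0 <= N)%nat ->
  (forall r, (1 <= r <= N)%nat -> r <> r0 -> u r = RtoC 0) -> csum u N = u r0.
Proof.
  intros Hr0 H. induction N as [|N IH]; [lia|]. simpl.
  destruct (Nat.eq_dec r0 (S N)) as [E|E].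
  - rewrite (csum_ext u (fun _ => Cmult (RtoC 0) (RtoC 0)) N).
    + rewrite csum_scal, E. ring.
    + intros n Hn. rewrite H by lia. ring.
  - rewrite IH, (H (S N)); [ring|lia|lia|lia|]. intros; apply H; lia.
Qed.

Lemma periodic_add_mul (q : nat) (f : nat -> C) (r k : nat) :
  periodic q f -> (1 <= r)%nat -> f (r + k * q)%nat = f r.
Proof.
  intros Hf Hr. induction k as [|k IH]; [now rewrite Nat.add_0_r|].
  replace (r + S k * q)%nat with (r + k * q + q)%nat by lia.
  rewrite Hf by lia. exact IH.
Qed.

Lemma csum_classes (q n : nat) (f : nat -> C) (s : C) :
  (1 <= q)%nat -> (1 <= n)%nat -> periodic q f ->
  csum (fun r => Cmult (f r) (class_term r q s n)) q =
  Cmult (f n) (cpw (INR n) (Cminus (RtoC 0) s)).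
Proof.
  intros Hq Hn Hf.
  (* The representative of [n] among 1, ..., [q]; the shift by one sends multiples of [q] to [q]
     instead of 0, where periodicity is not assumed. *)
  set (r0 := S ((n - 1) mod q)). set (k := ((n - 1) / q)%nat).
  assert (Hr0 : (1 <= r0 <= q)%nat).
  { assert (A := Nat.mod_upper_bound (n - 1) q ltac:(lia)). unfold r0. lia. }
  assert (En : n = (r0 + k * q)%nat).
  { assert (D := Nat.div_mod_eq (n - 1) q). unfold r0, k. lia. }
  rewrite (csum_single _ q r0 Hr0).
  - unfold class_term. rewrite En at 1. rewrite Nat.Div0.mod_add, Nat.eqb_refl.
    rewrite En at 2. now rewrite periodic_add_mul by (try assumption; lia).
  - intros r Hr Hne. unfold class_term. rewrite En at 1. rewrite Nat.Div0.mod_add.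
    destruct (Nat.eqb_spec (r0 mod q) (r mod q)) as [E|E]; [|ring].
    exfalso. apply Hne.
    assert (D1 := Nat.div_mod_eq r q). assert (D2 := Nat.div_mod_eq r0 q).
    rewrite E in D2. 
    set (A := (r / q)%nat) in *. set (B := (r0 / q)%nat) in *.
    assert (A = B) by nia. lia.
Qed.

Lemma csum_classes_total (q N : nat) (f : nat -> C) (s : C) :
  (1 <= q)%nat -> periodic q f ->
  csum (fun r => Cmult (f r) (csum (class_term r q s) N)) q =
  csum (fun n => Cmult (f n) (cpw (INR n) (Cminus (RtoC 0) s))) N.
Proof.
  intros Hq Hf. induction N as [|N IH].
  - simpl. rewrite (csum_ext _ (fun _ => Cmult (RtoC 0) (RtoC 0))) by (intros; ring).
    rewrite csum_scal. ring.
  - rewrite (csum_ext _ (fun r => Cplus (Cmult (f r) (csum (class_term r q s) N))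
      (Cmult (f r) (class_term r q s (S N))))) by (intros; simpl; ring).
    rewrite csum_plus, IH, csum_classes by (try assumption; lia). reflexivity.
Qed.

Lemma csum_limit (f u : nat -> C) (v : nat -> R -> C) (N : nat) :
  (forall r, (1 <= r <= N)%nat -> forall e, 0 < e -> exists X, forall x, X <= x ->
     Cmod (Cminus (u r) (v r x)) <= e) ->
  forall e, 0 < e -> exists X, forall x, X <= x ->
    Cmod (Cminus (csum (fun r => Cmult (f r) (u r)) N)
                 (csum (fun r => Cmult (f r) (v r x)) N)) <= e.
Proof.
  intros H. induction N as [|N IH]; intros e He.
  - exists 0. intros x _. simpl. replace (Cminus _ _) with (RtoC 0) by ring.
    rewrite Cmod_0. lra.
  - destruct (IH ltac:(intros r Hr; apply H; lia) (e / 2) ltac:(lra)) as [X1 H1].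
    set (m := Cmod (f (S N)) + 1).
    assert (Hm : 0 < m) by (unfold m; assert (A := Cmod_ge_0 (f (S N))); lra).
    destruct (H (S N) ltac:(lia) (e / 2 / m)) as [X2 H2].
    { apply Rdiv_lt_0_compat; lra. }
    exists (Rmax X1 X2). intros x Hx.
    assert (M1 := Rmax_l X1 X2). assert (M2 := Rmax_r X1 X2).
    specialize (H1 x ltac:(lra)). specialize (H2 x ltac:(lra)).
    simpl. replace (Cminus _ _) with (Cplus
      (Cminus (csum (fun r => Cmult (f r) (u r)) N) (csum (fun r => Cmult (f r) (v r x)) N))
      (Cmult (f (S N)) (Cminus (u (S N)) (v (S N) x)))) by ring.
    eapply Rle_trans; [apply Cmod_triangle|]. rewrite Cmod_mult.
    assert (B : Cmod (f (S N)) * Cmod (Cminus (u (S N)) (v (S N) x)) <= m * (e / 2 / m)).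
    { apply Rmult_le_compat; try apply Cmod_ge_0; [unfold m; lra|assumption]. }
    replace (m * (e / 2 / m)) with (e / 2) in B by (field; lra). lra.
Qed.

Definition zeta_combination (f : nat -> C) (q : nat) (s : C) : C :=
  csum (fun r => Cmult (f r) (zeta_class r q s)) q.

Lemma holo_zeta_combination (f : nat -> C) (q : nat) (s : C) :
  0 < Re s -> s <> RtoC 1 -> holo (zeta_combination f q) s.
Proof.
  intros H1 H2. apply (holo_csum (fun r s => Cmult (f r) (zeta_class r q s))).
  intros r Hr. apply holo_mult; [apply holo_const|]. now apply holo_zeta_class.
Qed.

Lemma partial_sum_limit (f : nat -> C) (s l : C) :
  @is_series C_AbsRing C_NormedModule
       (fun m : nat => Cmult (f (S m)) (ncpow (S m) (Copp s))) l ->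
  forall e, 0 < e -> exists N0, forall N, (N0 <= N)%nat ->
    Cmod (Cminus (csum (fun n => Cmult (f n) (cpw (INR n) (Cminus (RtoC 0) s))) N) l) < e.
Proof.
  intros H e He.
  assert (Q : forall n, sum_n (G := C_AbelianGroup)
      (fun m : nat => Cmult (f (S m)) (ncpow (S m) (Copp s))) n =
      csum (fun n => Cmult (f n) (cpw (INR n) (Cminus (RtoC 0) s))) (S n)).
  { assert (E : forall n, ncpow n (Copp s) = cpw (INR n) (Cminus (RtoC 0) s)).
    { intros n. unfold ncpow, cpw. f_equal. ring. }
    induction n as [|n IH].
    - rewrite sum_O, E. exact (eq_sym (Cplus_0_l _)).
    - rewrite sum_Sn, IH, E. reflexivity. }
  destruct (H (fun z => Cmod (Cminus z l) < e)) as [N0 HN0].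
  { apply (locally_C_iff l). now exists e. }
  exists (S N0). intros [|N] HN; [lia|]. rewrite <- Q. apply HN0. lia.
Qed.

(** Summed over [r] with weights [f r], the truncated class sums are a partial sum of the Dirichlet
    series, by periodicity, and the corrections tend to 0 because [1 < Re s]. *)
Lemma L_eq_zeta_combination_right (f : nat -> C) (q : nat) (L : C -> C) (s : C) :
  (1 <= q)%nat -> periodic q f -> is_L_function f L -> 1 < Re s ->
  L s = zeta_combination f q s.
Proof.
  intros Hq Hf [HL _] Hs.
  assert (Hs1 : s <> RtoC 1) by (intros ->; simpl in Hs; lra).
  assert (Hs1' : Cminus (RtoC 1) s <> RtoC 0).
  { apply Cminus_neq_0. intros E; now apply Hs1. }
  assert (HM := proj1 (Cmod_gt_0 _) Hs1').
  assert (Pq : 0 < INR q) by (apply lt_0_INR; lia).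
  apply Ceq_eps. intros e He.
  destruct (partial_sum_limit f s (L s) (HL s Hs) (e / 3) ltac:(lra)) as [N0 HN0].
  destruct (csum_limit f (fun r => zeta_class r q s) (fun r x => zeta_approx r q x s) q)
    with (e := e / 3) as [X1 HX1].
  { intros r Hr e' He'.
    destruct (zeta_class_uniform r q (Re s) (Cmod s) e' Hr ltac:(lra) He') as (X & _ & HX).
    exists X. intros x Hx. apply HX; try assumption; lra. }
  { lra. }
  (* The modulus of the total correction at [x] is this constant times [x^-(Re s - 1)]. *)
  destruct (decay_small (Cmod (csum f q) * / INR q * / Cmod (Cminus (RtoC 1) s))
     (Re s - 1) (e / 3)) as (X2 & HX2 & HX2'); [lra|lra|].
  destruct (archimed (Rmax X1 X2)) as [A1 _].
  assert (M1 := Rmax_l X1 X2). assert (M2 := Rmax_r X1 X2).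
  assert (A2 : (0 <= up (Rmax X1 X2))%Z) by (apply le_IZR; lra).
  set (N := (Z.to_nat (up (Rmax X1 X2)) + N0)%nat).
  assert (HN : Rmax X1 X2 <= INR N).
  { unfold N. rewrite plus_INR, INR_IZR_INZ, Z2Nat.id by assumption.
    assert (P := pos_INR N0). lra. }
  specialize (HX1 (INR N) ltac:(lra)). specialize (HX2' (INR N) ltac:(lra)).
  specialize (HN0 N ltac:(unfold N; lia)).
  assert (IP : Z.to_nat (Int_part (INR N)) = N) by (apply Int_part_nat; lra).
  assert (E : csum (fun r => Cmult (f r) (zeta_approx r q (INR N) s)) q =
    Cminus (csum (fun n => Cmult (f n) (cpw (INR n) (Cminus (RtoC 0) s))) N)
      (Cmult (Cmult (RtoC (/ INR q)) (power_antideriv (INR N) s)) (csum f q))).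
  { rewrite (csum_ext _ (fun r => Cplus (Cmult (f r) (csum (class_term r q s) N))
      (Cmult (Copp (Cmult (RtoC (/ INR q)) (power_antideriv (INR N) s))) (f r)))).
    - rewrite csum_plus, csum_scal, csum_classes_total by assumption. ring.
    - intros r _. unfold zeta_approx. rewrite IP. ring. }
  rewrite E in HX1. fold (zeta_combination f q s) in HX1.
  set (P := Cmult (Cmult (RtoC (/ INR q)) (power_antideriv (INR N) s)) (csum f q)) in *.
  set (Sm := csum (fun n => Cmult (f n) (cpw (INR n) (Cminus (RtoC 0) s))) N) in *.
  assert (HP : Cmod P <= e / 3).
  { eapply Rle_trans; [|exact HX2']. unfold P, power_antideriv.
    rewrite !Cmod_mult, Cmod_R, Rabs_pos_eq by (apply Rlt_le, Rinv_0_lt_compat; lra).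
    unfold Cdiv. rewrite Cmod_mult, Cmod_inv, Cmod_cpw by assumption.
    replace (Re (Cminus (RtoC 1) s)) with (- (Re s - 1)) by (unfold Re; simpl; ring).
    right. ring. }
  replace (Cminus (L s) (zeta_combination f q s)) with
    (Copp (Cplus (Cplus (Cminus (zeta_combination f q s) (Cminus Sm P)) (Cminus Sm (L s)))
       (Copp P))) by ring.
  rewrite Cmod_opp. eapply Rle_trans; [apply Cmod_triangle|].
  rewrite Cmod_opp.
  assert (T := Cmod_triangle (Cminus (zeta_combination f q s) (Cminus Sm P)) (Cminus Sm (L s))).
  lra.
Qed.

(* Continuation from [Re s > 1] into the strip [0 < Re s < 1]: first through the
   disc with centre [1 + alpha / 2 + i] and radius 1, then down the segment from
   [alpha + i] to [alpha] through a chain of discs of radius [min alpha (1 - alpha)]. *)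
Lemma vanishing_continuation (H : C -> C) (alpha : R) : 0 < alpha < 1 ->
  (forall s, 0 < Re s -> s <> RtoC 1 -> holo H s) ->
  (forall s, 1 < Re s -> H s = RtoC 0) ->
  forall s, Cmod (Cminus s (RtoC alpha)) < Rmin alpha (1 - alpha) -> H s = RtoC 0.
Proof.
  intros Ha HH HZ. set (rho := Rmin alpha (1 - alpha)).
  assert (Hrho : 0 < rho) by (apply Rmin_pos; lra).
  assert (Hr1 : rho <= alpha) by apply Rmin_l.
  assert (Hr2 : rho <= 1 - alpha) by apply Rmin_r.
  set (c := (1 + alpha / 2, 1) : C).
  (* The height 1 of the centre keeps the point 1 out of the disc, and its real part leaves a disc
     of radius [alpha / 2] around [c] inside [1 < Re s]. *)
  assert (B0 : forall s, Cmod (Cminus s c) < 1 -> H s = RtoC 0).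
  { apply identity_disc with (alpha / 2).
    - intros s Hs. apply HH.
      + assert (T := Re_near s c 1 Hs). unfold c in T; simpl in T. lra.
      + intros ->. assert (T := im_le_Cmod (Cminus (RtoC 1) c)).
        replace (Im (Cminus (RtoC 1) c)) with (- (1)) in T by (unfold c, Im; simpl; ring).
        rewrite Rabs_Ropp, Rabs_R1 in T. lra.
    - lra.
    - intros s Hs. apply HZ. assert (T := Re_near s c _ Hs). unfold c in T; simpl in T. lra. }
  (* A disc of radius [rho] centred on the line [Re s = alpha] stays in the strip [0 < Re s < 1], so
     vanishing near its centre spreads over all of it. *)
  assert (Disc : forall t d, 0 < d ->
    (forall s, Cmod (Cminus s (alpha, t)) < d -> H s = RtoC 0) ->
    forall s, Cmod (Cminus s (alpha, t)) < rho -> H s = RtoC 0).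
  { intros t d Hd H0. apply identity_disc with d; try assumption.
    intros s Hs. assert (A := re_le_Cmod (Cminus s (alpha, t))).
    replace (Re (Cminus s (alpha, t))) with (Re s - alpha) in A by (unfold Re; simpl; ring).
    assert (A' : Rabs (Re s - alpha) < rho) by lra. apply Rabs_def2 in A'.
    apply HH; [lra|]. intros ->. simpl in A'. lra. }
  assert (Chain : forall n t, 1 - INR n * (rho / 2) <= t <= 1 ->
    exists d, 0 < d /\ forall s, Cmod (Cminus s (alpha, t)) < d -> H s = RtoC 0).
  { induction n as [|n IH]; intros t Ht.
    - simpl in Ht. assert (t = 1) by lra. subst t.
      (* The distance from [alpha + i] to [c] is [1 - alpha / 2], which leaves [alpha / 2] inside
         the unit disc. *)
      exists (alpha / 2). split; [lra|]. intros s Hs. apply B0.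
      replace (Cminus s c) with (Cplus (Cminus s (alpha, 1)) (RtoC (- (1 - alpha / 2))))
        by (unfold c; apply injective_projections; simpl; field).
      eapply Rle_lt_trans; [apply Cmod_triangle|].
      rewrite Cmod_R, Rabs_Ropp, Rabs_pos_eq by lra. lra.
    - rewrite S_INR in Ht. set (t' := Rmin 1 (t + rho / 2)).
      assert (Ht' : t <= t' <= t + rho / 2 /\ 1 - INR n * (rho / 2) <= t' <= 1).
      { assert (C1 := Rmin_l 1 (t + rho / 2)). assert (C2 := Rmin_r 1 (t + rho / 2)).
        fold t' in C1, C2. assert (P := pos_INR n).
        assert (0 <= INR n * (rho / 2)) by (apply Rmult_le_pos; lra).
        assert (C3 : t <= t') by (apply Rmin_glb; lra).
        assert (C4 : 1 - INR n * (rho / 2) <= t') by (apply Rmin_glb; lra). lra. }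
      destruct (IH t' ltac:(lra)) as (d & Hd & H0).
      (* The centres differ by at most [rho / 2], so the smaller disc lies in the disc of radius
         [rho] around the previous centre. *)
      exists (rho / 2). split; [lra|]. intros s Hs. apply (Disc t' d Hd H0).
      replace (Cminus s (alpha, t')) with
        (Cplus (Cminus s (alpha, t)) (Cmult (RtoC (t - t')) Ci))
        by (apply injective_projections; simpl; ring).
      eapply Rle_lt_trans; [apply Cmod_triangle|].
      rewrite Cmod_mult, Cmod_Ci, Cmod_R, Rabs_left1 by lra. lra. }
  (* Steps of length [rho / 2] cover the unit segment when there are at least [2 / rho] of them. *)
  destruct (archimed (2 / rho)) as [A1 _].
  assert (A0 : 0 < 2 / rho) by (apply Rdiv_lt_0_compat; lra).
  assert (A2 : (0 <= up (2 / rho))%Z) by (apply le_IZR; lra).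
  destruct (Chain (Z.to_nat (up (2 / rho))) 0) as (d & Hd & H0).
  - split; [|lra]. rewrite INR_IZR_INZ, Z2Nat.id by assumption.
    assert (E : 2 / rho * (rho / 2) = 1) by (field; lra).
    assert (2 / rho * (rho / 2) <= IZR (up (2 / rho)) * (rho / 2))
      by (apply Rmult_le_compat_r; lra). lra.
  - exact (Disc 0 d Hd H0).
Qed.

Lemma coef_zeta_class_limit (r q : nat) (alpha rho e : R) (k : nat) : (1 <= r <= q)%nat ->
  0 < alpha < 1 -> 0 < rho < Rmin alpha (1 - alpha) -> 0 < e ->
  exists X, 1 <= X /\ forall x, X <= x ->
    Cmod (Cminus (coef (zeta_class r q) (RtoC alpha) rho k)
       (RtoC ((-1) ^ k / INR (fact k) * zeta_partial k alpha r q x))) <= e.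
Proof.
  intros Hr Ha Hrho He.
  assert (M1 := Rmin_l alpha (1 - alpha)). assert (M2 := Rmin_r alpha (1 - alpha)).
  assert (Hp : 0 < (/ rho) ^ k) by (apply pow_lt, Rinv_0_lt_compat; lra).
  (* The accuracy on the circle is chosen to cancel the factor [(/ rho) ^ k] of Cauchy's estimate;
     [alpha - rho] and [alpha + rho] bound [Re s] from below and [Cmod s] from above there. *)
  destruct (zeta_class_uniform r q (alpha - rho) (alpha + rho) (e / (/ rho) ^ k) Hr)
    as (X & HX1 & HX); [lra|now apply Rdiv_lt_0_compat|].
  assert (Reg : forall s, Cmod (Cminus s (RtoC alpha)) = rho ->
     alpha - rho <= Re s /\ Cmod s <= alpha + rho /\ s <> RtoC 1).
  { intros s Hs. assert (A := re_le_Cmod (Cminus s (RtoC alpha))).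
    replace (Re (Cminus s (RtoC alpha))) with (Re s - alpha) in A by (unfold Re; simpl; ring).
    rewrite Hs in A. apply Rabs_le_between in A. split; [lra|]. split.
    - replace s with (Cplus (RtoC alpha) (Cminus s (RtoC alpha))) by ring.
      eapply Rle_trans; [apply Cmod_triangle|]. rewrite Hs, Cmod_R, Rabs_pos_eq; lra.
    - intros ->. simpl in A. lra. }
  exists X. split; [assumption|]. intros x Hx.
  rewrite <- (coef_zeta_approx r q x alpha rho k) by (try lia; lra).
  assert (C1 : circle_continuous (zeta_class r q) (RtoC alpha) rho).
  { intros s Hs. destruct (Reg s Hs) as (R1 & R2 & R3).
    apply holo_continuous, holo_zeta_class; [assumption|lra|assumption]. }
  assert (C2 : circle_continuous (zeta_approx r q x) (RtoC alpha) rho).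
  { intros s Hs. apply holo_continuous, holo_zeta_approx. now apply Reg. }
  rewrite <- coef_minus by (try assumption; lra).
  replace e with (e / (/ rho) ^ k * (/ rho) ^ k) by (unfold Rdiv; rewrite Rmult_assoc, Rinv_l by lra; ring).
  apply coef_bound; [lra| |].
  - intros s Hs. apply continuous_Cminus; [now apply C1|now apply C2].
  - intros s Hs. destruct (Reg s Hs) as (R1 & R2 & R3). now apply HX.
Qed.

(** The coefficient is a limit of real numbers: its real part yields the limit that defines
    [zeta_k], and its imaginary part has to vanish. *)
Lemma zeta_partial_limit (r q : nat) (alpha rho : R) (k : nat) : (1 <= r <= q)%nat ->
  0 < alpha < 1 -> 0 < rho < Rmin alpha (1 - alpha) ->
  ex_finite_lim (zeta_partial k alpha r q) p_infty /\
  coef (zeta_class r q) (RtoC alpha) rho k =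
    RtoC ((-1) ^ k / INR (fact k) * zeta_k k alpha r q).
Proof.
  intros Hr Ha Hrho.
  set (c := coef (zeta_class r q) (RtoC alpha) rho k).
  set (b := (-1) ^ k / INR (fact k)).
  assert (Hf : 0 < INR (fact k)) by apply INR_fact_lt_0.
  assert (Hb : b <> 0).
  { unfold b, Rdiv. apply Rmult_integral_contrapositive_currified.
    - apply pow_nonzero. lra.
    - apply Rinv_neq_0_compat. lra. }
  assert (Hlim := fun e => coef_zeta_class_limit r q alpha rho e k Hr Ha Hrho).
  fold c b in Hlim. clearbody b c.
  assert (L1 : is_lim (zeta_partial k alpha r q) p_infty (Re c / b)).
  { apply is_lim_spec. intros e.
    assert (Pb : 0 < Rabs b) by now apply Rabs_pos_lt.
    destruct (Hlim (Rabs b * (e / 2))) as (X & _ & HX).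
    { apply Rmult_lt_0_compat; [assumption|]. destruct e; simpl; lra. }
    exists X. intros x Hx. specialize (HX x ltac:(lra)).
    assert (A := re_le_Cmod (Cminus c (RtoC (b * zeta_partial k alpha r q x)))).
    replace (Re (Cminus c (RtoC (b * zeta_partial k alpha r q x)))) with
      (b * (- (zeta_partial k alpha r q x - Re c / b))) in A
      by (unfold Re; simpl; field; assumption).
    rewrite Rabs_mult, Rabs_Ropp in A.
    apply Rle_lt_trans with (e / 2); [|destruct e; simpl; lra].
    apply Rmult_le_reg_l with (Rabs b); [assumption|lra]. }
  split; [now exists (Re c / b)|].
  unfold zeta_k. rewrite (is_lim_unique _ _ _ L1). simpl real.
  replace (b * (Re c / b)) with (Re c) by (field; assumption).
  apply injective_projections; [reflexivity|].
  change (Im c = 0). apply Rminus_diag_uniq. rewrite Rminus_0_r.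
  destruct (Req_dec (Im c) 0) as [E|E]; [assumption|exfalso].
  assert (Pc := Rabs_pos_lt _ E).
  destruct (Hlim (Rabs (Im c) / 2) ltac:(lra)) as (X & _ & HX).
  specialize (HX X ltac:(lra)).
  assert (A := im_le_Cmod (Cminus c (RtoC (b * zeta_partial k alpha r q X)))).
  replace (Im (Cminus c (RtoC (b * zeta_partial k alpha r q X)))) with (Im c) in A
    by (unfold Im; simpl; ring).
  lra.
Qed.

Lemma L_eq_zeta_combination (alpha : R) (f : nat -> C) (q : nat) (L : C -> C) (s : C) :
  0 < alpha < 1 -> (1 <= q)%nat -> periodic q f -> is_L_function f L ->
  Cmod (Cminus s (RtoC alpha)) < Rmin alpha (1 - alpha) ->
  L s = zeta_combination f q s.
Proof.
  intros Ha Hq Hf HL Hs. apply Cminus_eq_0.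
  apply (vanishing_continuation (fun s => Cminus (L s) (zeta_combination f q s)) alpha);
    try assumption.
  - intros z Hz Hz1. apply holo_minus.
    + apply holo_Cdifferentiable. now apply HL.
    + now apply holo_zeta_combination.
  - intros z Hz. rewrite (L_eq_zeta_combination_right f q L z) by assumption. ring.
Qed.

Lemma coef_L (alpha rho : R) (f : nat -> C) (q : nat) (L : C -> C) (k : nat) :
  0 < alpha < 1 -> (1 <= q)%nat -> periodic q f -> is_L_function f L ->
  0 < rho < Rmin alpha (1 - alpha) ->
  coef L (RtoC alpha) rho k =
  Cmult (RtoC ((-1) ^ k / INR (fact k))) (sum_f_zeta f k alpha q).
Proof.
  intros Ha Hq Hf HL Hrho.
  assert (M1 := Rmin_l alpha (1 - alpha)). assert (M2 := Rmin_r alpha (1 - alpha)).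
  rewrite (coef_ext L (zeta_combination f q));
    [|lra|intros s Hs; apply (L_eq_zeta_combination alpha); try assumption; lra].
  assert (HZ : forall r, (1 <= r <= q)%nat ->
    disc_holo (zeta_class r q) (RtoC alpha) (Rmin alpha (1 - alpha))).
  { intros r Hr s Hs. assert (A := re_le_Cmod (Cminus s (RtoC alpha))).
    replace (Re (Cminus s (RtoC alpha))) with (Re s - alpha) in A by (unfold Re; simpl; ring).
    assert (A' : Rabs (Re s - alpha) < Rmin alpha (1 - alpha)) by lra.
    apply Rabs_def2 in A'.
    apply holo_zeta_class; [assumption|lra|]. intros ->. simpl in A'. lra. }
  unfold zeta_combination.
  rewrite (coef_csum (fun r s => Cmult (f r) (zeta_class r q s)) q _ (Rmin alpha (1 - alpha)) rho k Hrho).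
  - unfold sum_f_zeta. rewrite csum_sum_n_m, <- csum_scal. apply csum_ext.
    intros r Hr. rewrite coef_scal; [|lra|].
    + destruct (zeta_partial_limit r q alpha rho k Hr Ha Hrho) as [_ E].
      rewrite E, RtoC_mult. ring.
    + apply disc_holo_circle with (Rmin alpha (1 - alpha)); [now apply HZ|lra].
  - intros r Hr s Hs. apply holo_mult; [apply holo_const|now apply HZ].
Qed.

Theorem theorem4 (alpha : R) (q : nat) (f : nat -> C) (L : C -> C)
    (Halpha : 0 < alpha < 1) (Hq : (1 <= q)%nat)
    (Hf : periodic q f) (HL : is_L_function f L) :
  (forall k r : nat, (1 <= r <= q)%nat ->
     ex_finite_lim (zeta_partial k alpha r q) p_infty)
  /\ (forall s : C, Cmod (Cminus s (RtoC alpha)) < Rabs (alpha - 1) ->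
        @is_pseries C_AbsRing C_NormedModule
          (fun k : nat =>
             Cmult (RtoC ((-1) ^ k / INR (fact k))) (sum_f_zeta f k alpha q))
          (Cminus s (RtoC alpha)) (L s))
  /\ (forall k : nat,
        is_C_derive_n L k (RtoC alpha)
          (Cmult (RtoC ((-1) ^ k)) (sum_f_zeta f k alpha q))).
Proof.
  assert (P : 0 < Rmin alpha (1 - alpha)) by (apply Rmin_pos; lra).
  set (rho := Rmin alpha (1 - alpha) / 2).
  assert (Hrho : 0 < rho < Rmin alpha (1 - alpha)) by (unfold rho; lra).
  assert (Hrho' : 0 < rho < 1 - alpha) by (assert (M := Rmin_r alpha (1 - alpha)); lra).
  assert (HD : disc_holo L (RtoC alpha) (1 - alpha)).
  { intros s Hs. apply holo_Cdifferentiable. apply HL. intros ->.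
    rewrite <- RtoC_minus, Cmod_R, Rabs_pos_eq in Hs; lra. }
  assert (HC := fun k => coef_L alpha rho f q L k Halpha Hq Hf HL Hrho).
  split; [|split].
  - intros k r Hr. now apply (zeta_partial_limit r q alpha rho k).
  - intros s Hs. rewrite Rabs_left in Hs by lra.
    replace (- (alpha - 1)) with (1 - alpha) in Hs by ring.
    assert (N := Cmod_ge_0 (Cminus s (RtoC alpha))).
    set (r := (Cmod (Cminus s (RtoC alpha)) + (1 - alpha)) / 2).
    assert (T := taylor_series L (RtoC alpha) (1 - alpha) r (Cminus s (RtoC alpha)) HD
      ltac:(unfold r; lra)).
    replace (Cplus (RtoC alpha) (Cminus s (RtoC alpha))) with s in T by ring.
    eapply (is_pseries_ext (V := C_NormedModule)); [|exact T].
    (* [HC] knows the coefficients on the small circle of radius [rho]; the expansion needs them on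
       the circle of radius [r], which encloses [s]. *)
    intros k. rewrite <- HC. apply coef_radius with (1 - alpha); [assumption| |assumption].
    unfold r; lra.
  - assert (E : forall k, C_derive_n L k (RtoC alpha) =
       Cmult (RtoC ((-1) ^ k)) (sum_f_zeta f k alpha q)).
    { intros k. rewrite (C_derive_n_coef L (RtoC alpha) (1 - alpha) rho k HD Hrho'), HC.
      rewrite Cmult_assoc, <- RtoC_mult. f_equal. f_equal. field. apply INR_fact_neq_0. }
    intros [|k].
    + exact (E 0%nat).
    + rewrite <- E. simpl. apply cderiv_is_derive, holo_C_derive.
      apply (disc_holo_C_derive_n L (RtoC alpha) (1 - alpha) k HD).
      replace (Cminus (RtoC alpha) (RtoC alpha)) with (RtoC 0) by ring. rewrite Cmod_0. lra.
Qed.
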